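(* Let $n\ge1$. For every $n$-dimensional complex semisimple Jordan algebra $\mu\in\mathcal J_n$, the orbit $GL(n,\mathbb C)\cdot\mu$ (its isomorphism class) is distinguished, i.e. contains a soliton. Further, the semisimple Jordan solitons are characterized among Jordan algebras of dimension $n$ as having the lowest possible value of the energy: for $\mu\in\mathcal J_n\setminus\{0\}$, $E_n(\mu)=\min_{\nu\in\mathcal J_n\setminus\{0\}}E_n(\nu)$ if and only if $\mu$ is a soliton and $(\mathbb C^n,\mu)$ is semisimple.
   Context: Fix a Hermitian inner product $\langle\cdot,\cdot\rangle$ on $\mathbb C^n$. $V_n=S^2(\mathbb C^{n*})\otimes\mathbb C^n$ is the space of symmetric bilinear maps $\mu:\mathbb C^n\times\mathbb C^n\to\mathbb C^n$, identified with commutative (not necessarily associative) algebras $(\mathbb C^n,\mu)$. It carries the Hermitian product $\langle\mu,\nu\rangle=\sum_{i,j,k}\langle\mu(x_i,x_j),x_k\rangle\overline{\langle\nu(x_i,x_j),x_k\rangle}$, with $(x_i)$ any orthonormal basis. The group $GL(n,\mathbb C)$ acts on $V_n$ by $(g\cdot\mu)(a,b)=g\mu(g^{-1}a,g^{-1}b)$, so orbits are isomorphism classes; $A\in\mathfrak{gl}(n,\mathbb C)$ acts by $(A\cdot\mu)(x,y)=A\mu(x,y)-\mu(Ax,y)-\mu(x,Ay)$. The moment matrix $M_\mu$ is the unique Hermitian endomorphism of $\mathbb C^n$ with $\mathrm{Tr}(M_\mu A)=\langle A\cdot\mu,\mu\rangle$ for all Hermitian $A$. For $\mu\neq0$: $m(\mu)=M_\mu/\|\mu\|^2$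 and $E_n(\mu)=\mathrm{Tr}(m(\mu)^2)$. A soliton is a critical point of $E_n:V_n\setminus\{0\}\to\mathbb R$. A $GL(n,\mathbb C)$-orbit is distinguished if it contains a soliton. $\mathcal J_n\subset V_n$ is the set of Jordan algebras, i.e. those $\mu$ satisfying $[L_a,L_{a^2}]=0$ for all $a$, where $L_a$ is multiplication by $a$. A Jordan algebra is simple if its square is nonzero and it has no nontrivial ideals, and semisimple if it is a direct product of simple Jordan algebras. *)

(* Defs.v *)
From HB Require Import structures.
From mathcomp Require Import all_boot all_order all_algebra.
From mathcomp Require Import all_classical all_reals all_analysis.
From mathcomp Require Export complex.
Set Implicit Arguments.
Unset Strict Implicit.
Unset Printing Implicit Defensive.

Import Order.TTheory GRing.Theory Num.Theory.
Import numFieldNormedType.Exports.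

Local Open Scope classical_set_scope.
Local Open Scope ring_scope.
Local Open Scope complex_scope.

Definition algebra_law (R : realType) (n : nat) : Type :=
  'cV[R[i]]_n -> 'cV[R[i]]_n -> 'cV[R[i]]_n.

(* The vector space [V_n] is the subset [sym_bilinear] of [algebra_law R n];
   its linear structure is the pointwise one. *)
Definition sym_bilinear (R : realType) (n : nat) (mu : algebra_law R n) : Prop :=
  (forall a, linear (mu a)) /\ (forall a b, mu a b = mu b a).

(* Jordan identity: [L_a] and [L_(a^2)] commute, where [L_a] is [mu a]. *)
Definition jordan (R : realType) (n : nat) (mu : algebra_law R n) : Prop :=
  sym_bilinear mu /\
  forall a, mu a \o mu (mu a a) = mu (mu a a) \o mu a.

Definition ideal (R : realType) (n : nat) (mu : algebra_law R n)
    (I : {vspace 'cV[R[i]]_n}) : Prop :=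
  forall a x, x \in I -> mu a x \in I.

Definition simple_jordan (R : realType) (n : nat) (mu : algebra_law R n) : Prop :=
  [/\ jordan mu,
      exists a b, mu a b <> 0
    & forall I : {vspace 'cV[R[i]]_n}, ideal mu I -> I = 0%VS \/ I = fullv].

(* The algebra [mu] is the direct product of the [nu i] when there are algebra
   morphisms [p i] to the factors such that [v |-> (p i v)_i] is a bijection onto
   the product. *)
Definition semisimple_jordan (R : realType) (n : nat) (mu : algebra_law R n) : Prop :=
  exists (k : nat) (d : 'I_k -> nat) (nu : forall i, algebra_law R (d i))
         (p : forall i, {linear 'cV[R[i]]_n -> 'cV[R[i]]_(d i)}),
    [/\ forall i, simple_jordan (nu i),
        forall i a b, p i (mu a b) = nu i (p i a) (p i b)
      & forall y : (forall i, 'cV[R[i]]_(d i)),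
          exists! v, forall i, p i v = y i].

Definition gl_act (R : realType) (n : nat) (g : 'M[R[i]]_n)
    (mu : algebra_law R n) : algebra_law R n :=
  fun a b => g *m mu (invmx g *m a) (invmx g *m b).

Definition gl_orbit (R : realType) (n : nat) (mu : algebra_law R n) :
    set (algebra_law R n) :=
  [set nu | exists2 g, g \in unitmx & nu = gl_act g mu].

Definition lie_act (R : realType) (n : nat) (A : 'M[R[i]]_n)
    (mu : algebra_law R n) : algebra_law R n :=
  fun a b => A *m mu a b - mu (A *m a) b - mu a (A *m b).

(* In what follows [h] is the inner product on [C^n], linear in its first
   argument, and [x] is an [h]-orthonormal basis; the product [alg_dot h x] does not
   depend on the choice of [x]. *)
Definition alg_dot (R : realType) (n : nat)
    (h : {dot 'cV[R[i]]_n for Num.conj}) (x : n.-tuple 'cV[R[i]]_n)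
    (mu nu : algebra_law R n) : R[i] :=
  \sum_(i < n) \sum_(j < n) \sum_(k < n)
    h (mu (tnth x i) (tnth x j)) (tnth x k) *
    Num.conj (h (nu (tnth x i) (tnth x j)) (tnth x k)).

Definition hermitian_endo (R : realType) (n : nat)
    (h : {dot 'cV[R[i]]_n for Num.conj}) (A : 'M[R[i]]_n) : Prop :=
  forall u v, h (A *m u) v = h u (A *m v).

Definition moment_matrix (R : realType) (n : nat)
    (h : {dot 'cV[R[i]]_n for Num.conj}) (x : n.-tuple 'cV[R[i]]_n)
    (mu : algebra_law R n) : 'M[R[i]]_n :=
  xget 0 [set M | hermitian_endo h M /\
    forall A, hermitian_endo h A -> \tr (M *m A) = alg_dot h x (lie_act A mu) mu].

Definition normalized_moment (R : realType) (n : nat)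
    (h : {dot 'cV[R[i]]_n for Num.conj}) (x : n.-tuple 'cV[R[i]]_n)
    (mu : algebra_law R n) : 'M[R[i]]_n :=
  (alg_dot h x mu mu)^-1 *: moment_matrix h x mu.

(* The trace of the square of a Hermitian endomorphism is real; [complex.Re] only
   serves to land in [R]. *)
Definition energy (R : realType) (n : nat)
    (h : {dot 'cV[R[i]]_n for Num.conj}) (x : n.-tuple 'cV[R[i]]_n)
    (mu : algebra_law R n) : R :=
  complex.Re (\tr (normalized_moment h x mu *m normalized_moment h x mu)).

(* Critical point of the energy on [V_n] minus the origin, regarded as a real
   manifold: the differential vanishes on every tangent vector [nu] in [V_n]. *)
Definition soliton (R : realType) (n : nat)
    (h : {dot 'cV[R[i]]_n for Num.conj}) (x : n.-tuple 'cV[R[i]]_n)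
    (mu : algebra_law R n) : Prop :=
  [/\ sym_bilinear mu, mu <> (fun _ _ => 0)
    & forall nu : algebra_law R n, sym_bilinear nu ->
        is_derive (0 : R) (1 : R)
          (fun t : R => energy h x (fun a b => mu a b + t%:C *: nu a b)) 0].

Definition distinguished (R : realType) (n : nat)
    (h : {dot 'cV[R[i]]_n for Num.conj}) (x : n.-tuple 'cV[R[i]]_n)
    (O : set (algebra_law R n)) : Prop :=
  exists2 nu, O nu & soliton h x nu.

Definition nonzero_jordan (R : realType) (n : nat) : set (algebra_law R n) :=
  [set mu | jordan mu /\ mu <> (fun _ _ => 0)].

Definition energy_is_min (R : realType) (n : nat)
    (h : {dot 'cV[R[i]]_n for Num.conj}) (x : n.-tuple 'cV[R[i]]_n)
    (S : set (algebra_law R n)) (mu : algebra_law R n) : Prop :=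
  S mu /\ forall nu, S nu -> energy h x mu <= energy h x nu.

(* Main.v *)
(** Since [Tr M = - |mu|^2], splitting off the trace part of [M] gives [E >= 1/n]
    with equality exactly when [M] is a multiple of the identity; call such an
    algebra balanced. Both claims then reduce to relating balanced and semisimple.

    If [mu] is balanced, testing [M] against the orthogonal projection onto an
    ideal shows that nonzero ideals have nonzero square, and a Jordan algebra with
    this property splits off its minimal ideals, hence is semisimple. A balanced
    [mu] is a critical point. Conversely, at a critical point [M + Tr(M^2)/|mu|^2]
    is a derivation; if [mu] is semisimple, its trace form is nondegenerate, so
    derivations are inner and traceless, and the trace of this one is the defect
    in [E >= 1/n].

    To find a balanced point in the orbit of a semisimple [mu], fix a maximal
    independent family [T_k] of commuting Hermitian derivations among all algebras
    of the orbit, and minimize [|exp(b) U^* mu|^2] over unitary [U] diagonalizing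
    the [T_k] and real traceless diagonal [b] orthogonal to them. The infimum is
    attained unless some direction [b] does not increase the norm. Such a degeneration
    of a nondegenerate Jordan algebra is trivial up to a unipotent conjugation, which
    yields one more derivation and contradicts maximality. *)
Require Import Defs.
From HB Require Import structures.
From mathcomp Require Import all_boot all_order all_algebra.
From mathcomp Require Import all_classical all_reals all_analysis.
From mathcomp Require Import complex perm ring lra.
Set Implicit Arguments.
Unset Strict Implicit.
Unset Printing Implicit Defensive.
Import Order.TTheory GRing.Theory Num.Theory.
Import numFieldNormedType.Exports.
Local Open Scope classical_set_scope.
Local Open Scope ring_scope.

(** * Nilpotent families of matrices *)

(** The existence of a minimum is a compactness argument. A unimodular [g] matters for the norm only
    through [g^* g], hence through a unitary frame and real exponents [b]; frames form a compact
    set, so only [b] can escape. Flat directions do occur: along a Hermitian derivation the norm is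
    constant. They are removed by admitting only [g] for which [g^* g] commutes with the [T_k], and
    by taking [b] orthogonal to the [T_k]. The restricted problem still sees the whole moment matrix
    [M]: it commutes with every Hermitian derivation, so the variation along its traceless part
    stays among the competitors.

    The other ingredient, nondegeneracy of the trace form [tr (L_x L_y)], is obtained without
    classification. The operators that come from its radical form a weakly closed set of nilpotents;
    by Engel's theorem they have a common kernel, which is invariant and therefore fills a minimal
    ideal. Nilpotency is read off from traces: a polynomial that conjugates the eigenvalues turns a
    vanishing trace into a vanishing sum of squared moduli. *)

Lemma mxscaleAl (F : comPzRingType) n (c : F) (X Y : 'M[F]_n) : (c *: X) * Y = c *: (X * Y).
Proof. by rewrite -[LHS]scalemxAl. Qed.

Lemma mxscaleAr (F : comPzRingType) n (c : F) (X Y : 'M[F]_n) : X * (c *: Y) = c *: (X * Y).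
Proof. by rewrite -[LHS]scalemxAr. Qed.

Section Engel.
Variables (F : fieldType) (n : nat).
Implicit Types (X Y b s : 'M[F]_n) (w : seq 'M[F]_n) (B : {vspace 'M[F]_n}).

Definition wprod w : 'M[F]_n := foldr *%R 1 w.

Definition comm X Y : 'M[F]_n := X * Y - Y * X.

Definition word_nil B k := forall w, all (mem B) w -> size w = k -> wprod w = 0.

Definition wkills B k X :=
  forall w, all (mem B) w -> size w = k -> wprod w * X = 0.

Lemma wprod_cat w w' : wprod (w ++ w') = wprod w * wprod w'.
Proof. by elim: w => [|b w IH] /=; rewrite ?mul1r // IH mulrA. Qed.

Lemma wkillsS B k X : wkills B k X -> wkills B k.+1 X.
Proof.
by move=> kX [|b w] //= /andP[_ Bw] [sw]; rewrite -mulrA kX // mulr0.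
Qed.

Lemma wkills_mul B k b X : b \in B -> wkills B k.+1 X -> wkills B k (b * X).
Proof.
move=> Bb kX w Bw sw; have -> : wprod w * (b * X) = wprod (w ++ [:: b]) * X.
  by rewrite wprod_cat /= mulr1 mulrA.
by apply: kX; rewrite ?size_cat ?sw ?addn1 // all_cat Bw /= Bb.
Qed.

Lemma wkillsD B k X Y : wkills B k X -> wkills B k Y -> wkills B k (X + Y).
Proof. by move=> kX kY w Bw sw; rewrite mulrDr kX // kY // addr0. Qed.

Lemma wkillsZ B k c X : wkills B k X -> wkills B k (c *: X).
Proof. by move=> kX w Bw sw; rewrite mxscaleAr kX // scaler0. Qed.

Lemma wkills_norm B k s X : (forall b, b \in B -> comm b s \in B) ->
  wkills B k X -> wkills B k (s * X).
Proof.
move=> Bs; elim: k X => [|k IH] X kX.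
  by move=> [|//] _ _; rewrite mul1r; have := kX [::] isT erefl; rewrite mul1r => ->; rewrite mulr0.
move=> w; case/lastP: w => [//|w b]; rewrite all_rcons size_rcons => /andP[Bb Bw] [sw].
rewrite -cats1 wprod_cat /= mulr1 -mulrA.
have -> : b * (s * X) = s * (b * X) + comm b s * X.
  by rewrite /comm mulrBl !mulrA addrC subrK.
rewrite mulrDr (IH _ (wkills_mul Bb kX)) // add0r.
exact: (wkills_mul (Bs _ Bb) kX).
Qed.

(** Since [b * s = s * b + comm b s], the occurrences of [s] in a word can be moved to the left at
    the price of letters of [B]. A block of [m] letters applied to [X] thus gives a multiple of
    [s ^+ m * X = 0] plus a matrix that is killed by words of [B] one letter shorter, so [k] blocks
    suffice. *)
Lemma word_nil_add B k s m : (forall b, b \in B -> comm b s \in B) ->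
  s ^+ m = 0 -> word_nil B k -> word_nil (<[s]> + B)%VS (k * m).
Proof.
move=> Bs sm0 Bk.
have step j X u : wkills B j.+1 X -> all (mem (<[s]> + B)%VS) u ->
    exists c Y, wprod u * X = c *: (s ^+ size u * X) + Y /\ wkills B j Y.
  move=> kX; elim: u => [|b u IH] /= => [_|/andP[/memv_addP[_ /vlineP[c' ->]] [b' Bb' ->] Bu]].
    exists 1, 0; split; first by rewrite scale1r !mul1r addr0.
    by move=> w _ _; rewrite mulr0.
  have [c [Y [uE kY]]] := IH Bu.
  have kX' : wkills B j.+1 (s ^+ size u * X).
    elim: (size u) => [|i IHi]; first by rewrite mul1r.
    by rewrite exprS -mulrA; apply: wkills_norm.
  exists (c' * c), (c' *: (s * Y) + (c *: (b' * (s ^+ size u * X)) + b' * Y)); split.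
    rewrite -mulrA uE mulrDl !mulrDr !mxscaleAr !mxscaleAl scalerA [c * c']mulrC.
    by rewrite exprS -!mulrA -!addrA.
  apply: wkillsD; first by apply/wkillsZ/wkills_norm.
  apply: wkillsD; first by apply/wkillsZ/wkills_mul.
  exact/wkills_mul/wkillsS.
have main j u X : wkills B j X -> all (mem (<[s]> + B)%VS) u -> size u = (j * m)%N ->
    wprod u * X = 0.
  elim: j u X => [|j IH] u X kX Bu su.
    by have /eqP := su; rewrite mul0n size_eq0 => /eqP ->; apply: (kX [::]).
  have [u1 [u2 [uE s1 s2]]] : exists u1 u2, [/\ u = u1 ++ u2, size u1 = (j * m)%N & size u2 = m].
    exists (take (j * m) u), (drop (j * m) u); split; first by rewrite cat_take_drop.
      by rewrite size_takel // su mulSn leq_addl.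
    by rewrite size_drop su mulSn addnK.
  move: Bu; rewrite uE all_cat wprod_cat -mulrA => /andP[Bu1 Bu2].
  have [c [Y [-> kY]]] := step _ _ _ kX Bu2.
  by rewrite s2 sm0 mul0r scaler0 add0r; apply: IH.
move=> u Bu su; rewrite -[wprod u]mulr1; apply: (main k) => // w Bw sw.
by rewrite mulr1 Bk.
Qed.

(** Otherwise each element of [S] outside [B] has a commutator with some [t] in [T] that is again
    outside [B]. After [k + k] such commutators, every term of the expansion has at least [k]
    letters of [B] on one side of [s0] and vanishes; but 0 lies in [B]. *)
Lemma ad_escape (B : {vspace 'M[F]_n}) (T : seq 'M[F]_n) k (S : 'M[F]_n -> Prop) s0 :
  word_nil B k -> B = <<T>>%VS -> (forall t, t \in T -> S t) ->
  (forall X Y, S X -> S Y -> S (comm X Y)) -> S s0 -> s0 \notin B ->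
  exists2 s, S s /\ s \notin B & forall b, b \in B -> comm b s \in B.
Proof.
move=> Bk BT TS Scl Ss0 Bs0.
suff: exists2 s, S s /\ s \notin B & forall t, t \in T -> comm t s \in B.
  case=> s Ss Ts; exists s => // b; rewrite BT => /(@coord_span _ _ _ (in_tuple T)) ->.
  rewrite /comm mulr_suml mulr_sumr -sumrB; apply: memv_suml => i _.
  rewrite mxscaleAl mxscaleAr -scalerBr memvZ // -BT.
  by apply: Ts; rewrite mem_nth.
apply: contrapT => noS.
(* [Q j X] is what a [j]-fold commutator satisfies: [k + k - j] further letters around [X], on
   either side, are enough to kill it. *)
pose Q j X := forall w1 w2, all (mem B) w1 -> all (mem B) w2 ->
  (k + k <= size w1 + size w2 + j)%N -> wprod w1 * X * wprod w2 = 0.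
have big w : all (mem B) w -> (k <= size w)%N -> wprod w = 0.
  move=> Bw kw; rewrite -(cat_take_drop k w) wprod_cat [X in X * _]Bk ?mul0r ?size_takel //.
    by move: Bw; rewrite -{1}(cat_take_drop k w) all_cat => /andP[].
have: forall j, exists s, [/\ S s, s \notin B & Q j s].
  elim=> [|j [s [Ss Bs Qs]]].
    exists s0; split => // w1 w2 B1 B2; rewrite addn0 => le.
    case: (leqP k (size w1)) => [l1|l1]; first by rewrite big // !mul0r.
    have l2 : (k <= size w2)%N by rewrite -(leq_add2l k) (leq_trans le) // leq_add2r ltnW.
    by rewrite [wprod w2]big // mulr0.
  have [t Tt Bts] : exists2 t, t \in T & comm t s \notin B.
    apply: contrapT => no; apply: noS; exists s => // t Tt.
    by apply: contrapT => /negP Bts; apply: no; exists t.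
  exists (comm t s); split; first exact: Scl (TS _ Tt) Ss.
    exact: Bts.
  have Bt : t \in B by rewrite BT memv_span.
  move=> w1 w2 B1 B2 le; rewrite /comm mulrBr mulrBl.
  have -> : wprod w1 * (t * s) * wprod w2 = wprod (w1 ++ [:: t]) * s * wprod w2.
    by rewrite wprod_cat /= mulr1 !mulrA.
  have -> : wprod w1 * (s * t) * wprod w2 = wprod w1 * s * wprod (t :: w2).
    by rewrite /= !mulrA.
  have B1t : all (mem B) (w1 ++ [:: t]) by rewrite all_cat B1 /= Bt.
  have B2t : all (mem B) (t :: w2) by rewrite /= Bt.
  rewrite Qs ?Qs ?subrr //.
    by rewrite /= addnS addSn -addnS.
  by rewrite size_cat /= addn1 !addSn -addnS.
case/(_ (k + k)%N) => s [_ Bs Qs]; case/negP: Bs.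
by have := Qs [::] [::] isT isT; rewrite /= mul1r mulr1 add0n leqnn => -> //; rewrite mem0v.
Qed.

(* Engel's theorem for weakly closed sets, following Jacobson: a maximal
   nilpotent span of elements of [S] is normalized by some further element. *)
Lemma engel (S : 'M[F]_n -> Prop) : (0 < n)%N ->
  (forall X, S X -> exists k, X ^+ k = 0) ->
  (forall X Y, S X -> S Y -> S (comm X Y)) ->
  exists2 v : 'cV[F]_n, v != 0 & forall X, S X -> X *m v = 0.
Proof.
move=> n_gt0 Snil Scl.
have [B [k [Bk SB]]] : exists B k, word_nil B k /\ forall X, S X -> X \in B.
  (* Induction on [d], a bound on the codimension of the nilpotent span. *)
  suff gen d (T : seq 'M[F]_n) k : (forall t, t \in T -> S t) -> word_nil <<T>>%VS k ->
      (dim 'M[F]_n <= \dim <<T>>%VS + d)%N ->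
      exists B k, word_nil B k /\ forall X, S X -> X \in B.
    apply: (gen (dim 'M[F]_n) [::] 1) => [//||]; last by rewrite leq_addl.
    move=> [|b [|//]] //=; rewrite span_nil memv0 andbT => /eqP -> _.
    by rewrite mul0r.
  elim: d T k => [|d IH] T k TS Tk le.
    exists <<T>>%VS, k; split=> // X _; suff -> : <<T>>%VS = fullv by rewrite memvf.
    by apply/eqP; rewrite eqEdim subvf dimvf -(addn0 (\dim _)).
  case: (pselect (forall X, S X -> X \in <<T>>%VS)) => [all|/existsNP[s0]].
    by exists <<T>>%VS, k.
  move=> /not_implyP[Ss0 /negP Bs0].
  have [s [Ss Bs] Ns] := ad_escape Tk erefl TS Scl Ss0 Bs0.
  have [m sm] := Snil _ Ss.
  apply: (IH (s :: T) (k * m)%N).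
  - by move=> t; rewrite inE => /orP[/eqP ->|/TS].
  - by rewrite span_cons; apply: word_nil_add.
  - apply: leq_trans le _; rewrite addnS -addSn leq_add2r span_cons.
    rewrite dimv_disjoint_sum; last first.
      apply/eqP; rewrite -subv0; apply/subvP => v; rewrite memv_cap => /andP[/vlineP[c ->] Bcs].
      case: (eqVneq c 0) => [-> |c0]; first by rewrite scale0r mem0v.
      by case/negP: Bs; rewrite -(scale1r s) -(mulVf c0) -scalerA memvZ.
    rewrite -add1n leq_add2r dim_vline.
    by case: eqP Bs => // ->; rewrite mem0v.
(* Descent to the least index: if some word of length [k] is nonzero, any nonzero column of it is
   killed by [S], because all words of length [k.+1] vanish. *)
elim: k Bk => [|k IH] Bk.
  have := Bk [::] isT erefl => /(congr1 (fun M : 'M[F]_n => M (Ordinal n_gt0) (Ordinal n_gt0))).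
  by rewrite !mxE eqxx => /eqP; rewrite oner_eq0.
case: (pselect (word_nil B k)) => [/IH //|/existsNP[w /not_implyP[Bw /not_implyP[sw /eqP w0]]]].
have [j wj] : exists j, wprod w *m delta_mx j 0 != 0 :> 'cV_n.
  apply: contrapT => no; case/negP: w0; apply/eqP/matrixP => i j.
  have /eqP /colP /(_ i) : wprod w *m delta_mx j 0 == 0 :> 'cV_n.
    by apply: contrapT => /negP cj; apply: no; exists j.
  by rewrite -colE !mxE.
exists (wprod w *m delta_mx j 0) => // X SX; rewrite mulmxA.
have -> : X *m wprod w = wprod (X :: w) by [].
by rewrite Bk ?mul0mx //= ?sw // SB.
Qed.

End Engel.

(** * Polynomials in a matrix *)

Section PolyMx.
Variables (C : fieldType) (n : nat).
Implicit Types (A B : 'M[C]_n) (p q : {poly C}).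

(* The value of [p] at [A], total in the size [n] unlike [horner_mx]. *)
Definition pmx A p : 'M[C]_n := \sum_(i < size p) p`_i *: A ^+ i.

End PolyMx.

Section PolyMxTheory.
Variable C : fieldType.
Implicit Types (p q : {poly C}).

Lemma pmx_horner n (A : 'M[C]_n.+1) p : pmx A p = horner_mx A p.
Proof.
rewrite /horner_mx /horner_morph horner_coef size_map_poly; apply: eq_bigr => i _.
by rewrite coef_map /= -mul_scalar_mx.
Qed.

Lemma pmxD n (A : 'M[C]_n) p q : pmx A (p + q) = pmx A p + pmx A q.
Proof.
case: n A => [|n] A; last by rewrite !pmx_horner rmorphD.
by rewrite [LHS]flatmx0 [RHS]flatmx0.
Qed.

Lemma pmxM n (A : 'M[C]_n) p q : pmx A (p * q) = pmx A p * pmx A q.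
Proof.
case: n A => [|n] A; last by rewrite !pmx_horner rmorphM.
by rewrite [LHS]flatmx0 [RHS]flatmx0.
Qed.

Lemma pmxN n (A : 'M[C]_n) p : pmx A (- p) = - pmx A p.
Proof.
case: n A => [|n] A; last by rewrite !pmx_horner rmorphN.
by rewrite [LHS]flatmx0 [RHS]flatmx0.
Qed.

Lemma pmxB n (A : 'M[C]_n) p q : pmx A (p - q) = pmx A p - pmx A q.
Proof. by rewrite pmxD pmxN. Qed.

Lemma pmxC n (A : 'M[C]_n) c : pmx A c%:P = c%:M.
Proof.
case: n A => [|n] A; last by rewrite !pmx_horner horner_mx_C.
by rewrite [LHS]flatmx0 [RHS]flatmx0.
Qed.

Lemma pmxX n (A : 'M[C]_n) : pmx A 'X = A.
Proof.
case: n A => [|n] A; last by rewrite !pmx_horner horner_mx_X.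
by rewrite [LHS]flatmx0 [RHS]flatmx0.
Qed.

Lemma pmx0 n (A : 'M[C]_n) : pmx A 0 = 0.
Proof. by rewrite /pmx size_poly0 big_ord0. Qed.

Lemma pmx1 n (A : 'M[C]_n) : pmx A 1 = 1.
Proof. by rewrite -[1]/(1%:P) pmxC. Qed.

Lemma pmxXn n (A : 'M[C]_n) p k : pmx A (p ^+ k) = pmx A p ^+ k.
Proof. by elim: k => [|k IH]; rewrite ?expr0 ?pmx1 // !exprS pmxM IH. Qed.

Lemma pmx_char n (A : 'M[C]_n) : pmx A (char_poly A) = 0.
Proof.
case: n A => [|n] A; last by rewrite !pmx_horner Cayley_Hamilton.
by rewrite [LHS]flatmx0.
Qed.

Lemma pmx_comm n (A B : 'M[C]_n) p : A * B = B * A -> pmx A p * B = B * pmx A p.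
Proof.
move=> AB; rewrite /pmx mulr_suml mulr_sumr; apply: eq_bigr => i _.
rewrite mxscaleAl mxscaleAr; congr (_ *: _).
by apply/esym/commrX.
Qed.

Lemma coprimep_prod_XsubC_exp (s : seq C) c N M : c \notin s ->
  coprimep (\prod_(d <- s) ('X - d%:P) ^+ N) (('X - c%:P) ^+ M).
Proof.
move=> cs; rewrite coprimep_expr // prodrXl coprimep_expl // coprimep_XsubC.
by rewrite root_prod_XsubC.
Qed.

(** Chinese remainders for the coprime moduli [('X - c)^N]. The order [N] makes the polynomial act
    as the scalar [f c] on a whole generalized eigenspace, not just on eigenvectors. *)
Lemma hermite_interpolation (s : seq C) (f : C -> C) N : uniq s ->
  exists q : {poly C}, forall c, c \in s -> ('X - c%:P) ^+ N %| q - (f c)%:P.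
Proof.
elim: s => [|c s IH] /=; first by exists 0.
case/andP=> cs us; have [q qP] := IH us.
pose P := \prod_(d <- s) ('X - d%:P) ^+ N.
have cP : coprimep P (('X - c%:P) ^+ N).
  exact: coprimep_prod_XsubC_exp.
have /Bezout_eq1_coprimepP[[u v] /= uv] := cP.
exists (q + u * P * ((f c)%:P - q)) => d; rewrite inE => /orP[/eqP ->|ds].
  have -> : q + u * P * ((f c)%:P - q) - (f c)%:P = (q - (f c)%:P) * v * ('X - c%:P) ^+ N.
    by rewrite -[RHS]mulrA (_ : v * _ = 1 - u * P); [ring | rewrite -uv; ring].
  exact: dvdp_mull.
have -> : q + u * P * ((f c)%:P - q) - (f d)%:P = (q - (f d)%:P) + P * (u * ((f c)%:P - q)) by ring.
apply: dvdp_add; first exact: qP.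
by apply: dvdp_mulr; rewrite /P (big_rem d) //= dvdp_mulr.
Qed.

Lemma interpolation (s : seq C) (f : C -> C) :
  exists q : {poly C}, forall c, c \in s -> q.[c] = f c.
Proof.
have [q qP] := hermite_interpolation f 1 (undup_uniq s).
exists q => c cs; have := qP c; rewrite mem_undup expr1 dvdp_XsubCl => /(_ cs).
by rewrite /root !hornerE subr_eq0 => /eqP.
Qed.

(* Every vector is a sum of generalized eigenvectors. *)
Lemma geigen_ind_seq n (A : 'M[C]_n) (P : 'cV[C]_n -> Prop) (s : seq C) N :
  P 0 -> (forall u v, P u -> P v -> P (u + v)) ->
  (forall c u, c \in s -> pmx A (('X - c%:P) ^+ N) *m u = 0 -> P u) ->
  uniq s -> forall u, pmx A (\prod_(c <- s) ('X - c%:P) ^+ N) *m u = 0 -> P u.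
Proof.
move=> P0 PD; elim: s => [|c s IH] Pg /=.
  by move=> _ u; rewrite big_nil pmx1 mul1mx => ->.
case/andP=> cs us u; rewrite big_cons => uE.
pose Q := \prod_(d <- s) ('X - d%:P) ^+ N.
have cP : coprimep Q (('X - c%:P) ^+ N).
  exact: coprimep_prod_XsubC_exp.
have /Bezout_eq1_coprimepP[[a b] /= ab] := cP.
set Z := _ ^+ N in uE cP ab.
have -> : u = pmx A (a * Q) *m u + pmx A (b * Z) *m u.
  by rewrite -mulmxDl -pmxD ab pmx1 mul1mx.
apply: PD.
  apply: (Pg c); first by rewrite mem_head.
  by rewrite mulmxA -[_ *m pmx A _]pmxM -/Z mulrCA pmxM -[_ *m u]mulmxA uE mulmx0.
apply: IH => //; first by move=> d v ds; apply: Pg; rewrite inE ds orbT.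
by rewrite mulmxA -[_ *m pmx A _]pmxM -/Q mulrCA [Q * Z]mulrC pmxM -[_ *m u]mulmxA uE mulmx0.
Qed.

End PolyMxTheory.

(** * Traces and nilpotency *)

Section TrigMx.
Variable C : numClosedFieldType.

Lemma trig_mul n (A B : 'M[C]_n) : is_trig_mx A -> is_trig_mx B ->
  is_trig_mx (A *m B) /\ forall i, (A *m B) i i = A i i * B i i.
Proof.
move=> /is_trig_mxP tA /is_trig_mxP tB; split.
  apply/is_trig_mxP => i j ij; rewrite mxE big1 // => k _.
  case: (ltnP i k) => ik; first by rewrite tA // mul0r.
  by rewrite tB ?mulr0 // (leq_ltn_trans ik).
move=> i; rewrite mxE (bigD1 i) //= big1 ?addr0 // => k ki.
case: (ltngtP i k) => ik; [by rewrite tA // mul0r|by rewrite tB // mulr0|].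
by move: ki; rewrite (ord_inj ik) eqxx.
Qed.

Lemma trig_exp n (A : 'M[C]_n) k : is_trig_mx A ->
  is_trig_mx (A ^+ k) /\ forall i, (A ^+ k) i i = A i i ^+ k.
Proof.
move=> tA; elim: k => [|k [t e]].
  by split=> [|i]; rewrite ?expr0 ?mxE ?eqxx // scalar_mx_is_trig.
rewrite exprS; have [t' e'] := trig_mul tA t; split=> // i.
by rewrite e' e exprS.
Qed.

Lemma trig_pmx n (A : 'M[C]_n) p i : is_trig_mx A -> (pmx A p) i i = p.[A i i].
Proof.
move=> tA; rewrite /pmx summxE horner_coef; apply: eq_bigr => k _.
by rewrite !mxE (trig_exp k tA).2.
Qed.

Lemma trig_nilp n (A : 'M[C]_n) : is_trig_mx A -> (forall i, A i i = 0) -> A ^+ n = 0.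
Proof.
move=> tA A0; have := pmx_char A; rewrite char_poly_trig //.
rewrite (eq_bigr (fun=> 'X)) => [|i _]; last by rewrite A0 polyC0 subr0.
by rewrite prodr_const card_ord pmxXn pmxX.
Qed.

Definition cj n (P A : 'M[C]_n) := P *m A *m invmx P.

Lemma cjM n (P A B : 'M[C]_n) : P \in unitmx -> cj P (A * B) = cj P A * cj P B.
Proof. by move=> uP; rewrite /cj -[RHS]/(_ *m _) -!mulmxA mulKmx. Qed.

Lemma cjD n (P A B : 'M[C]_n) : cj P (A + B) = cj P A + cj P B.
Proof. by rewrite /cj mulmxDr mulmxDl. Qed.

Lemma cjZ n (P A : 'M[C]_n) c : cj P (c *: A) = c *: cj P A.
Proof. by rewrite /cj -scalemxAr -scalemxAl. Qed.

Lemma cj1 n (P : 'M[C]_n) : P \in unitmx -> cj P 1 = 1.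
Proof. by move=> uP; rewrite /cj mulmx1 mulmxV. Qed.

Lemma cj0 n (P : 'M[C]_n) : cj P 0 = 0.
Proof. by rewrite /cj mulmx0 mul0mx. Qed.

Lemma cjX n (P A : 'M[C]_n) k : P \in unitmx -> cj P (A ^+ k) = cj P A ^+ k.
Proof. by move=> uP; elim: k => [|k IH]; rewrite ?cj1 // !exprS cjM // IH. Qed.

Lemma cj_pmx n (P A : 'M[C]_n) p : P \in unitmx -> cj P (pmx A p) = pmx (cj P A) p.
Proof.
move=> uP; rewrite /pmx (big_morph (cj P) (@cjD _ P) (cj0 P)).
by apply: eq_bigr => i _; rewrite cjZ cjX.
Qed.

Lemma cj_inj0 n (P A : 'M[C]_n) : P \in unitmx -> cj P A = 0 -> A = 0.
Proof.
move=> uP; rewrite /cj => /(congr1 (fun X => invmx P *m X *m P)).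
by rewrite mulmx0 mul0mx !mulmxA mulVmx // mul1mx mulmxKV.
Qed.

Lemma tr_cj n (P A : 'M[C]_n) : P \in unitmx -> \tr (cj P A) = \tr A.
Proof. by move=> uP; rewrite /cj mxtrace_mulC mulmxA mulVmx // mul1mx. Qed.

Lemma cotrig2 n (A B : 'M[C]_n) : A * B = B * A ->
  exists2 P : 'M[C]_n, P \in unitmx & is_trig_mx (cj P A) /\ is_trig_mx (cj P B).
Proof.
case/cotrigonalization2 => P uP /andP[]; have {}uP := unitarymx_unit uP.
by rewrite /similar_to !conjumx // => tA tB; exists P.
Qed.

Lemma trig1 n (A : 'M[C]_n) :
  exists2 P : 'M[C]_n, P \in unitmx & is_trig_mx (cj P A).
Proof. by have [|P uP [tA _]] := @cotrig2 n A A; last exists P. Qed.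

Lemma nilp_cj n (P A : 'M[C]_n) : P \in unitmx -> is_trig_mx (cj P A) ->
  (forall i, cj P A i i = 0) -> exists k, A ^+ k = 0.
Proof.
move=> uP tA A0; exists n; apply: (@cj_inj0 _ P) => //.
by rewrite cjX // trig_nilp.
Qed.

(** The exponent [size r] dominates all multiplicities, so a single [N] makes the product of the
    [('X - c)^N] a multiple of the characteristic polynomial. *)
Lemma geigen_ind n (A : 'M[C]_n) : exists (s : seq C) N,
  uniq s /\ forall P : 'cV[C]_n -> Prop,
  P 0 -> (forall u v, P u -> P v -> P (u + v)) ->
  (forall c u, c \in s -> pmx A (('X - c%:P) ^+ N) *m u = 0 -> P u) -> forall u, P u.
Proof.
have [r] := closed_field_poly_normal (char_poly A).
rewrite (monicP (char_poly_monic A)) scale1r => rE.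
exists (undup r), (size r); split; first exact: undup_uniq.
move=> P P0 PD Pg u; apply: (geigen_ind_seq P0 PD Pg (undup_uniq r)).
have /dvdpP[q ->] : char_poly A %| \prod_(c <- undup r) ('X - c%:P) ^+ size r.
  rewrite rE -(prodr_undup_exp_count r xpredT).
  have -> : \prod_(c <- undup r) ('X - c%:P) ^+ size r = \prod_(c <- undup r)
      (('X - c%:P) ^+ count_mem c r * ('X - c%:P) ^+ (size r - count_mem c r)).
    by apply: eq_bigr => c _; rewrite -exprD subnKC // count_size.
  by rewrite big_split; apply: dvdp_mulr; rewrite dvdpp.
by rewrite pmxM pmx_char mulr0 mul0mx.
Qed.

(* [D] is nilpotent as soon as it is trace-orthogonal to the polynomial in [D]
   that conjugates its eigenvalues. *)
Lemma nilp_of_conj_trace n (D : 'M[C]_n) :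
  exists s : seq C, forall q : {poly C}, (forall c, c \in s -> q.[c] = c^*) ->
  \tr (D * pmx D q) = 0 -> exists k, D ^+ k = 0.
Proof.
have [P uP tD] := trig1 D.
exists [seq cj P D i i | i <- enum 'I_n] => q qP.
rewrite -(tr_cj _ uP) cjM // cj_pmx // /mxtrace.
have e i : (cj P D * pmx (cj P D) q) i i = `|cj P D i i| ^+ 2.
  have -> : cj P D * pmx (cj P D) q = pmx (cj P D) ('X * q) by rewrite pmxM pmxX.
  rewrite trig_pmx // hornerM hornerX qP ?normCK //.
  by apply/mapP; exists i; rewrite ?mem_enum.
rewrite (eq_bigr _ (fun i _ => e i)) => /eqP; rewrite psumr_eq0 => [/allP H|i _]; last first.
  by rewrite exprn_ge0.
apply: (nilp_cj uP tD) => i; have := H i (mem_index_enum _).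
by rewrite /= sqrf_eq0 normr_eq0 => /eqP.
Qed.

(** * Powers of one element, through their multiplication operators *)

Section JordanPowers.
Variables (n : nat) (a b : 'M[C]_n) (L : nat -> 'M[C]_n).
Hypothesis ab : a * b = b * a.
Hypotheses (L0 : L 0 = 1) (L1 : L 1 = a).
Hypothesis LS : forall k, L k.+2 = a * L k.+1 *+ 2 + (b - a ^+ 2 *+ 2) * L k.

(* [c] and [c'] are the roots of X^2 - 2 a X + 2 a^2 - b on a joint eigenvector. *)
Lemma jordan_power_diag : exists P (c c' : 'I_n -> C),
  [/\ P \in unitmx, is_trig_mx (cj P a), forall i, cj P a i i = (c i + c' i) / 2
    & forall k, (forall i, (cj P (L k)) i i = (c i ^+ k + c' i ^+ k) / 2) /\
        (forall i, (cj P (a * L k)) i i = (c i + c' i) / 2 * ((c i ^+ k + c' i ^+ k) / 2))].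
Proof.
have [P uP [ta tb]] := cotrig2 ab.
pose d i := sqrtC (cj P b i i - cj P a i i ^+ 2).
exists P, (fun i => cj P a i i + d i), (fun i => cj P a i i - d i).
have n2 : 2 != 0 :> C by rewrite pnatr_eq0.
have aE i : cj P a i i = (cj P a i i + d i + (cj P a i i - d i)) / 2 by field.
split=> //.
suff H k : is_trig_mx (cj P (L k)) /\ forall i, cj P (L k) i i =
    ((cj P a i i + d i) ^+ k + (cj P a i i - d i) ^+ k) / 2.
  move=> k; have [tk ek] := H k; split=> // i.
  by rewrite cjM // (trig_mul ta tk).2 ek -aE.
suff [] : (is_trig_mx (cj P (L k)) /\ forall i, cj P (L k) i i =
    ((cj P a i i + d i) ^+ k + (cj P a i i - d i) ^+ k) / 2) /\
   (is_trig_mx (cj P (L k.+1)) /\ forall i, cj P (L k.+1) i i =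
    ((cj P a i i + d i) ^+ k.+1 + (cj P a i i - d i) ^+ k.+1) / 2) by [].
elim: k => [|k [[tk ek] [tk1 ek1]]].
  rewrite L0 L1 cj1 //; split; split=> // [|i]; first exact: scalar_mx_is_trig.
  by rewrite mxE eqxx !expr0 mulr1n; field.
split=> //.
have e1 : cj P (L k.+2) = (cj P a * cj P (L k.+1)) *+ 2 +
    (cj P b * cj P (L k) - (cj P a * cj P a * cj P (L k)) *+ 2).
  by rewrite LS mulrBl -scaler_nat -[a ^+ 2 *+ 2]scaler_nat mxscaleAl !cjD -scaleN1r !cjZ !cjM // scaleN1r !scaler_nat.
have [t1 d1] := trig_mul ta tk1; have [t2 d2] := trig_mul tb tk.
have [ta2 da2] := trig_mul ta ta; have [t3 d3] := trig_mul ta2 tk.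
have e2 i j : cj P (L k.+2) i j = (cj P a *m cj P (L k.+1)) i j *+ 2 +
    ((cj P b *m cj P (L k)) i j - (cj P a *m cj P a *m cj P (L k)) i j *+ 2).
  by rewrite e1 !mxE.
split=> [|i].
  move: t1 t2 t3 => /is_trig_mxP t1 /is_trig_mxP t2 /is_trig_mxP t3.
  by apply/is_trig_mxP => i j ij; rewrite e2 t1 // t2 // t3 // !mul0rn subr0 addr0.
rewrite e2.
rewrite d1 d2 d3 da2 ek ek1.
have d2E : cj P b i i = cj P a i i ^+ 2 + d i ^+ 2 by rewrite sqrtCK addrC subrK.
rewrite d2E !exprS; by field.
Qed.

(** In a Jordan algebra [a], [b] and [L k] are the multiplications by [x], [x^2] and [x^k], and the
    hypothesis says that [x] is orthogonal to its powers under the trace form. By linearity the sum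
    of [(c + c') * (q(c) + q(c'))] vanishes for every [q] with [q(0) = 0]. For [q] interpolating
    complex conjugation this is the sum of the [|c + c'|^2], and the eigenvalues of [a] are the
    [(c + c') / 2]. *)
Lemma jordan_power_nilp1 : (forall k, \tr (a * L k.+1) = 0) -> exists k, a ^+ k = 0.
Proof.
have [P [c [c' [uP ta aE LE]]]] := jordan_power_diag => tr0.
have n2 : 2 != 0 :> C by rewrite pnatr_eq0.
have poly_tr q : q.[0] = 0 -> \sum_i (c i + c' i) * (q.[c i] + q.[c' i]) = 0.
  move=> q0.
  rewrite (eq_bigr (fun i => \sum_(k < size q) q`_k * ((c i + c' i) * (c i ^+ k + c' i ^+ k)))); last first.
    move=> i _; rewrite !horner_coef -big_split mulr_sumr; apply: eq_bigr => k _ /=; ring.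
  rewrite exchange_big big1 //= => k _; rewrite -mulr_sumr.
  case: k => [[|k] kq] /=; first by rewrite -horner_coef0 q0 mul0r.
  have := tr0 k; rewrite -(tr_cj _ uP) /mxtrace => /(congr1 (fun x => 4 * x)); rewrite mulr0.
  rewrite mulr_sumr (eq_bigr (fun i => (c i + c' i) * (c i ^+ k.+1 + c' i ^+ k.+1))) => [->|i _].
    by rewrite mulr0.
  by rewrite (LE k.+1).2; field.
have [q qP] := interpolation (0 :: [seq c i | i <- enum 'I_n] ++ [seq c' i | i <- enum 'I_n]) (fun x => x^*).
have qc i : q.[c i] = (c i)^* by rewrite qP // inE mem_cat map_f ?mem_enum ?orbT.
have qc' i : q.[c' i] = (c' i)^* by rewrite qP // inE mem_cat [X in _ || (_ || X)]map_f ?mem_enum ?orbT.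
have q0 : q.[0] = 0 by rewrite qP ?mem_head // conjC0.
have := poly_tr q q0; rewrite (eq_bigr (fun i => `|c i + c' i| ^+ 2)) => [/eqP|i _]; last first.
  by rewrite qc qc' -rmorphD -normCK.
rewrite psumr_eq0 => [/allP H|i _]; last by rewrite exprn_ge0.
apply: (nilp_cj uP ta) => i; have := H i (mem_index_enum _).
by rewrite /= sqrf_eq0 normr_eq0 aE => /eqP ->; rewrite mul0r.
Qed.

(** The traces of [x^2, x^3, ...] give the sums of [c * q(c) + c' * q(c')], so the same choice of
    [q] produces [|c|^2 + |c'|^2] and forces [c = c' = 0]. *)
Lemma jordan_power_nilp2 : (forall k, \tr (L k.+2) = 0) -> exists k, a ^+ k = 0.
Proof.
have [P [c [c' [uP ta aE LE]]]] := jordan_power_diag => tr0.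
have n2 : 2 != 0 :> C by rewrite pnatr_eq0.
have poly_tr q : q.[0] = 0 -> \sum_i (c i * q.[c i] + c' i * q.[c' i]) = 0.
  move=> q0.
  rewrite (eq_bigr (fun i => \sum_(k < size q) q`_k * (c i ^+ k.+1 + c' i ^+ k.+1))); last first.
    move=> i _; rewrite !horner_coef !mulr_sumr -big_split; apply: eq_bigr => k _ /=; rewrite !exprS; ring.
  rewrite exchange_big big1 //= => k _; rewrite -mulr_sumr.
  case: k => [[|k] kq] /=; first by rewrite -horner_coef0 q0 mul0r.
  have := tr0 k; rewrite -(tr_cj _ uP) /mxtrace => /(congr1 (fun x => 2 * x)); rewrite mulr0.
  rewrite mulr_sumr (eq_bigr (fun i => (c i ^+ k.+2 + c' i ^+ k.+2))) => [->|i _].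
    by rewrite mulr0.
  by rewrite (LE k.+2).1; field.
have [q qP] := interpolation (0 :: [seq c i | i <- enum 'I_n] ++ [seq c' i | i <- enum 'I_n]) (fun x => x^*).
have qc i : q.[c i] = (c i)^* by rewrite qP // inE mem_cat map_f ?mem_enum ?orbT.
have qc' i : q.[c' i] = (c' i)^* by rewrite qP // inE mem_cat [X in _ || (_ || X)]map_f ?mem_enum ?orbT.
have q0 : q.[0] = 0 by rewrite qP ?mem_head // conjC0.
have := poly_tr q q0; rewrite (eq_bigr (fun i => `|c i| ^+ 2 + `|c' i| ^+ 2)) => [/eqP|i _]; last first.
  by rewrite qc qc' -!normCK.
rewrite psumr_eq0 => [/allP H|i _]; last by rewrite addr_ge0 ?exprn_ge0.
apply: (nilp_cj uP ta) => i; have := H i (mem_index_enum _).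
rewrite /= paddr_eq0 ?exprn_ge0 // !sqrf_eq0 !normr_eq0 aE => /andP[/eqP -> /eqP ->].
by rewrite addr0 mul0r.
Qed.

End JordanPowers.

End TrigMx.

(** * Jordan algebras *)

Section Algebra.
Variables (C : numClosedFieldType) (n : nat).
Implicit Types mu : 'cV[C]_n -> 'cV[C]_n -> 'cV[C]_n.

Definition symbil mu := (forall a, linear (mu a)) /\ forall a b, mu a b = mu b a.

Definition jordan_id mu := forall a b, mu a (mu (mu a a) b) = mu (mu a a) (mu a b).

Definition Lm mu a : 'M[C]_n := \matrix_(i, j) mu a (delta_mx j 0) i 0.

Definition derivation mu (D : 'M[C]_n) :=
  forall a b, D *m mu a b = mu (D *m a) b + mu a (D *m b).

Definition inn mu x y z := mu x (mu y z) - mu y (mu x z).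

Section Bilinear.
Variable mu : 'cV[C]_n -> 'cV[C]_n -> 'cV[C]_n.
Hypothesis mu_symbil : symbil mu.

Lemma muC a b : mu a b = mu b a. Proof. exact: mu_symbil.2. Qed.
Lemma muPr a c u v : mu a (c *: u + v) = c *: mu a u + mu a v.
Proof. exact: mu_symbil.1. Qed.
Lemma muDr a u v : mu a (u + v) = mu a u + mu a v.
Proof. by have := muPr a 1 u v; rewrite !scale1r. Qed.
Lemma mu0r a : mu a 0 = 0.
Proof. by have /eqP := muDr a 0 0; rewrite addr0 -subr_eq0 opprD addNKr oppr_eq0 => /eqP. Qed.
Lemma muZr a c u : mu a (c *: u) = c *: mu a u.
Proof. by have := muPr a c u 0; rewrite mu0r !addr0. Qed.
Lemma muNr a u : mu a (- u) = - mu a u.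
Proof. by rewrite -scaleN1r muZr scaleN1r. Qed.
Lemma muBr a u v : mu a (u - v) = mu a u - mu a v.
Proof. by rewrite muDr muNr. Qed.
Lemma muDl a u v : mu (u + v) a = mu u a + mu v a.
Proof. by rewrite muC muDr 2!(muC a). Qed.
Lemma mu0l a : mu 0 a = 0. Proof. by rewrite muC mu0r. Qed.
Lemma muZl a c u : mu (c *: u) a = c *: mu u a.
Proof. by rewrite muC muZr (muC a). Qed.
Lemma muNl a u : mu (- u) a = - mu u a.
Proof. by rewrite muC muNr (muC a). Qed.
Lemma muBl a u v : mu (u - v) a = mu u a - mu v a.
Proof. by rewrite muDl muNl. Qed.
Lemma mu_sumr a I (r : seq I) (P : pred I) (f : I -> 'cV[C]_n) :
  mu a (\sum_(i <- r | P i) f i) = \sum_(i <- r | P i) mu a (f i).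
Proof. by apply: (big_morph (mu a)) => [u v|]; rewrite ?muDr ?mu0r. Qed.
Lemma mu_suml a I (r : seq I) (P : pred I) (f : I -> 'cV[C]_n) :
  mu (\sum_(i <- r | P i) f i) a = \sum_(i <- r | P i) mu (f i) a.
Proof. by rewrite muC mu_sumr; apply: eq_bigr => i _; apply: muC. Qed.

Lemma cV_sum_delta (v : 'cV[C]_n) : v = \sum_i v i 0 *: delta_mx i 0.
Proof.
by rewrite {1}[v]matrix_sum_delta; apply: eq_bigr => i _; rewrite big_ord1.
Qed.

Lemma LmE a b : Lm mu a *m b = mu a b.
Proof.
rewrite {2}(cV_sum_delta b) mu_sumr; apply/colP => i; rewrite mxE summxE.
by apply: eq_bigr => j _; rewrite muZr !mxE mulrC.
Qed.

Lemma cV_mx_eq m (A B : 'M[C]_(m, n)) : (forall v : 'cV_n, A *m v = B *m v) -> A = B.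
Proof.
move=> AB; apply/matrixP => i j.
by have /colP/(_ i) := AB (delta_mx j 0); rewrite -!colE !mxE.
Qed.

Lemma LmD a b : Lm mu (a + b) = Lm mu a + Lm mu b.
Proof. by apply: cV_mx_eq => v; rewrite mulmxDl !LmE muDl. Qed.

Lemma LmZ c a : Lm mu (c *: a) = c *: Lm mu a.
Proof. by apply: cV_mx_eq => v; rewrite -scalemxAl !LmE muZl. Qed.

Lemma Lm0 : Lm mu 0 = 0.
Proof. by rewrite -(scale0r (0 : 'cV_n)) LmZ scale0r. Qed.

Lemma LmB a b : Lm mu (a - b) = Lm mu a - Lm mu b.
Proof. by rewrite -scaleN1r LmD LmZ scaleN1r. Qed.

Lemma Lm_sum I (r : seq I) (P : pred I) (f : I -> 'cV[C]_n) :
  Lm mu (\sum_(i <- r | P i) f i) = \sum_(i <- r | P i) Lm mu (f i).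
Proof. by apply: (big_morph (Lm mu)) => [u v|]; rewrite ?LmD ?Lm0. Qed.

Lemma derivationP D : derivation mu D <-> forall a, comm D (Lm mu a) = Lm mu (D *m a).
Proof.
split=> [dD a|dD a b].
  apply: cV_mx_eq => v; rewrite /comm mulmxBl -!mulmxA !LmE dD.
  by rewrite addrK.
have := congr1 (fun M => M *m b) (dD a); rewrite /comm /= mulmxBl -!mulmxA !LmE.
by move/eqP; rewrite subr_eq => /eqP.
Qed.

Lemma derivation0 : derivation mu 0.
Proof. by move=> a b; rewrite !mul0mx mu0l mu0r addr0. Qed.

Lemma derivationD D E : derivation mu D -> derivation mu E -> derivation mu (D + E).
Proof.
move=> dD dE a b; rewrite !mulmxDl dD dE muDl muDr -!addrA; congr (_ + _).
by rewrite addrCA.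
Qed.

Lemma derivationZ c D : derivation mu D -> derivation mu (c *: D).
Proof. by move=> dD a b; rewrite -!scalemxAl dD muZl muZr scalerDr. Qed.

(** The product of generalized eigenvectors for [c] and [d] is one for [c + d], and conjugation is
    additive; so the operator that acts as [c^*] on each generalized eigenspace obeys the Leibniz
    rule. The condition [q(0) = 0] keeps its image inside that of [D]. *)
Lemma conj_derivation D (s : seq C) : derivation mu D ->
  exists q : {poly C}, [/\ q.[0] = 0, forall c, c \in s -> q.[c] = c^*
    & derivation mu (pmx D q)].
Proof.
move=> dD; have [s0 [N [us0 ind]]] := geigen_ind D.
pose s1 := undup (0 :: s ++ s0 ++ [seq c + d | c <- s0, d <- s0]).
(* The nodes include 0 and the sums [c + d], where products live. The order [N + N] is needed
   because it kills a product of two vectors killed by [N]-th powers; the extra 1 keeps the modulus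
   nontrivial when [N = 0], so that the values of [q] can be read off. *)
have [q qP] := hermite_interpolation (fun c => c^*) (N + N).+1 (undup_uniq (0 :: s ++ s0 ++ [seq c + d | c <- s0, d <- s0])).
have qv c : c \in s1 -> q.[c] = c^*.
  move=> /qP; rewrite exprS => /(dvdp_trans (dvdp_mulr _ (dvdpp _))).
  by rewrite dvdp_XsubCl /root !hornerE subr_eq0 => /eqP.
have qD c k (u : 'cV[C]_n) : c \in s1 -> (k <= N + N)%N -> pmx D (('X - c%:P) ^+ k) *m u = 0 ->
    pmx D q *m u = c^* *: u.
  move=> /qP /dvdpP[r rE] kN u0; apply/eqP; rewrite -subr_eq0 -mul_scalar_mx -(pmxC D) -mulmxBl -pmxB rE.
  rewrite -(subnK (leqW kN)) exprD mulrA pmxM -[_ *m u]mulmxA u0 mulmx0 //.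
(* By the Leibniz rule [D - (c + d)] sends [mu u v] to [mu ((D - c) u) v + mu u ((D - d) v)], and
   each term lowers [i + j]. *)
have step c d i j u v : pmx D (('X - c%:P) ^+ i) *m u = 0 -> pmx D (('X - d%:P) ^+ j) *m v = 0 ->
    pmx D (('X - (c + d)%:P) ^+ (i + j)) *m mu u v = 0.
  have [k ij] := ubnP (i + j)%N; elim: k i j ij u v => // k IH.
  case=> [|i] j ij u v; first by rewrite pmx1 mul1mx => -> _; rewrite mu0l mulmx0.
  case: j ij => [|j] ij u0; first by rewrite pmx1 mul1mx => ->; rewrite mu0r mulmx0.
  move=> v0; rewrite addSn exprSr pmxM -[_ *m mu u v]mulmxA.
  have -> : pmx D ('X - (c + d)%:P) *m mu u v =
      mu (pmx D ('X - c%:P) *m u) v + mu u (pmx D ('X - d%:P) *m v).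
    rewrite !pmxB !pmxX !pmxC !mulmxBl !mul_scalar_mx dD muBl muBr muZl muZr scalerDl opprD.
    by rewrite addrACA.
  move: (u0); rewrite exprSr pmxM -[_ *m u]mulmxA => u0'.
  move: (v0); rewrite exprSr pmxM -[_ *m v]mulmxA => v0'.
  have lt : (i + j.+1 < k)%N by move: ij; rewrite addSn ltnS.
  have lt' : (i.+1 + j < k)%N by rewrite addSnnS.
  by rewrite mulmxDr (IH i j.+1 lt _ _ u0' v0) add0r -addSnnS; apply: (IH i.+1 j lt').
exists q; split.
- by rewrite qv ?conjC0 // mem_undup mem_head.
- by move=> c cs; rewrite qv // mem_undup inE mem_cat cs orbT.
have s01 c : c \in s0 -> c \in s1 by move=> cs; rewrite mem_undup inE !mem_cat cs !orbT.
move=> a b; move: a; apply: (ind) => [|u v|c u cs u0].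
- by rewrite mu0l !mulmx0 mu0l mu0l addr0.
- move=> hu hv; rewrite muDl !mulmxDr hu hv !muDl -!addrA; congr (_ + _).
  by rewrite addrCA.
move: b; apply: (ind) => [|v w|d v ds v0].
- by rewrite mu0r !mulmx0 mu0r mu0r addr0.
- move=> hv hw; rewrite muDr !mulmxDr hv hw !muDr -!addrA; congr (_ + _).
  by rewrite addrCA.
rewrite (qD c N u) ?s01 ?leq_addl // (qD d N v) ?s01 ?leq_addl //.
rewrite (qD (c + d) (N + N)%N) //; last exact: step.
  by rewrite muZl muZr rmorphD scalerDl.
by rewrite mem_undup inE !mem_cat (allpairs_f _ cs ds) !orbT.
Qed.

Section Jordan.
Hypothesis mu_jordan : jordan_id mu.

(** Polarization of a cubic identity: the defect [T] is symmetric and trilinear in [x, y, z] and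
    vanishes on the diagonal, hence everywhere since 6 and 2 are invertible. *)
Lemma jordan_lin x y z w :
  mu (mu x y) (mu z w) + mu (mu y z) (mu x w) + mu (mu z x) (mu y w) =
  mu z (mu (mu x y) w) + mu x (mu (mu y z) w) + mu y (mu (mu z x) w).
Proof.
apply/colP => i.
pose T x y z := (mu (mu x y) (mu z w) + mu (mu y z) (mu x w) + mu (mu z x) (mu y w) -
  (mu z (mu (mu x y) w) + mu x (mu (mu y z) w) + mu y (mu (mu z x) w))) i 0.
suff T0 : T x y z = 0 by apply/eqP; rewrite -subr_eq0; move: T0; rewrite /T !mxE => ->.
have TC1 a b c : T a b c = T b a c.
  rewrite /T (muC b a) (muC a c) (muC c b) !mxE; ring.
have TC2 a b c : T a b c = T b c a.
  rewrite /T !mxE; ring.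
have TD a b c d : T (a + b) c d = T a c d + T b c d.
  rewrite /T !(muDl, muDr) !mxE; ring.
have TN a c d : T (- a) c d = - T a c d.
  rewrite /T !(muNl, muNr) !mxE; ring.
have TD2 a b c d : T c (a + b) d = T c a d + T c b d by rewrite TC1 TD !(TC1 _ c).
have TD3 a b c d : T c d (a + b) = T c d a + T c d b by rewrite -TC2 TD !(TC2 _ c).
have P1 u v : T v u u = T u u v by rewrite TC2.
have P2 u v : T u v u = T u u v by rewrite TC1 P1.
have T3 a : T a a a = 0.
  by rewrite /T -!mu_jordan !mxE; ring.
have n6 k : k.+1%:R != 0 :> C by rewrite pnatr_eq0.
have T2 a b : T a a b = 0.
  have ex d : T (a + d) (a + d) (a + d) = T a a a + T a a d *+ 3 + T d d a *+ 3 + T d d d.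
    rewrite TD !TD2 !TD3 (P1 a d) (P2 a d) (P1 d a) (P2 d a); ring.
  have e1 := T3 (a + b); have e2 := T3 (a - b).
  move: e1 e2; rewrite !ex !T3.
  have -> : T a a (- b) = - T a a b by rewrite -P1 TN P1.
  have -> : T (- b) (- b) a = T b b a by rewrite TN TC1 TN opprK.
  rewrite !add0r !addr0 => e1 e2; apply/eqP.
  have : T a a b *+ 6 == 0.
    have -> : T a a b *+ 6 = T a a b *+ 3 + T b b a *+ 3 - ((- T a a b) *+ 3 + T b b a *+ 3) by ring.
    by rewrite e1 e2 subr0.
  by rewrite -mulr_natr mulf_eq0 (negPf (n6 5)) orbF.
have : T x y z *+ 2 == 0.
  have := T2 (x + y) z; rewrite TD !TD2 !T2 add0r addr0 [T y x z]TC1 => e.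
  by rewrite mulr2n e.
by rewrite -mulr_natr mulf_eq0 (negPf (n6 1)) orbF => /eqP.
Qed.

(** The left sides of [jordan_lin y a b x] and [jordan_lin x a b y] coincide; equating the right
    sides is the Leibniz rule. *)
Lemma inn_derivation x y a b : inn mu x y (mu a b) = mu (inn mu x y a) b + mu a (inn mu x y b).
Proof.
apply/colP => i.
have /colP/(_ i) e1 := jordan_lin y a b x; have /colP/(_ i) e2 := jordan_lin x a b y.
move: e1 e2; rewrite /inn !(muBl, muBr) !mxE.
rewrite (muC b x) (muC a x) (muC b y) (muC a y) (muC y x).
rewrite ?(muC _ (mu a b)) ?(muC (mu y a) b) ?(muC (mu x a) b).
rewrite (muC (mu x b) (mu y a)) (muC (mu x a) (mu y b)).
rewrite (muC b (mu _ _)).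
rewrite (muC b (mu _ _)) (muC (mu x a) y) (muC (mu x b) y) (muC (mu y a) x) (muC (mu y b) x).
move=> e1 e2.
set p := mu x _ i 0 in e2 *; set r := mu y (mu (mu a b) x) i 0 in e1 *.
set A1 := mu (mu x (mu y a)) b i 0 in e1 *; set B1 := mu (mu y (mu x a)) b i 0 in e2 *.
set A2 := mu a (mu x (mu y b)) i 0 in e1 *; set B2 := mu a (mu y (mu x b)) i 0 in e2 *.
have -> : p = (B1 + p + B2) - B1 - B2 by ring.
have -> : r = (A1 + r + A2) - A1 - A2 by ring.
by rewrite -e1 -e2; ring.
Qed.

(** [jordan_lin] with the test vector [v] put among its three symmetric arguments, read as an
    identity of operators in [v]. *)
Lemma LmM x y z : Lm mu (mu x (mu y z)) = Lm mu (mu y z) * Lm mu x + Lm mu (mu y x) * Lm mu z +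
  Lm mu (mu z x) * Lm mu y - Lm mu y * Lm mu x * Lm mu z - Lm mu z * Lm mu x * Lm mu y.
Proof.
apply: cV_mx_eq => v; rewrite !(mulmxBl, mulmxDl) -!mulmxA !LmE.
have := jordan_lin y z v x.
rewrite (muC v x) (muC v y) (muC (mu y x) _) (muC (mu z x) _) (muC (mu x (mu y z))).
rewrite (muC (mu y z) x) (muC x (mu z v)) (muC x (mu y v)) => e.
apply/colP => i; move/colP/(_ i): e; rewrite !mxE => e.
set p := mu v _ i 0 in e *; set A := mu y _ i 0 in e *; set B := mu z (mu _ x) i 0 in e *.
have -> : p = p + A + B - A - B by ring.
by rewrite -e; ring.
Qed.

Definition Inn x y : 'M[C]_n := comm (Lm mu x) (Lm mu y).

Lemma InnE x y z : Inn x y *m z = inn mu x y z.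
Proof. by rewrite /Inn /comm mulmxBl -!mulmxA !LmE. Qed.

Lemma Inn_derivation x y : derivation mu (Inn x y).
Proof. by move=> a b; rewrite !InnE inn_derivation. Qed.

(** [pw x k] is the power [x^(k+1)]. *)
Fixpoint pw x k := if k is k'.+1 then mu x (pw x k') else x.

Lemma Lm_pw_rec x q : Lm mu x * Lm mu q = Lm mu q * Lm mu x ->
  Lm mu x * Lm mu (mu x q) = Lm mu (mu x q) * Lm mu x ->
  Lm mu (mu x (mu x q)) =
  Lm mu x * Lm mu (mu x q) *+ 2 + (Lm mu (mu x x) - Lm mu x ^+ 2 *+ 2) * Lm mu q.
Proof.
move=> c1 c2; rewrite LmM (muC q x) -c2.
have -> : Lm mu q * Lm mu x * Lm mu x = Lm mu x * Lm mu x * Lm mu q.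
  by rewrite -c1 -!mulrA c1.
rewrite expr2 mulrBl mulrnAl !mulr2n opprD !addrA.
by do 2!congr (_ - _); rewrite addrAC.
Qed.

(** Two consecutive powers are carried along because [Lm_pw_rec] is a recursion of second order that
    itself presupposes commutation. *)
Lemma Lm_comm_pw x k : Lm mu x * Lm mu (pw x k) = Lm mu (pw x k) * Lm mu x /\
  Lm mu x * Lm mu (mu x (pw x k)) = Lm mu (mu x (pw x k)) * Lm mu x.
Proof.
have c2 : Lm mu x * Lm mu (mu x x) = Lm mu (mu x x) * Lm mu x.
  by apply: cV_mx_eq => v; rewrite -[LHS]mulmxA -[RHS]mulmxA !LmE mu_jordan.
elim: k => [|k [IH1 IH2]]; first by split.
split=> //=; rewrite Lm_pw_rec //; apply: commrD.
  by apply: commrMn; apply: commrM.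
apply: commrM => //; apply: commrB => //.
by apply: commrMn; apply: commrX.
Qed.

Lemma Lm_pwS x k : Lm mu (pw x k.+2) =
  Lm mu x * Lm mu (pw x k.+1) *+ 2 + (Lm mu (mu x x) - Lm mu x ^+ 2 *+ 2) * Lm mu (pw x k).
Proof. by have [c1 c2] := Lm_comm_pw x k; apply: Lm_pw_rec. Qed.

End Jordan.
End Bilinear.
End Algebra.

(** * Trace forms on an ideal *)

Section TraceComm.
Variables (F : comPzRingType) (n : nat).
Implicit Types A X Y : 'M[F]_n.

Lemma tr_mulC X Y : \tr (X * Y) = \tr (Y * X).
Proof. exact: mxtrace_mulC. Qed.

End TraceComm.

Lemma tr_comm (F : fieldType) n (A X : 'M[F]_n) : \tr (comm A X) = 0.
Proof. by rewrite /comm raddfB /= tr_mulC subrr. Qed.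

Lemma tr_comm_l (F : fieldType) n (A X Y : 'M[F]_n) :
  \tr (comm A X * Y) = - \tr (X * comm A Y).
Proof.
apply/eqP; rewrite -addr_eq0 -raddfD /=; apply/eqP.
have -> : comm A X * Y + X * comm A Y = comm A (X * Y).
  by rewrite /comm mulrBl mulrBr !mulrA addrA subrK.
exact: tr_comm.
Qed.

Lemma comm_mul (F : fieldType) n (A X Y : 'M[F]_n) :
  comm A (X * Y) = comm A X * Y + X * comm A Y.
Proof. by rewrite /comm mulrBl mulrBr !mulrA addrA subrK. Qed.

Lemma comm_anti (F : fieldType) n (X Y : 'M[F]_n) : comm X Y = - comm Y X.
Proof. by rewrite /comm opprB. Qed.

Lemma comm_jacobi (F : fieldType) n (A X Y : 'M[F]_n) :
  comm A (comm X Y) = comm (comm A X) Y + comm X (comm A Y).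
Proof.
have sub4 (V : zmodType) (a b c d : V) : a - b - (c - d) = a - c - (b - d).
  by rewrite !opprB !addrA [LHS]addrAC [a - b - c]addrAC [RHS]addrAC.
have -> : comm A (comm X Y) = comm A (X * Y) - comm A (Y * X).
  by rewrite /comm mulrBr mulrBl sub4.
by rewrite !comm_mul [comm A Y * X + _]addrC opprD addrACA.
Qed.

Lemma tr_comm_cycle (F : fieldType) n (X Y Z : 'M[F]_n) :
  \tr (comm X Y * Z) = \tr (X * comm Y Z).
Proof.
rewrite /comm mulrBl mulrBr !raddfB /= !mulrA; congr (_ - _).
by rewrite -[Y * X * Z]mulrA tr_mulC.
Qed.

Section Ideal.
Variables (C : numClosedFieldType) (n m : nat).
Variable mu : 'cV[C]_n -> 'cV[C]_n -> 'cV[C]_n.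
Hypotheses (mu_symbil : symbil mu) (mu_jordan : jordan_id mu).
(* [B] embeds ['cV_m] onto an ideal of [mu], with left inverse [B']. *)
Variables (B : 'M[C]_(n, m)) (B' : 'M[C]_(m, n)).
Hypothesis BB : B' *m B = 1%:M.
Hypothesis B_ideal : forall y v, B *m (B' *m mu y (B *m v)) = mu y (B *m v).

Definition restr (X : 'M[C]_n) : 'M[C]_m := B' *m X *m B.

(** Invariance of the image of [B] under [X], as a matrix identity; on such matrices [restr] is
    multiplicative. *)
Definition stab (X : 'M[C]_n) := B *m restr X = X *m B.

Definition LI y := restr (Lm mu y).

(** The arguments range over the whole algebra, the trace is taken over the ideal only. *)
Definition kapI x y := \tr (LI x * LI y).

Lemma restr_mul X Y : stab Y -> restr (X *m Y) = restr X * restr Y.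
Proof. by move=> sY; rewrite -[RHS]mulmxA sY /restr !mulmxA. Qed.

Lemma restrD X Y : restr (X + Y) = restr X + restr Y.
Proof. by rewrite /restr mulmxDr mulmxDl. Qed.

Lemma restrZ c X : restr (c *: X) = c *: restr X.
Proof. by rewrite /restr -scalemxAr -scalemxAl. Qed.

Lemma restrB X Y : restr (X - Y) = restr X - restr Y.
Proof. by rewrite -scaleN1r restrD restrZ scaleN1r. Qed.

Lemma restr0 : restr 0 = 0.
Proof. by rewrite /restr mulmx0 mul0mx. Qed.

Lemma restr1 : restr 1 = 1.
Proof. by rewrite /restr mulmx1. Qed.

Lemma stab_mul X Y : stab X -> stab Y -> stab (X * Y).
Proof.
by move=> sX sY; rewrite /stab restr_mul // [B *m _]mulmxA sX -mulmxA sY mulmxA.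
Qed.

Lemma stabD X Y : stab X -> stab Y -> stab (X + Y).
Proof. by move=> sX sY; rewrite /stab restrD mulmxDr sX sY mulmxDl. Qed.

Lemma stabZ c X : stab X -> stab (c *: X).
Proof. by move=> sX; rewrite /stab restrZ -scalemxAr sX scalemxAl. Qed.

Lemma stab0 : stab 0.
Proof. by rewrite /stab restr0 mulmx0 mul0mx. Qed.

Lemma stab1 : stab 1.
Proof. by rewrite /stab restr1 mulmx1 mul1mx. Qed.

Lemma stab_comm X Y : stab X -> stab Y -> stab (comm X Y).
Proof.
by move=> sX sY; rewrite /comm -scaleN1r; apply/stabD/stabZ; apply: stab_mul.
Qed.

Lemma restr_comm X Y : stab X -> stab Y -> restr (comm X Y) = comm (restr X) (restr Y).
Proof. by move=> sX sY; rewrite /comm restrB !restr_mul. Qed.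

Lemma stabX X k : stab X -> stab (X ^+ k) /\ restr (X ^+ k) = restr X ^+ k.
Proof.
move=> sX; elim: k => [|k [IH1 IH2]]; first by rewrite !expr0 restr1; split=> //; apply: stab1.
by rewrite !exprS; split; [apply: stab_mul | rewrite restr_mul // IH2].
Qed.

Lemma stab_pmx X q : stab X -> stab (pmx X q) /\ restr (pmx X q) = pmx (restr X) q.
Proof.
move=> sX; split; rewrite /pmx.
  apply: (big_ind stab); [exact: stab0 | exact: stabD |].
  by move=> i _; apply/stabZ/(stabX i sX).1.
rewrite (big_morph restr restrD restr0); apply: eq_bigr => i _.
by rewrite restrZ (stabX i sX).2.
Qed.

Lemma stabL y : stab (Lm mu y).
Proof.
apply: cV_mx_eq => v; by rewrite /restr -!mulmxA LmE // B_ideal.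
Qed.

Lemma BLI y v : B *m (LI y *m v) = mu y (B *m v).
Proof. by rewrite mulmxA stabL -mulmxA LmE. Qed.

Lemma B_inj k (u v : 'M[C]_(m, k)) : B *m u = B *m v -> u = v.
Proof. by move=> /(congr1 (mulmx B')); rewrite !mulmxA BB !mul1mx. Qed.

Lemma LID x y : LI (x + y) = LI x + LI y.
Proof. by rewrite /LI LmD // restrD. Qed.

Lemma LIZ c y : LI (c *: y) = c *: LI y.
Proof. by rewrite /LI LmZ // restrZ. Qed.

Lemma LI_der D y : derivation mu D -> stab D -> comm (restr D) (LI y) = LI (D *m y).
Proof.
move=> /derivationP dD sD; rewrite /LI -dD // restr_comm //; exact: stabL.
Qed.

Lemma Inn_stab x y : stab (Inn mu x y).
Proof. by apply: stab_comm; apply: stabL. Qed.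

Lemma Inn_LI x y : restr (Inn mu x y) = comm (LI x) (LI y).
Proof. by rewrite restr_comm //; apply: stabL. Qed.

Lemma LI_Inn x y z : comm (comm (LI x) (LI y)) (LI z) = LI (inn mu x y z).
Proof.
by rewrite -Inn_LI LI_der ?InnE //; [apply: Inn_derivation | apply: Inn_stab].
Qed.

Lemma kapI_der D x y : derivation mu D -> stab D -> kapI (D *m x) y = - kapI x (D *m y).
Proof. by move=> dD sD; rewrite /kapI -!LI_der // tr_comm_l. Qed.

Lemma kapIC x y : kapI x y = kapI y x.
Proof. exact: tr_mulC. Qed.

Lemma kapIDl x y z : kapI (x + y) z = kapI x z + kapI y z.
Proof. by rewrite /kapI LID mulrDl raddfD. Qed.

(** On the ideal, multiplication by [inn mu x z y] is a double commutator, so its trace vanishes.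
    This makes the trace of [LI (mu x y)] an associative form, for which the orthogonal of an ideal
    is an ideal. *)
Lemma tr_LI_assoc x y z : \tr (LI (mu x (mu y z))) = \tr (LI (mu (mu x y) z)).
Proof.
have := congr1 mxtrace (LI_Inn x z y); rewrite tr_comm /inn /LI LmB // restrB raddfB /= => /eqP.
by rewrite eq_sym subr_eq0 (muC mu_symbil z y) (muC mu_symbil (mu x y)) => /eqP.
Qed.

Definition inI (x : 'cV[C]_n) := exists v : 'cV[C]_m, x = B *m v.

Lemma inI_mu y x : inI x -> inI (mu y x).
Proof. by case=> v ->; exists (LI y *m v); rewrite BLI. Qed.

Definition radK x := inI x /\ forall w, inI w -> kapI x w = 0.

(** Here the index is the exponent: [LIpow x k] is the operator of [x^k], with the identity at
    [k = 0] even if the algebra has no unit, so that the recursion starts at 0. *)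
Definition LIpow x k := if k is k'.+1 then LI (pw mu x k') else 1.

Lemma LIpow_rec x k : LIpow x k.+2 =
  LI x * LIpow x k.+1 *+ 2 + (LI (mu x x) - LI x ^+ 2 *+ 2) * LIpow x k.
Proof.
case: k => [|k]; first by rewrite /= mulr1 -expr2 addrC subrK.
have sx := stabL x; have sk := stabL (pw mu x k); have sk1 := stabL (pw mu x k.+1).
rewrite /LIpow {1}/LI Lm_pwS // restrD -scaler_nat restrZ scaler_nat !restr_mul //.
by rewrite restrB -[Lm mu x ^+ 2 *+ 2]scaler_nat restrZ scaler_nat (stabX 2 sx).2.
Qed.

Lemma LI_comm2 x : LI x * LI (mu x x) = LI (mu x x) * LI x.
Proof.
rewrite -!restr_mul; [|exact: stabL..].
by rewrite [_ *m _](Lm_comm_pw mu_symbil mu_jordan x 0).2.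
Qed.

Lemma LI_nilp1 x : inI x -> (forall w, inI w -> kapI x w = 0) -> exists k, LI x ^+ k = 0.
Proof.
move=> Ix x0; apply: (@jordan_power_nilp1 C m _ (LI (mu x x)) (LIpow x)) => //.
- exact: LI_comm2.
- exact: LIpow_rec.
- by move=> k; apply: x0; elim: k => //= k; apply: inI_mu.
Qed.

Lemma LI_nilp2 x : (forall k, \tr (LI (pw mu x k.+1)) = 0) -> exists k, LI x ^+ k = 0.
Proof.
move=> x0; apply: (@jordan_power_nilp2 C m _ (LI (mu x x)) (LIpow x)) => //.
- exact: LI_comm2.
- exact: LIpow_rec.
Qed.

Lemma inI0 : inI 0. Proof. by exists 0; rewrite mulmx0. Qed.
Lemma inID x y : inI x -> inI y -> inI (x + y).
Proof. by case=> u -> [v ->]; exists (u + v); rewrite mulmxDr. Qed.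
Lemma inIZ c x : inI x -> inI (c *: x).
Proof. by case=> u ->; exists (c *: u); rewrite scalemxAr. Qed.
Lemma inIB x y : inI x -> inI y -> inI (x - y).
Proof. by move=> Ix Iy; rewrite -scaleN1r; apply/inID/inIZ. Qed.

Lemma inI_inn x y z : inI x -> inI (inn mu x y z).
Proof.
move=> Ix; rewrite /inn; apply: inIB; last by rewrite (muC mu_symbil x); do 2!apply: inI_mu.
by rewrite (muC mu_symbil); apply: inI_mu.
Qed.

Lemma inI_innr x y z : inI z -> inI (inn mu x y z).
Proof. by move=> Iz; apply: inIB; do 2!apply: inI_mu. Qed.

Lemma radK_inn x y z : radK x -> radK (inn mu y z x).
Proof.
move=> [Ix x0]; split=> [|w Iw]; first exact: inI_innr.
rewrite -InnE // kapI_der; last exact: Inn_stab.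
  by rewrite x0 ?oppr0 // InnE //; apply: inI_innr.
exact: Inn_derivation.
Qed.

(** Moving the commutators around the trace gives [kapI (inn x y z) w = - kapI x (inn z w y)], and
    [inn z w y] lies in the ideal because [w] does. *)
Lemma radK_innl x y z : radK x -> radK (inn mu x y z).
Proof.
move=> [Ix x0]; split=> [|w Iw]; first exact: inI_inn.
rewrite /kapI -LI_Inn tr_comm_cycle tr_comm_cycle comm_anti mulrN raddfN /= LI_Inn.
rewrite -/(kapI x _) x0 ?oppr0 // -[inn _ _ _ _]opprK -scaleN1r; apply: inIZ.
by rewrite /inn opprB; apply: inI_inn.
Qed.

Lemma radK_sub x y : radK x -> radK y -> radK (x - y).
Proof.
move=> [Ix x0] [Iy y0]; split=> [|w Iw]; first exact: inIB.
by rewrite -scaleN1r kapIDl {2}/kapI LIZ mxscaleAl linearZ /= -/(kapI y w) x0 // y0 // mulr0 addr0.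
Qed.

Lemma radKN x : radK x -> radK (- x).
Proof.
by move=> Kx; have := radK_sub (radK_sub Kx Kx) Kx; rewrite subrr sub0r.
Qed.

Lemma radKD x y : radK x -> radK y -> radK (x + y).
Proof. by move=> Kx Ky; rewrite -[y]opprK; apply/radK_sub/radKN. Qed.

Lemma radK0 : radK 0.
Proof.
split=> [|w _]; first exact: inI0.
by rewrite /kapI -(scale0r (0 : 'cV_n)) LIZ scale0r mul0r raddf0.
Qed.

(** A union of two kinds of operators, closed under commutators but not under addition across the
    kinds: multiplications by radical elements, and sums of inner derivations with one leg in the
    radical. Closure under commutators is all that Engel's theorem asks for. *)
Definition weak (X : 'M[C]_m) :=
  (exists2 x, radK x & X = LI x) \/
  exists2 ps : seq ('cV[C]_n * 'cV[C]_n), (forall p, p \in ps -> radK p.1) &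
    X = restr (\sum_(p <- ps) Inn mu p.1 p.2).

Lemma sum_Inn_der (ps : seq ('cV[C]_n * 'cV[C]_n)) :
  derivation mu (\sum_(p <- ps) Inn mu p.1 p.2).
Proof.
apply: big_ind => [|X Y dX dY|p _]; [exact: derivation0|exact: derivationD|exact: Inn_derivation].
Qed.

Lemma sum_Inn_stab (ps : seq ('cV[C]_n * 'cV[C]_n)) :
  stab (\sum_(p <- ps) Inn mu p.1 p.2).
Proof. by apply: big_ind => [|X Y|p _]; [exact: stab0|exact: stabD|exact: Inn_stab]. Qed.

Lemma sum_Inn_inI (ps : seq ('cV[C]_n * 'cV[C]_n)) y : (forall p, p \in ps -> radK p.1) ->
  inI ((\sum_(p <- ps) Inn mu p.1 p.2) *m y).
Proof.
move=> psK; rewrite mulmx_suml big_seq; apply: big_ind => [|X Y|p /psK [Ip _]].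
- exact: inI0.
- exact: inID.
- by rewrite InnE //; apply: inI_inn.
Qed.

Lemma sum_Inn_radK (ps : seq ('cV[C]_n * 'cV[C]_n)) x : radK x ->
  radK ((\sum_(p <- ps) Inn mu p.1 p.2) *m x).
Proof.
move=> Kx; rewrite mulmx_suml; apply: big_ind => [|X Y KX KY|p _].
- exact: radK0.
- exact: radKD.
- by rewrite InnE //; apply: radK_inn.
Qed.

(** For a sum [D] of inner derivations [Inn x y] with [x] in the radical, [nilp_of_conj_trace] asks
    for [tr (D q(D)) = 0]. Since [q(D)] is again a derivation, each [Inn x y] contributes
    [- kapI x (q(D) y)]; and [q(D) y] lies in the ideal, because [D] maps into the ideal and
    [q(0) = 0]. *)
Lemma weak_nilp X : weak X -> exists k, X ^+ k = 0.
Proof.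
case=> [[x [Ix x0] ->]|[ps psK ->]]; first exact: LI_nilp1.
set D := \sum_(p <- ps) _.
have dD : derivation mu D := sum_Inn_der ps.
have sD : stab D := sum_Inn_stab ps.
have [s sP] := nilp_of_conj_trace (restr D).
have [q [q0 qs dq]] := conj_derivation mu_symbil s dD.
apply: (sP q qs); rewrite -(stab_pmx q sD).2.
have sq := (stab_pmx q sD).1.
have qI y : inI (pmx D q *m y).
  have /factor_theorem[r rE] : root q 0 by rewrite /root q0.
  rewrite rE subr0 mulrC pmxM pmxX -[_ *m y]mulmxA; exact: sum_Inn_inI.
rewrite {1}/D (big_morph restr restrD restr0) mulr_suml raddf_sum /= big_seq big1 // => p pps.
have [_ p0] := psK _ pps.
by rewrite Inn_LI tr_comm_cycle comm_anti mulrN raddfN /= LI_der // -/(kapI _ _) p0 ?oppr0.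
Qed.

Lemma weak_comm X Y : weak X -> weak Y -> weak (comm X Y).
Proof.
have LL x ps : radK x -> exists2 z, radK z &
    comm (restr (\sum_(p <- ps) Inn mu p.1 p.2)) (LI x) = LI z.
  move=> Kx; rewrite LI_der; [|exact: sum_Inn_der|exact: sum_Inn_stab].
  by exists ((\sum_(p <- ps) Inn mu p.1 p.2) *m x) => //; apply: sum_Inn_radK.
case=> [[x Kx ->]|[ps psK ->]] [[y Ky ->]|[qs qsK ->]].
- right; exists [:: (x, y)]; first by move=> p; rewrite inE => /eqP ->.
  by rewrite big_seq1 Inn_LI.
- left; have [z Kz e] := LL x qs Kx.
  by exists (- z); [exact: radKN | rewrite comm_anti e -scaleN1r -[- z]scaleN1r LIZ].
- by left; have [z Kz e] := LL y ps Ky; exists z.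
right; set D := \sum_(p <- ps) _.
exists (flatten [seq [:: (D *m q.1, q.2); (q.1, D *m q.2)] | q <- qs]).
  by move=> p /flatten_mapP[q /qsK Kq]; rewrite !inE => /orP[]/eqP -> //=; apply: sum_Inn_radK.
rewrite big_flatten /= big_map -restr_comm; [|exact: sum_Inn_stab..].
congr restr; rewrite {1}/comm mulr_sumr mulr_suml -sumrB; apply: eq_bigr => q _.
rewrite !big_cons big_nil addr0 -/(comm _ _) /Inn comm_jacobi.
by have /derivationP dD := sum_Inn_der ps; rewrite -!dD.
Qed.

Definition irreducible := forall P : 'cV[C]_m -> Prop,
  P 0 -> (forall u v, P u -> P v -> P (u + v)) -> (forall c u, P u -> P (c *: u)) ->
  (forall y u, P u -> P (LI y *m u)) -> (exists2 u, u != 0 & P u) -> forall u, P u.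

(** The common kernel of the [weak] operators is nonzero by Engel's theorem. It is invariant under
    all [LI y], because the commutator of a [weak] operator with [LI y] is [weak] again;
    irreducibility makes it everything. *)
Lemma radK_eq0 : (0 < m)%N -> irreducible -> forall x, radK x -> LI x = 0.
Proof.
move=> m_gt0 irr x Kx; apply: cV_mx_eq => v; rewrite mul0mx.
have := engel m_gt0 weak_nilp weak_comm; case=> v0 v0n v00.
suff all : forall (u : 'cV[C]_m) X, weak X -> X *m u = 0 by apply: all; left; exists x.
apply: (irr (fun u : 'cV[C]_m => forall X, weak X -> X *m u = 0)); last by exists v0.
- by move=> X _; rewrite mulmx0.
- by move=> a b a0 b0 X wX; rewrite mulmxDr a0 // b0 // addr0.
- by move=> c a a0 X wX; rewrite -scalemxAr a0 // scaler0.
move=> y a a0 X wX.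
have -> : X *m (LI y *m a) = comm X (LI y) *m a + LI y *m (X *m a).
  by rewrite /comm mulmxBl -!mulmxA subrK.
rewrite a0 // mulmx0 addr0; case: wX => [[z Kz ->]|[ps psK ->]].
  by apply: a0; right; exists [:: (z, y)]; [move=> p; rewrite inE => /eqP -> | rewrite big_seq1 Inn_LI].
rewrite LI_der; [|exact: sum_Inn_der|exact: sum_Inn_stab].
apply: a0; left; exists ((\sum_(p <- ps) Inn mu p.1 p.2) *m y) => //.
rewrite mulmx_suml big_seq; apply: big_ind => [|b c Kb Kc|p /psK Kp].
- exact: radK0.
- exact: radKD.
- by rewrite InnE //; apply: radK_innl.
Qed.

End Ideal.

(** * Semisimple algebras *)

Definition subspace (C : fieldType) n (P : 'cV[C]_n -> Prop) :=
  [/\ P 0, forall u v, P u -> P v -> P (u + v) & forall c u, P u -> P (c *: u)].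

Lemma subspace_basis (C : fieldType) n (P : 'cV[C]_n -> Prop) : subspace P ->
  exists m (B : 'M[C]_(n, m)) (B' : 'M[C]_(m, n)),
  B' *m B = 1%:M /\ forall x, P x <-> exists v : 'cV[C]_m, x = B *m v.
Proof.
case=> P0 PD PZ.
have [A AP] : exists A : 'M[C]_n, forall u : 'rV_n, (u <= A)%MS <-> P u^T.
  suff gen d (A : 'M[C]_n) : (forall u : 'rV_n, (u <= A)%MS -> P u^T) ->
      (n <= \rank A + d)%N -> exists A : 'M[C]_n, forall u : 'rV_n, (u <= A)%MS <-> P u^T.
    apply: (gen n 0) => [u|]; last by rewrite leq_addl.
    by rewrite submx0 => /eqP ->; rewrite trmx0.
  elim: d A => [|d IH] A AP.
    rewrite addn0 => le; exists A => u; split; first exact: AP.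
    by move=> _; apply: submx_full; rewrite /row_full eqn_leq rank_leq_col.
  case: (pselect (exists u : 'rV_n, P u^T /\ ~~ (u <= A)%MS)) => [[u [Pu nu]]|no] le.
    apply: (IH (A + u)%MS) => [w|].
      case/sub_addsmxP => -[w1 w2] /= ->; rewrite linearD /=; apply: PD.
        by apply: AP; apply: submxMl.
      by rewrite [w2]mx11_scalar mul_scalar_mx linearZ /=; apply: PZ.
    apply: leq_trans le _; rewrite addnS -addSn leq_add2r.
    rewrite ltn_neqAle mxrankS ?addsmxSl // andbT; apply: contra nu => /eqP e.
    apply: submx_trans (addsmxSr A u) _; rewrite -(geq_leqif (mxrank_leqif_sup (addsmxSl A u))).
    by rewrite e.
  exists A => u; split; first exact: AP.
  by move=> Pu; apply/negPn/negP => nu; apply: no; exists u.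
have rf : row_free (row_base A) := row_base_free A.
exists (\rank A), (row_base A)^T, (pinvmx (row_base A))^T; split.
  by rewrite -trmx_mul mulmxVp // trmx1.
move=> x; rewrite -{1}[x]trmxK -AP -(eq_row_base A); split=> [/submxP[D e]|[v ->]].
  by exists D^T; rewrite -trmx_mul -e trmxK.
by rewrite trmx_mul trmxK submxMl.
Qed.

Lemma row_free_left_inverse_leq (C : fieldType) n m (B : 'M[C]_(n, m)) (B' : 'M[C]_(m, n)) :
  B' *m B = 1%:M -> (m <= n)%N.
Proof.
move=> BB; have := mxrankM_maxr B' B; rewrite BB mxrank1 => h.
exact: leq_trans h (rank_leq_row _).
Qed.

Section Semisimple.
Variable C : numClosedFieldType.
Notation alg n := ('cV[C]_n -> 'cV[C]_n -> 'cV[C]_n).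

Definition ideal_pred n (mu : alg n) P := subspace P /\ forall a x, P x -> P (mu a x).

Definition simple_alg n (mu : alg n) :=
  [/\ symbil mu, jordan_id mu, exists a b, mu a b <> 0
    & forall P, ideal_pred mu P -> (exists2 x, x <> 0 & P x) -> forall x, P x].

Definition kap n (mu : alg n) x y := \tr (Lm mu x * Lm mu y).

Definition kap_nondeg n (mu : alg n) := forall x, (forall y, kap mu x y = 0) -> x = 0.

Definition semiprime n (mu : alg n) := forall P, ideal_pred mu P ->
  (exists2 x, x <> 0 & P x) -> exists a b, [/\ P a, P b & mu a b <> 0].

(** The index type is arbitrary so that one more factor can be added by passing from [T] to
    [option T]. *)
Definition semisimple_over (T : Type) n (mu : alg n) :=
  exists (d : T -> nat) (nu : forall i, alg (d i)) (p : forall i, 'M[C]_(d i, n)),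
    [/\ forall i, simple_alg (nu i),
        forall i a b, p i *m mu a b = nu i (p i *m a) (p i *m b)
      & forall y : (forall i, 'cV[C]_(d i)), exists! v, forall i, p i *m v = y i].

(** The algebra is taken as an ideal of itself, with [B = B' = 1]. A nonzero [x] in the radical has
    [L_x = 0]; the elements [c] with [L_c = 0] form an ideal, which would then be the whole
    algebra. *)
Lemma simple_kap_nondeg n (mu : alg n) : simple_alg mu -> kap_nondeg mu.
Proof.
case=> mus muj [a [b ab]] mui.
have BB : 1%:M *m 1%:M = 1%:M :> 'M[C]_n by rewrite mulmx1.
have Bi y v : 1%:M *m (1%:M *m mu y (1%:M *m v)) = mu y (1%:M *m v) by rewrite !mul1mx.
have LE y : LI mu 1%:M 1%:M y = Lm mu y by rewrite /LI /restr mul1mx mulmx1.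
have n_gt0 : (0 < n)%N.
  by case: n mu a b ab {mus muj mui BB Bi LE} => // mu a b; rewrite [mu a b]flatmx0.
have irr : irreducible mu 1%:M 1%:M.
  move=> P P0 PD PZ PL [u un Pu]; apply: mui; last by exists u => //; apply/eqP.
  by split=> // c x Px; have := PL c x Px; rewrite LE LmE.
have K := radK_eq0 mus muj BB Bi n_gt0 irr.
have L0 x : (forall y, kap mu x y = 0) -> Lm mu x = 0.
  move=> x0; rewrite -LE; apply: K; split=> [|w _]; first by exists x; rewrite mul1mx.
  by rewrite /kapI !LE; apply: x0.
move=> x x0; apply: contrapT => xn.
have all : forall c, Lm mu c = 0.
  apply: (mui (fun x => Lm mu x = 0)); last by exists x => //; apply: L0.
  split; first split=> [|u v u0 v0|c u u0].
  - exact: Lm0.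
  - by rewrite LmD // u0 v0 addr0.
  - by rewrite LmZ // u0 scaler0.
  by move=> c u u0; rewrite muC // -LmE // u0 mul0mx Lm0.
by apply: ab; rewrite -LmE // all mul0mx.
Qed.

(** A section [S] of the projection [p i] that vanishes in the other factors satisfies
    [L_(S y) = S L_y p_i]. Hence [kap mu x (S y)] is the trace form of the [i]-th factor at [p_i x]
    and [y]. *)
Lemma semisimple_kap_nondeg (T : eqType) n (mu : alg n) : symbil mu ->
  semisimple_over T mu -> kap_nondeg mu.
Proof.
move=> mus [d [nu [p [nus pm pbij]]]].
have p_inj (u : 'cV[C]_n) : (forall i, p i *m u = 0) -> u = 0.
  move=> u0; have [v [_ vu]] := pbij (fun i => 0).
  by rewrite -(vu u u0); apply/vu => i; rewrite mulmx0.
have sec i : exists S : 'M[C]_(n, d i), p i *m S = 1%:M /\ forall j, j != i -> p j *m S = 0.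
  pose y (k : 'I_(d i)) : forall j, 'cV[C]_(d j) := @eqtype.dfwith T (fun j => 'cV[C]_(d j)) (fun j => 0) i (delta_mx k 0).
  have [s sP] : {s : 'I_(d i) -> 'cV[C]_n & forall k j, p j *m s k = y k j}.
    by apply: (@choice _ _ (fun k v => forall j, p j *m v = y k j)) => k; have [v [vP _]] := pbij (y k); exists v.
  exists (\matrix_(a, k) s k a 0); split=> [|j ji]; apply/matrixP => a k.
    have /colP/(_ a) := sP k i; rewrite /y eqtype.dfwith_in !mxE eqxx andbT => <-.
    by apply: eq_bigr => b _; rewrite !mxE.
  have /colP/(_ a) := sP k j; rewrite /y eqtype.dfwith_out; last by rewrite eq_sym.
  by rewrite !mxE => h; rewrite -[RHS]h; apply: eq_bigr => b _; rewrite !mxE.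
move=> x x0; apply: (p_inj) => i; have [S [pS pS0]] := sec i.
have ns := nus i; have [nis _ _ _] := ns.
apply: (simple_kap_nondeg ns) => y.
have LS : Lm mu (S *m y) = S *m Lm (nu i) y *m p i.
  apply: cV_mx_eq => v; apply/eqP; rewrite -subr_eq0; apply/eqP/p_inj => j.
  rewrite LmE // mulmxBr pm -!mulmxA (mulmxA (p j) S) (mulmxA (p j) S).
  case: (eqVneq j i) => [->|ji]; first by rewrite pS !mul1mx LmE // subrr.
  rewrite pS0 // !mul0mx subr0.
  by have [njs _ _ _] := nus j; rewrite (mu0l njs).
have := x0 (S *m y); rewrite /kap LS -[\tr _]/(\tr (_ *m _)) !mulmxA mxtrace_mulC !mulmxA.
suff -> : p i *m Lm mu x *m S = Lm (nu i) (p i *m x) by [].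
apply: cV_mx_eq => v; rewrite -!mulmxA !LmE // pm.
by rewrite mulmxA pS mul1mx.
Qed.

End Semisimple.

(** * Splitting off minimal ideals *)

Section Decomposition.
Variable C : numClosedFieldType.
Notation alg n := ('cV[C]_n -> 'cV[C]_n -> 'cV[C]_n).

Lemma nilp_tr0 n (A : 'M[C]_n) k : A ^+ k = 0 -> \tr (A * A) = 0.
Proof.
move=> Ak; have [P uP tA] := trig1 A; rewrite -(tr_cj _ uP) cjM // /mxtrace big1 // => i _.
rewrite [_ i i](trig_mul tA tA).2.
have : (cj P A ^+ k) i i = 0 by rewrite -cjX // Ak cj0 mxE.
by rewrite (trig_exp k tA).2 => /eqP; rewrite expf_eq0 => /andP[_ /eqP ->]; rewrite mul0r.
Qed.

Lemma quotient_alg n m (mu : alg n) (nu : alg m) (p : 'M[C]_(m, n)) (s : 'M[C]_(n, m)) :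
  p *m s = 1%:M -> (forall a b, p *m mu a b = nu (p *m a) (p *m b)) ->
  symbil mu -> jordan_id mu -> symbil nu /\ jordan_id nu.
Proof.
move=> ps pm mus muj.
have nuE u v : nu u v = p *m mu (s *m u) (s *m v) by rewrite pm !mulmxA ps !mul1mx.
split; [split|].
- by move=> a c u v; rewrite !nuE mulmxDr -scalemxAr muPr // mulmxDr -scalemxAr.
- by move=> a b; rewrite !nuE muC.
move=> a b; have := congr1 (mulmx p) (muj (s *m a) (s *m b)).
by rewrite !pm !mulmxA ps !mul1mx.
Qed.

(* A minimal ideal of a semiprime Jordan algebra, with the projection onto it
   along its orthogonal for [tr_I L_(xy)]. *)
Lemma minimal_ideal_split n (mu : alg n) : (0 < n)%N -> symbil mu -> jordan_id mu ->
  semiprime mu ->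
  exists m (B : 'M[C]_(n, m)) (Q : 'M[C]_(m, n)), [/\ (0 < m)%N, Q *m B = 1%:M,
    forall y v, B *m (Q *m mu y (B *m v)) = mu y (B *m v),
    irreducible mu B Q
  & forall y x, Q *m x = 0 -> Q *m mu y x = 0].
Proof.
move=> n_gt0 mus muj musp.
have [m [B [B' [m_gt0 BB Bi mmin]]]] : exists m (B : 'M[C]_(n, m)) (B' : 'M[C]_(m, n)),
    [/\ (0 < m)%N, B' *m B = 1%:M, forall y v, B *m (B' *m mu y (B *m v)) = mu y (B *m v)
    & forall m1 (B1 : 'M[C]_(n, m1)) (B1' : 'M[C]_(m1, n)), (0 < m1)%N -> B1' *m B1 = 1%:M ->
       (forall y v, B1 *m (B1' *m mu y (B1 *m v)) = mu y (B1 *m v)) -> (m <= m1)%N].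
  pose good m := (0 < m)%N /\ exists (B : 'M[C]_(n, m)) (B' : 'M[C]_(m, n)),
    B' *m B = 1%:M /\ forall y v, B *m (B' *m mu y (B *m v)) = mu y (B *m v).
  have ex : exists m, `[< good m >].
    exists n; apply/asboolP; split=> //; exists 1%:M, 1%:M.
    by split=> [|y v]; rewrite ?mulmx1 // !mul1mx.
  case: (ex_minnP ex) => m /asboolP[m_gt0 [B [B' [BB Bi]]]] mmin.
  exists m, B, B'; split=> // m1 B1 B1' m1_gt0 BB1 Bi1.
  by apply: mmin; apply/asboolP; split=> //; exists B1, B1'.
have BLv y v := BLI mus Bi y v.
have irr : irreducible mu B B'.
  move=> P P0 PD PZ PL [u un Pu].
  pose W x := exists2 v, P v & x = B *m v.
  have Ws : subspace W.
    split; first by exists 0; rewrite ?mulmx0.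
      by move=> _ _ [a Pa ->] [b Pb ->]; exists (a + b); [apply: PD | rewrite mulmxDr].
    by move=> c _ [a Pa ->]; exists (c *: a); [apply: PZ | rewrite scalemxAr].
  have [m1 [B1 [B1' [BB1 WB1]]]] := subspace_basis Ws.
  have m1_gt0 : (0 < m1)%N.
    have /WB1[v] : W (B *m u) by exists u.
    case: m1 B1 B1' BB1 WB1 v => // B1 B1' _ _ v; rewrite [v]flatmx0 mulmx0 -(mulmx0 _ B).
    by move/(B_inj BB) => u0; rewrite u0 eqxx in un.
  have le : (m <= m1)%N.
    apply: (mmin m1 B1 B1') => // y v.
    have [w Pw e] : W (B1 *m v) by apply/WB1; exists v.
    have /WB1[w' ->] : W (mu y (B1 *m v)) by exists (LI mu B B' y *m w); [apply: PL | rewrite BLv e].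
    by rewrite [B1' *m _]mulmxA BB1 mul1mx.
  have B1E : B1 = B *m (B' *m B1).
    apply: cV_mx_eq => v; have [w _ e] : W (B1 *m v) by apply/WB1; exists v.
    by rewrite -!mulmxA e [B' *m _]mulmxA BB mul1mx.
  have XX : (B1' *m B) *m (B' *m B1) = 1%:M by rewrite -mulmxA -B1E.
  have XX' : (B' *m B1) *m (B1' *m B) = 1%:M.
    have em : m1 = m by apply/eqP; rewrite eqn_leq le andbT (row_free_left_inverse_leq XX).
    move: (B' *m B1) (B1' *m B) XX; rewrite em => X X'; exact: mulmx1C.
  move=> v; have [w Pw] : W (B *m v).
    apply/WB1; exists (B1' *m B *m v); rewrite {1}B1E -(mulmxA B); congr (_ *m _).
    by rewrite -[LHS]mul1mx -XX' !mulmxA.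
  by move/(B_inj BB) => ->.
have K := radK_eq0 mus muj BB Bi m_gt0 irr.
have v0 : exists2 v : 'cV[C]_m, v != 0 & True.
  exists (const_mx 1) => //; apply/eqP => /colP/(_ (Ordinal m_gt0)); rewrite !mxE => /eqP.
  by rewrite oner_eq0.
(* If the trace form vanished on the ideal, all its elements would be in [radK], and [radK_eq0]
   would make the square of the ideal zero, against semiprimeness. *)
have kap0 : ~ forall x w, inI B x -> inI B w -> kapI mu B B' x w = 0.
  move=> all0; have [||a [b [[u ->] [v ->]]]] := musp (inI B).
  - split; first by split; [exact: inI0 | exact: inID | exact: inIZ].
    by move=> a x; apply: inI_mu.
  - have [v vn _] := v0; exists (B *m v); last by exists v.
    by rewrite -(mulmx0 _ B) => /(B_inj BB) /eqP; rewrite (negPf vn).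
  apply; rewrite -BLv K ?mul0mx ?mulmx0 //; split=> [|w Iw]; first by exists u.
  by apply: all0 => //; exists u.
pose t x y := \tr (LI mu B B' (mu x y)).
have tDl x y z : t (x + y) z = t x z + t y z by rewrite /t muDl // LID // raddfD.
have tZl c x z : t (c *: x) z = c * t x z by rewrite /t muZl // LIZ // linearZ.
have tC x y : t x y = t y x by rewrite /t muC.
have tA x y z : t (mu x y) z = t x (mu y z) by rewrite /t tr_LI_assoc.
(* By associativity the radical of [t] on the ideal is invariant, hence zero or everything. In the
   second case the traces of [x^k] vanish for [k >= 2], so every [LI x] is nilpotent and
   [kapI x x = 0]; polarization contradicts [kap0]. *)
have tnd v : (forall w, t (B *m v) (B *m w) = 0) -> v = 0.
  move=> v1; apply: contrapT => /eqP vn.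
  have all0 : forall v w, t (B *m v) (B *m w) = 0.
    apply: (irr (fun v => forall w, t (B *m v) (B *m w) = 0)); last by exists v.
    - by move=> w; rewrite mulmx0 /t mu0l // -(scale0r (0 : 'cV_n)) LIZ // scale0r raddf0.
    - by move=> a b a0 b0 w; rewrite mulmxDr tDl a0 b0 addr0.
    - by move=> c a a0 w; rewrite -scalemxAr tZl a0 mulr0.
    by move=> y a a0 w; rewrite BLv (muC mus) tA -BLv a0.
  have k0 x : inI B x -> kapI mu B B' x x = 0.
    move=> Ix; suff [k /nilp_tr0] : exists k, LI mu B B' x ^+ k = 0 by [].
    apply: (LI_nilp2 mus muj BB Bi) => k; rewrite /= -/(t x (pw mu x k)).
    have Ip : inI B (pw mu x k) by elim: k => //= k; apply: inI_mu.
    by case: Ix Ip => a -> [b ->].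
  apply: kap0 => x w Ix Iw; have := k0 _ (inID Ix Iw).
  rewrite kapIDl // ![kapI mu B B' _ (x + w)]kapIC !kapIDl // !k0 // add0r addr0.
  rewrite [kapI _ _ _ w x]kapIC => /eqP; rewrite -mulr2n -mulr_natr mulf_eq0 pnatr_eq0 orbF.
  by move/eqP.
pose G : 'M[C]_m := \matrix_(i, j) t (B *m delta_mx i 0) (B *m delta_mx j 0).
(* [H *m x] lists the values of [t] at [x] against the basis of the ideal and [H *m B] is the Gram
   matrix, so [invmx (H *m B) *m H] gives the coordinates of the [t]-orthogonal projection. *)
pose H : 'M[C]_(m, n) := \matrix_(i, j) t (B *m delta_mx i 0) (delta_mx j 0).
have tsum x (w : 'cV[C]_m) : t (B *m w) x = \sum_i w i 0 * t (B *m delta_mx i 0) x.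
  rewrite {1}(cV_sum_delta w) mulmx_sumr.
  rewrite (big_morph (fun z => t z x) (fun y z => tDl y z x) (_ : t 0 x = 0)); last first.
    by rewrite -(scale0r (0 : 'cV_n)) tZl mul0r.
  by apply: eq_bigr => i _; rewrite -scalemxAr tZl.
have tsumr x y : t x y = \sum_j y j 0 * t x (delta_mx j 0).
  rewrite {1}(cV_sum_delta y).
  rewrite (big_morph (fun z => t x z) (_ : forall y z, t x (y + z) = t x y + t x z) (_ : t x 0 = 0)).
  - by apply: eq_bigr => i _; rewrite tC tZl tC.
  - by move=> y' z; rewrite !(tC x) tDl.
  - by rewrite tC -(scale0r (0 : 'cV_n)) tZl mul0r.
have HE x i : (H *m x) i 0 = t (B *m delta_mx i 0) x.
  by rewrite tsumr mxE; apply: eq_bigr => j _; rewrite !mxE mulrC.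
have tQ u x : t (B *m u) x = (u^T *m H *m x) 0 0.
  by rewrite tsum -mulmxA mxE; apply: eq_bigr => i _; rewrite HE mxE.
have uG : H *m B \in unitmx.
  rewrite -unitmx_tr -row_free_unit -kermx_eq0; apply/eqP/row_matrixP => i; rewrite row0.
  set r := row i _; have : r *m (H *m B)^T = 0 by apply/sub_kermxP; apply: row_sub.
  move/(congr1 trmx); rewrite trmx_mul trmxK trmx0 => e.
  apply: (can_inj trmxK); rewrite trmx0; apply: tnd => w.
  by rewrite tC tQ -mulmxA (mulmxA H) e mulmx0 mxE.
exists m, B, (invmx (H *m B) *m H).
have QB : invmx (H *m B) *m H *m B = 1%:M by rewrite -mulmxA mulVmx.
have BQB X : inI B X -> B *m (invmx (H *m B) *m H *m X) = X.
  by case=> v ->; rewrite [_ *m H *m _]mulmxA QB mul1mx.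
split=> //.
- by move=> y v; apply: BQB; apply: (inI_mu mus Bi); exists v.
- have LIE y : LI mu B (invmx (H *m B) *m H) y = LI mu B B' y.
    apply: cV_mx_eq => v; apply: (B_inj BB); rewrite BLv.
    rewrite /LI /restr -!mulmxA LmE // [_ *m (H *m _)]mulmxA; apply: BQB.
    by apply: (inI_mu mus Bi); exists v.
  by move=> P P0 PD PZ PL; apply: irr => // y u Pu; rewrite -LIE; apply: PL.
move=> y x Qx; have Hx : H *m x = 0.
  by rewrite -[H *m x]mul1mx -(mulmxV uG) -!mulmxA (mulmxA _ H x) Qx !mulmx0.
rewrite -mulmxA (_ : H *m mu y x = 0) ?mulmx0 //.
apply/colP => i; rewrite HE -tA (muC mus) -BLv tQ.
by rewrite -mulmxA Hx mulmx0 !mxE.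
Qed.

Lemma semisimple_over_option (T : Type) n m m2 (mu : alg n) (nu1 : alg m) (nu2 : alg m2)
    (Q : 'M[C]_(m, n)) (P2 : 'M[C]_(m2, n)) (B : 'M[C]_(n, m)) (B2 : 'M[C]_(n, m2)) :
  simple_alg nu1 -> semisimple_over T nu2 ->
  (forall a b, Q *m mu a b = nu1 (Q *m a) (Q *m b)) ->
  (forall a b, P2 *m mu a b = nu2 (P2 *m a) (P2 *m b)) ->
  Q *m B = 1%:M -> Q *m B2 = 0 -> P2 *m B = 0 -> P2 *m B2 = 1%:M ->
  B *m Q + B2 *m P2 = 1%:M -> semisimple_over (option T) mu.
Proof.
move=> s1 [d [nu [p [sn pm pbij]]]] Qm P2m QB QB2 P2B P2B2 sum1.
exists (fun o => if o is Some i then d i else m).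
exists (fun o => match o return alg (if o is Some i then d i else m) with Some i => nu i | None => nu1 end).
exists (fun o => match o return 'M[C]_(if o is Some i then d i else m, n) with
  Some i => p i *m P2 | None => Q end).
split.
- by case.
- by case=> [i|] a b //; rewrite -!mulmxA P2m pm.
move=> y; have [w [wP wu]] := pbij (fun i => y (Some i)).
exists (B *m y None + B2 *m w); split.
  case=> [i|]; rewrite mulmxDr.
    by rewrite -!mulmxA !(mulmxA P2) P2B P2B2 mul0mx mul1mx mulmx0 add0r wP.
  by rewrite !mulmxA QB QB2 mul0mx mul1mx addr0.
move=> v vP; rewrite -[RHS]mul1mx -sum1 mulmxDl -!mulmxA (vP None); congr (_ + _ *m _).
by apply: wu => i; rewrite mulmxA (vP (Some i)).
Qed.

Lemma semiprime_semisimple n (mu : alg n) : symbil mu -> jordan_id mu -> semiprime mu ->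
  exists k, semisimple_over 'I_k mu.
Proof.
suff H : symbil mu -> jordan_id mu -> semiprime mu ->
    exists T : finType, semisimple_over T mu.
  move=> mus muj musp; have [T [d [nu [p [sn pm pbij]]]]] := H mus muj musp.
  exists #|T|, (fun i => d (enum_val i)), (fun i => nu (enum_val i)), (fun i => p (enum_val i)).
  split=> // y.
  (* A dependent family over ordinals is turned into one over [T] by a cast along [enum_rankK]; at
     [enum_val i] the cast disappears because equality proofs on an [eqType] are unique. *)
  pose y' t : 'cV[C]_(d t) := ecast z 'cV[C]_(d z) (enum_rankK t) (y (enum_rank t)).
  have yE i : y' (enum_val i) = y i.
    rewrite /y'; move: (enum_rankK (enum_val i)); move: (enum_rank _) => j e.
    by move: e (e) => /enum_val_inj -> e; rewrite eq_axiomK.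
  have [v [vP vu]] := pbij y'; exists v; split=> [i|w wP]; first by rewrite vP yE.
  by apply: vu => t; rewrite -(enum_rankK t) wP yE.
have [k] := ubnP n; elim: k n mu => // k IH n mu nk mus muj musp.
case: (posnP n) => [n0|n_gt0].
  move: mu mus muj musp {nk}; rewrite n0 => mu mus muj musp.
  exists void, (fun=> 0%N), (fun i : void => match i return alg 0 with end), (fun i : void => match i return 'M[C]_(0, 0) with end); split; [case|case|].
  by move=> y; exists 0; split=> [[]|v _]; rewrite [v]flatmx0.
have [m [B [Q [m_gt0 QB Bi irr Qperp]]]] := minimal_ideal_split n_gt0 mus muj musp.
have [m2 [B2 [B2' [BB2 kerE]]]] : exists m2 (B2 : 'M[C]_(n, m2)) (B2' : 'M[C]_(m2, n)),
    B2' *m B2 = 1%:M /\ forall x, Q *m x = 0 <-> exists v : 'cV[C]_m2, x = B2 *m v.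
  apply: subspace_basis; split=> [|u v u0 v0|c u u0]; first exact: mulmx0.
    by rewrite mulmxDr u0 v0 addr0.
  by rewrite -scalemxAr u0 scaler0.
pose P2 := B2' *m (1%:M - B *m Q).
have QB2 : Q *m B2 = 0.
  by apply: cV_mx_eq => v; rewrite mul0mx -mulmxA; apply/kerE; exists v.
have P2B : P2 *m B = 0 by rewrite /P2 -mulmxA mulmxBl -mulmxA QB mul1mx mulmx1 subrr mulmx0.
have P2B2 : P2 *m B2 = 1%:M by rewrite /P2 -mulmxA mulmxBl -mulmxA QB2 mulmx0 subr0 mul1mx.
have sum1 : B *m Q + B2 *m P2 = 1%:M.
  apply: cV_mx_eq => x; have /kerE[v e] : Q *m ((1%:M - B *m Q) *m x) = 0.
    by rewrite mulmxA mulmxBr mulmx1 mulmxA QB mul1mx subrr mul0mx.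
  rewrite mulmxDl /P2 -!mulmxA e [B2' *m _]mulmxA BB2 mul1mx -e mulmxBl mul1mx -mulmxA.
  by rewrite addrC subrK.
clearbody P2.
have decomp (x : 'cV[C]_n) : x = B *m (Q *m x) + B2 *m (P2 *m x).
  by rewrite !mulmxA -mulmxDl sum1 mul1mx.
have Q0 y v : Q *m mu y (B2 *m v) = 0 by apply: Qperp; apply/kerE; exists v.
(* The product lies both in the ideal and in its orthogonal. *)
have IJ0 u v : mu (B *m u) (B2 *m v) = 0.
  by rewrite (muC mus) -Bi (muC mus) Q0 mulmx0.
pose nu1 u v := Q *m mu (B *m u) (B *m v); pose nu2 u v := P2 *m mu (B2 *m u) (B2 *m v).
have Qm a b : Q *m mu a b = nu1 (Q *m a) (Q *m b).
  rewrite {1}(decomp a) {1}(decomp b) (muDl mus) !(muDr mus) IJ0 addr0 (muC mus (B2 *m _) (B *m _)) IJ0 add0r.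
  by rewrite mulmxDr Q0 addr0.
have P2m a b : P2 *m mu a b = nu2 (P2 *m a) (P2 *m b).
  rewrite {1}(decomp a) {1}(decomp b) (muDl mus) !(muDr mus) IJ0 addr0 (muC mus (B2 *m _) (B *m _)) IJ0 add0r.
  by rewrite mulmxDr -Bi mulmxA P2B mul0mx add0r.
have [s1 j1] := quotient_alg QB Qm mus muj; have [s2 j2] := quotient_alg P2B2 P2m mus muj.
have simp1 : simple_alg nu1.
  have BE y v : LI mu B Q y *m v = nu1 (Q *m y) v.
    by rewrite /LI /restr -!mulmxA LmE // Qm [Q *m (B *m v)]mulmxA QB mul1mx.
  split=> //.
    have [||a [b [[u ->] [v ->] ab]]] := musp (inI B).
    - split; first by split; [exact: inI0 | exact: inID | exact: inIZ].
      by move=> a x; apply: (inI_mu mus Bi).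
    - exists (B *m const_mx 1); last by exists (const_mx 1).
      move/(congr1 (mulmx Q)); rewrite mulmxA QB mul1mx mulmx0 => /colP/(_ (Ordinal m_gt0)).
      by rewrite !mxE => /eqP; rewrite oner_eq0.
    exists u, v => e; apply: ab; rewrite -Bi -/(nu1 u v) e mulmx0 //.
  move=> P [[P0 PD PZ] Pi] [x xn Px]; apply: irr => //; last by exists x => //; apply/eqP.
  by move=> y u Pu; rewrite BE; apply: Pi.
(* By [B2i] an ideal of the complement is an ideal of the whole algebra, so semiprimeness is
   inherited. *)
have sp2 : semiprime nu2.
  move=> P [[P0 PD PZ] Pi] [x xn Px].
  have B2i y v : mu y (B2 *m v) = B2 *m nu2 (P2 *m y) v.
    have [w e] := (kerE _).1 (Q0 y v).
    rewrite e; congr (_ *m _); have := P2m y (B2 *m v).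
    by rewrite e !mulmxA P2B2 !mul1mx.
  have [||a [b [[u Pu ->] [v Pv ->] ab]]] := musp (fun x => exists2 v, P v & x = B2 *m v).
  - split; first split.
    + by exists 0; rewrite ?mulmx0.
    + by move=> _ _ [a Pa ->] [b Pb ->]; exists (a + b); [apply: PD | rewrite mulmxDr].
    + by move=> c _ [a Pa ->]; exists (c *: a); [apply: PZ | rewrite scalemxAr].
    by move=> a _ [v Pv ->]; exists (nu2 (P2 *m a) v); [apply: Pi | apply: B2i].
  - exists (B2 *m x); last by exists x.
    by move/(congr1 (mulmx B2')); rewrite mulmxA BB2 mul1mx mulmx0.
  exists u, v; split=> // e; apply: ab; rewrite B2i mulmxA P2B2 mul1mx e mulmx0 //.
have m2n : (m2 < n)%N.
  rewrite ltn_neqAle (row_free_left_inverse_leq BB2) andbT; apply/eqP => e.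
  have : Q = 0; last first.
    move=> Q00; move: QB; rewrite Q00 mul0mx => /matrixP/(_ (Ordinal m_gt0) (Ordinal m_gt0)).
    by rewrite !mxE eqxx => /eqP; rewrite eq_sym oner_eq0.
  move: B2 B2' BB2 QB2 {kerE P2 P2B P2B2 sum1 decomp Q0 IJ0 nu1 nu2 Qm P2m s1 j1 s2 j2 simp1 sp2}.
  rewrite e => B2 B2' BB2 QB2; rewrite -[Q]mulmx1 -(mulmx1C BB2) mulmxA QB2 mul0mx //.
have [T ssT] := IH m2 nu2 (leq_trans m2n nk) s2 j2 sp2.
exists (option T); exact: (semisimple_over_option simp1 ssT Qm P2m QB QB2 P2B P2B2 sum1).
Qed.

End Decomposition.

(** * The moment matrix *)

Section Metric.
Variables (C : numClosedFieldType) (n : nat).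
Notation alg := ('cV[C]_n -> 'cV[C]_n -> 'cV[C]_n).
Notation e_ i := (delta_mx i 0 : 'cV[C]_n).
Implicit Types (A : 'M[C]_n) (mu nu : alg) (u v x y : 'cV[C]_n).

Definition adj m p (A : 'M[C]_(m, p)) : 'M[C]_(p, m) := map_mx Num.conj A^T.

Definition dotv u v : C := \sum_k u k 0 * (v k 0)^*.

Definition ip mu nu : C := \sum_i \sum_j dotv (mu (e_ i) (e_ j)) (nu (e_ i) (e_ j)).

Definition lact A mu : alg := fun a b => A *m mu a b - mu (A *m a) b - mu a (A *m b).

Definition gact (g : 'M[C]_n) mu : alg := fun a b => g *m mu (invmx g *m a) (invmx g *m b).

(** The matrix that represents [A |-> ip (lact A mu) mu] through the pairing [tr (X A)], for all [A]
    and not only for Hermitian ones; hence the exchanged indices in [delta_mx l k]. *)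
Definition Mm mu : 'M[C]_n := \matrix_(k, l) ip (lact (delta_mx l k) mu) mu.

Definition balanced mu := exists c, Mm mu = c%:M.

Lemma adjE m p (A : 'M[C]_(m, p)) i j : adj A i j = (A j i)^*.
Proof. by rewrite !mxE. Qed.

Lemma adjK m p (A : 'M[C]_(m, p)) : adj (adj A) = A.
Proof. by apply/matrixP => i j; rewrite !adjE conjCK. Qed.

Lemma adjM m p q (A : 'M[C]_(m, p)) (B : 'M[C]_(p, q)) : adj (A *m B) = adj B *m adj A.
Proof. by rewrite /adj trmx_mul map_mxM. Qed.

Lemma adjB m p (A B : 'M[C]_(m, p)) : adj (A - B) = adj A - adj B.
Proof. by apply/matrixP => i j; rewrite !mxE rmorphB. Qed.

Lemma adjZ m p c (A : 'M[C]_(m, p)) : adj (c *: A) = c^* *: adj A.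
Proof. by apply/matrixP => i j; rewrite !mxE rmorphM. Qed.

Lemma adj1 : adj (1%:M : 'M[C]_n) = 1%:M.
Proof. by apply/matrixP => i j; rewrite !mxE eq_sym rmorph_nat. Qed.

Lemma tr_adj_ge0 m p (A : 'M[C]_(m, p)) : 0 <= \tr (A *m adj A).
Proof.
rewrite sumr_ge0 // => i _; rewrite mxE sumr_ge0 // => j _.
by rewrite adjE -normCK exprn_ge0.
Qed.

Lemma tr_adj_eq0 m p (A : 'M[C]_(m, p)) : \tr (A *m adj A) = 0 -> A = 0.
Proof.
have ge i j : 0 <= A i j * adj A j i by rewrite adjE -normCK exprn_ge0.
move/eqP; rewrite psumr_eq0 => [/allP h|i _]; last by rewrite mxE sumr_ge0.
apply/matrixP => i j; have := h i (mem_index_enum _); rewrite /= mxE psumr_eq0 //.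
by move/allP/(_ j (mem_index_enum _)); rewrite /= adjE -normCK sqrf_eq0 normr_eq0 mxE => /eqP.
Qed.

Lemma dotv_mx u v : dotv u v = (adj v *m u) 0 0.
Proof. by rewrite mxE; apply: eq_bigr => k _; rewrite adjE mulrC. Qed.

Lemma dotv_adj A u v : dotv (A *m u) v = dotv u (adj A *m v).
Proof. by rewrite !dotv_mx adjM adjK mulmxA. Qed.

Lemma dotvDl u v w : dotv (u + v) w = dotv u w + dotv v w.
Proof. by rewrite !dotv_mx mulmxDr mxE. Qed.
Lemma dotvZl c u w : dotv (c *: u) w = c * dotv u w.
Proof. by rewrite !dotv_mx -scalemxAr mxE. Qed.
Lemma dotvC u v : dotv u v = (dotv v u)^*.
Proof. by rewrite rmorph_sum; apply: eq_bigr => k _; rewrite rmorphM /= conjCK mulrC. Qed.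
Lemma dotvDr u v w : dotv w (u + v) = dotv w u + dotv w v.
Proof. by rewrite dotvC dotvDl rmorphD /= -!dotvC. Qed.
Lemma dotvZr c u w : dotv w (c *: u) = c^* * dotv w u.
Proof. by rewrite dotvC dotvZl rmorphM /= -dotvC. Qed.
Lemma dotvBl u v w : dotv (u - v) w = dotv u w - dotv v w.
Proof. by rewrite -scaleN1r dotvDl dotvZl mulN1r. Qed.
Lemma dotvBr u v w : dotv w (u - v) = dotv w u - dotv w v.
Proof. by rewrite -scaleN1r dotvDr dotvZr rmorphN1 mulN1r. Qed.

Lemma dotvv_ge0 u : 0 <= dotv u u.
Proof. by rewrite sumr_ge0 // => k _; rewrite -normCK exprn_ge0. Qed.

Lemma dotvv_eq0 u : dotv u u = 0 -> u = 0.
Proof.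
move/eqP; rewrite psumr_eq0 => [/allP h|k _]; last by rewrite -normCK exprn_ge0.
apply/colP => k; have := h k (mem_index_enum _).
by rewrite /= -normCK sqrf_eq0 normr_eq0 mxE => /eqP.
Qed.

Definition sesq (h : 'cV[C]_n -> 'cV[C]_n -> C) :=
  (forall c x y z, h (c *: x + y) z = c * h x z + h y z) /\
  (forall c x y z, h z (c *: x + y) = c^* * h z x + h z y).

Lemma mul_delta A i : A *m e_ i = \sum_k A k i *: e_ k.
Proof.
by rewrite {1}[A *m _]cV_sum_delta; apply: eq_bigr => k _; rewrite -colE mxE.
Qed.

Lemma sesq_suml h (f : 'I_n -> C) z : sesq h ->
  h (\sum_k f k *: e_ k) z = \sum_k f k * h (e_ k) z.
Proof.
case=> hl _; have h0 : h 0 z = 0.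
  by have /eqP := hl 1 0 0 z; rewrite scaler0 addr0 mul1r eq_sym -subr_eq0 addrK => /eqP.
elim/big_rec2: _ => // k y1 y2 _ <-; exact: hl.
Qed.

Lemma sesq_sumr h (f : 'I_n -> C) z : sesq h ->
  h z (\sum_k f k *: e_ k) = \sum_k (f k)^* * h z (e_ k).
Proof.
case=> _ hr; have h0 : h z 0 = 0.
  by have /eqP := hr 1 0 0 z; rewrite scaler0 addr0 rmorph1 mul1r eq_sym -subr_eq0 addrK => /eqP.
elim/big_rec2: _ => // k y1 y2 _ <-; exact: hr.
Qed.

(** Moves an adjoint across an input slot of a multiplication, where [ip] sums over a basis instead
    of pairing two vectors. *)
Lemma sesq_adj h A : sesq h -> \sum_i h (A *m e_ i) (e_ i) = \sum_i h (e_ i) (adj A *m e_ i).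
Proof.
move=> sh; under eq_bigr do rewrite mul_delta sesq_suml //.
under [RHS]eq_bigr do rewrite mul_delta sesq_sumr //.
rewrite exchange_big; apply: eq_bigr => k _; apply: eq_bigr => i _.
by rewrite adjE conjCK.
Qed.

Lemma sesq_unitary h V : sesq h -> V *m adj V = 1%:M ->
  \sum_i h (V *m e_ i) (V *m e_ i) = \sum_i h (e_ i) (e_ i).
Proof.
move=> sh VV.
have sh' : sesq (fun x y => h x (V *m y)).
  case: sh => hl hr; split=> c x y z; first exact: hl.
  by rewrite mulmxDr -scalemxAr hr.
rewrite (sesq_adj _ sh'); apply: eq_bigr => i _.
by rewrite mulmxA VV mul1mx.
Qed.

Lemma lact_symbil A mu : symbil mu -> symbil (lact A mu).
Proof.
move=> sm; split; last by move=> a b; rewrite /lact (muC sm a) (muC sm (A *m a)) (muC sm a (A *m b)) addrAC.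
move=> a c x y; rewrite /lact !mulmxDr -!scalemxAr !(muDr sm) !(muZr sm) mulmxDr -!scalemxAr.
have gen (P1 P2 Q1 Q2 R1 R2 : 'cV[C]_n) : c *: P1 + P2 - (c *: Q1 + Q2) - (c *: R1 + R2) =
    c *: (P1 - Q1 - R1) + (P2 - Q2 - R2).
  by apply/colP => i; rewrite !mxE; ring.
exact: gen.
Qed.

Lemma gact_symbil g mu : symbil mu -> symbil (gact g mu).
Proof.
move=> sm; split; last by move=> a b; rewrite /gact (muC sm).
by move=> a c x y; rewrite /gact mulmxDr -scalemxAr muPr // mulmxDr -scalemxAr.
Qed.

Lemma ip_ge0 mu : 0 <= ip mu mu.
Proof. by rewrite sumr_ge0 // => i _; rewrite sumr_ge0 // => j _; apply: dotvv_ge0. Qed.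

Lemma ip_eq0 mu : symbil mu -> ip mu mu = 0 -> forall a b, mu a b = 0.
Proof.
move=> sm /eqP; rewrite psumr_eq0 => [/allP h|i _]; last by rewrite sumr_ge0 // => j _; apply: dotvv_ge0.
have h' i j : mu (e_ i) (e_ j) = 0.
  have := h i (mem_index_enum _); rewrite /= psumr_eq0 => [/allP/(_ j (mem_index_enum _)) /eqP|k _].
    exact: dotvv_eq0.
  exact: dotvv_ge0.
move=> a b; rewrite (cV_sum_delta a) (cV_sum_delta b) (mu_suml sm) big1 // => i _.
rewrite (muZl sm) (mu_sumr sm) big1 ?scaler0 // => j _.
by rewrite (muZr sm) h' scaler0.
Qed.

Lemma sesq_form1 mu nu i : symbil mu -> symbil nu ->
  sesq (fun x y => dotv (mu x (e_ i)) (nu y (e_ i))).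
Proof.
move=> sm sn; split=> c x y z.
  by rewrite (muDl sm) (muZl sm) dotvDl dotvZl.
by rewrite (muDl sn) (muZl sn) dotvDr dotvZr.
Qed.

Lemma sesq_form mu nu V : symbil mu -> symbil nu ->
  sesq (fun x y => \sum_j dotv (mu x (V *m e_ j)) (nu y (V *m e_ j))).
Proof.
move=> sm sn; split=> c x y z.
  rewrite mulr_sumr -big_split; apply: eq_bigr => j _.
  by rewrite (muDl sm) (muZl sm) dotvDl dotvZl.
rewrite mulr_sumr -big_split; apply: eq_bigr => j _.
by rewrite (muDl sn) (muZl sn) dotvDr dotvZr.
Qed.

Lemma unitary_inv (U : 'M[C]_n) : adj U *m U = 1%:M -> invmx U = adj U.
Proof.
move=> UU; rewrite -[LHS]mul1mx -UU -mulmxA mulmxV ?mulmx1 //.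
exact: (mulmx1_unit (mulmx1C UU)).1.
Qed.

Lemma ip_gact_unitary (U : 'M[C]_n) mu nu : symbil mu -> symbil nu -> adj U *m U = 1%:M ->
  ip (gact U mu) (gact U nu) = ip mu nu.
Proof.
move=> sm sn UU; have iU := unitary_inv UU.
transitivity (\sum_i \sum_j dotv (mu (adj U *m e_ i) (adj U *m e_ j)) (nu (adj U *m e_ i) (adj U *m e_ j))).
  apply: eq_bigr => i _; apply: eq_bigr => j _.
  by rewrite /gact iU dotv_adj mulmxA UU mul1mx.
rewrite (sesq_unitary (sesq_form (adj U) sm sn)) ?adjK //; apply: eq_bigr => i _.
have sh : sesq (fun x y => dotv (mu (e_ i) x) (nu (e_ i) y)).
  have [h1 h2] := sesq_form1 i sm sn.
  by split=> c x y z; rewrite !(muC sm (e_ i)) !(muC sn (e_ i)) ?h1 ?h2.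
by rewrite (sesq_unitary sh) ?adjK.
Qed.

Lemma ip_lact_adj A mu nu : symbil mu -> symbil nu ->
  ip (lact A mu) nu = ip mu (lact (adj A) nu).
Proof.
move=> sm sn; rewrite /ip /lact.
under eq_bigr do under eq_bigr do rewrite !dotvBl.
under [RHS]eq_bigr do under eq_bigr do rewrite !dotvBr.
under eq_bigr do rewrite !sumrB; rewrite !sumrB.
under [RHS]eq_bigr do rewrite !sumrB; rewrite !sumrB.
congr (_ - _ - _).
- by apply: eq_bigr => i _; apply: eq_bigr => j _; rewrite dotv_adj.
- rewrite exchange_big [RHS]exchange_big; apply: eq_bigr => j _.
  exact: (sesq_adj A (sesq_form1 j sm sn)).
apply: eq_bigr => i _; rewrite (eq_bigr (fun j => dotv (mu (A *m e_ j) (e_ i)) (nu (e_ j) (e_ i)))) => [|j _].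
  rewrite (sesq_adj A (sesq_form1 i sm sn)); apply: eq_bigr => j _.
  by rewrite (muC sm) (muC sn).
by rewrite (muC sm) (muC sn).
Qed.

Lemma ipC mu nu : ip mu nu = (ip nu mu)^*.
Proof.
rewrite rmorph_sum; apply: eq_bigr => i _; rewrite rmorph_sum; apply: eq_bigr => j _.
exact: dotvC.
Qed.

Lemma ipDl mu mu' nu : ip (fun a b => mu a b + mu' a b) nu = ip mu nu + ip mu' nu.
Proof.
rewrite /ip -big_split; apply: eq_bigr => i _; rewrite -big_split; apply: eq_bigr => j _.
exact: dotvDl.
Qed.

Lemma ipZl c mu nu : ip (fun a b => c *: mu a b) nu = c * ip mu nu.
Proof.
rewrite /ip mulr_sumr; apply: eq_bigr => i _; rewrite mulr_sumr; apply: eq_bigr => j _.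
exact: dotvZl.
Qed.

Lemma ip_ext mu mu' nu nu' : (forall a b, mu a b = mu' a b) -> (forall a b, nu a b = nu' a b) ->
  ip mu nu = ip mu' nu'.
Proof. by move=> e e'; apply: eq_bigr => i _; apply: eq_bigr => j _; rewrite e e'. Qed.

Lemma ip_lactD A B mu nu : symbil mu -> ip (lact (A + B) mu) nu = ip (lact A mu) nu + ip (lact B mu) nu.
Proof.
move=> sm; rewrite -ipDl; apply: ip_ext => // a b.
rewrite /lact !mulmxDl (muDl sm) (muDr sm); apply/colP => i.
move: (A *m mu a b) (B *m mu a b) (mu (A *m a) b) (mu (B *m a) b) (mu a (A *m b)) (mu a (B *m b)).
by move=> *; rewrite !mxE; ring.
Qed.

Lemma ip_lactZ c A mu nu : symbil mu -> ip (lact (c *: A) mu) nu = c * ip (lact A mu) nu.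
Proof.
move=> sm; rewrite -ipZl; apply: ip_ext => // a b.
by rewrite /lact -!scalemxAl (muZl sm) (muZr sm) -!scalerBr.
Qed.

Lemma Mm_tr A mu : symbil mu -> \tr (Mm mu *m A) = ip (lact A mu) mu.
Proof.
move=> sm; have ip0 : ip (lact 0 mu) mu = 0 by rewrite -(scale0r (0 : 'M[C]_n)) ip_lactZ // mul0r.
have -> : ip (lact A mu) mu = \sum_l \sum_k A l k * ip (lact (delta_mx l k) mu) mu.
  rewrite {1}[A]matrix_sum_delta.
  rewrite (big_morph (fun A => ip (lact A mu) mu) (_ : {morph _ : x y / x + y >-> x + y}) ip0); last first.
    by move=> X Y; apply: ip_lactD.
  apply: eq_bigr => l _.
  rewrite (big_morph (fun A => ip (lact A mu) mu) (_ : {morph _ : x y / x + y >-> x + y}) ip0); last first.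
    by move=> X Y; apply: ip_lactD.
  by apply: eq_bigr => k _; rewrite ip_lactZ.
rewrite exchange_big; apply: eq_bigr => k _; rewrite mxE; apply: eq_bigr => l _.
by rewrite mxE mulrC.
Qed.

Lemma Mm_herm mu : symbil mu -> adj (Mm mu) = Mm mu.
Proof.
move=> sm; apply/matrixP => k l; rewrite adjE !mxE -ipC ip_lact_adj //; congr ip.
by congr lact; apply/matrixP => i j; rewrite !mxE rmorph_nat andbC.
Qed.

Lemma tr_eq0 (X : 'M[C]_n) : (forall A, \tr (X *m A) = 0) -> X = 0.
Proof. by move=> h; apply: tr_adj_eq0; apply: h. Qed.

(** The identity matrix acts as [mu - mu - mu = - mu]. *)
Lemma Mm_trace mu : symbil mu -> \tr (Mm mu) = - ip mu mu.
Proof.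
move=> sm; rewrite -[Mm mu]mulmx1 Mm_tr // -mulN1r -ipZl; apply: ip_ext => // a b.
by rewrite /lact !mul1mx subrr sub0r scaleN1r.
Qed.

Lemma lact_gact g A mu a b : symbil mu -> g \in unitmx ->
  lact A (gact g mu) a b = gact g (lact (invmx g *m A *m g) mu) a b.
Proof.
move=> sm ug; rewrite /lact /gact !mulmxBr -!mulmxA !(mulmxA g (invmx g)).
by rewrite mulmxV // !mul1mx.
Qed.

Lemma Mm_gact_unitary (U : 'M[C]_n) mu : symbil mu -> adj U *m U = 1%:M ->
  Mm (gact U mu) = U *m Mm mu *m adj U.
Proof.
move=> sm UU; have UU' := mulmx1C UU; have uU := (mulmx1_unit UU').1.
have iU := unitary_inv UU.
apply/eqP; rewrite -subr_eq0; apply/eqP/tr_eq0 => A.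
rewrite mulmxBl raddfB /= Mm_tr; last exact: gact_symbil.
rewrite (@ip_ext _ (gact U (lact (adj U *m A *m U) mu)) _ (gact U mu)) // => [|a b]; last first.
  by rewrite lact_gact // iU.
rewrite ip_gact_unitary //; last exact: lact_symbil.
rewrite -Mm_tr // -!mulmxA [X in _ - X]mxtrace_mulC !mulmxA.
by rewrite subrr.
Qed.

Lemma ip_diag mu (a : 'I_n -> C) : symbil mu ->
  ip (lact (\matrix_(i, j) (a i *+ (i == j))) mu) mu =
  \sum_i \sum_j \sum_k (a k - a i - a j) * `|mu (e_ i) (e_ j) k 0| ^+ 2.
Proof.
move=> sm; set A := \matrix_(_, _) _.
have Ae i : A *m e_ i = a i *: e_ i.
  rewrite mul_delta (bigD1 i) //= big1 ?addr0 => [|k ki]; first by rewrite mxE eqxx.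
  by rewrite mxE (negPf ki) scale0r.
apply: eq_bigr => i _; apply: eq_bigr => j _; apply: eq_bigr => k _.
rewrite /lact !Ae (muZl sm) (muZr sm) normCK mulrA; congr (_ * _).
rewrite !mxE (bigD1 k) //= big1 => [|l lk]; first by rewrite !mxE eqxx mulr1n; ring.
by rewrite mxE eq_sym (negPf lk) mul0r.
Qed.

End Metric.

(** * Balanced algebras: ideals and derivations *)

Section Balanced.
Variables (C : numClosedFieldType) (n : nat).
Notation alg := ('cV[C]_n -> 'cV[C]_n -> 'cV[C]_n).
Notation e_ i := (delta_mx i 0 : 'cV[C]_n).
Implicit Types (A : 'M[C]_n) (mu nu : alg).

Definition dg (a : 'I_n -> C) : 'M[C]_n := \matrix_(i, j) (a i *+ (i == j)).

(** Simultaneous unitary trigonalization; a triangular Hermitian matrix is diagonal. *)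
Lemma herm_codiag (As : seq 'M[C]_n) : (forall A, A \in As -> adj A = A) ->
  (forall A B, A \in As -> B \in As -> A *m B = B *m A) ->
  exists2 U : 'M[C]_n, adj U *m U = 1%:M &
    forall A, A \in As -> adj U *m A *m U = dg (fun i => (adj U *m A *m U) i i).
Proof.
move=> Ah Ac; have [P uP /allP tP] := cotrigonalization (Ac : {in As &, forall A B, comm_mx A B}).
have PP : P *m adj P = 1%:M by apply/unitarymxP.
exists (adj P); first by rewrite adjK.
move=> A AAs; rewrite adjK; have := tP A AAs; rewrite /= /similar_to conjumx; last exact: unitarymx_unit.
rewrite invmx_unitary // -/(adj P) => /is_trig_mxP tr.
apply/matrixP => i j; rewrite !mxE; case: eqP => [->|/eqP ij]; first by rewrite mulr1n.
have hA : adj (P *m A *m adj P) = P *m A *m adj P by rewrite !adjM adjK Ah // mulmxA.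
rewrite mulr0n; case: (ltngtP i j) => lij.
- by have := tr i j lij; rewrite mxE.
- by have := tr j i lij; rewrite -[in X in X -> _]hA adjE mxE => /eqP; rewrite conjC_eq0 => /eqP.
- by move: ij; rewrite (ord_inj lij) eqxx.
Qed.

Lemma dg_tr (a : 'I_n -> C) : \tr (dg a) = \sum_i a i.
Proof. by apply: eq_bigr => i _; rewrite mxE eqxx. Qed.

Lemma dg_mul_delta (a : 'I_n -> C) i : dg a *m e_ i = a i *: e_ i.
Proof.
rewrite mul_delta (bigD1 i) //= big1 ?addr0 => [|k ki]; first by rewrite mxE eqxx.
by rewrite mxE (negPf ki) scale0r.
Qed.

Lemma dg_mulE m (a : 'I_n -> C) (X : 'M[C]_(n, m)) k j : (dg a *m X) k j = a k * X k j.
Proof.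
rewrite mxE (bigD1 k) //= big1 ?addr0 => [|l lk]; first by rewrite mxE eqxx mulr1n.
by rewrite mxE eq_sym (negPf lk) mul0r.
Qed.

(** For a basis matrix [B] of the subspace, the projection is [B (B^* B)^-1 B^*]. *)
Lemma orth_proj (P : 'cV[C]_n -> Prop) : subspace P ->
  exists A, [/\ adj A = A, forall x, P (A *m x) & forall x, P x -> A *m x = x].
Proof.
move=> sP; have [m [B [B' [BB PB]]]] := subspace_basis sP.
have uG : adj B *m B \in unitmx.
  rewrite -row_free_unit -kermx_eq0; apply/eqP/row_matrixP => i; rewrite row0.
  set r := row i _; have r0 : r *m (adj B *m B) = 0 by apply/sub_kermxP; apply: row_sub.
  have : r *m adj B = 0.
    by apply: tr_adj_eq0; rewrite adjM adjK mulmxA -[r *m adj B *m B]mulmxA r0 mul0mx raddf0.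
  move/(congr1 (fun X => X *m adj B')); rewrite mul0mx -mulmxA -adjM BB.
  by rewrite /adj trmx1 map_mx1 mulmx1.
have aG : adj (adj B *m B) = adj B *m B by rewrite adjM adjK.
have aGi : adj (invmx (adj B *m B)) = invmx (adj B *m B).
  by rewrite /adj trmx_inv map_invmx; congr invmx; exact: aG.
exists (B *m invmx (adj B *m B) *m adj B); split.
- by rewrite !adjM adjK aGi mulmxA.
- by move=> x; apply/PB; exists (invmx (adj B *m B) *m adj B *m x); rewrite !mulmxA.
move=> x /PB[v ->]; rewrite -!mulmxA (mulmxA (adj B)) (mulmxA (invmx _)) mulVmx //.
by rewrite mul1mx.
Qed.

(* Otherwise the orthogonal projection onto an ideal of square zero would
   contradict [tr M < 0]. *)
Lemma balanced_semiprime mu : symbil mu -> (exists a b, mu a b <> 0) -> balanced mu ->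
  semiprime mu.
Proof.
move=> sm [a0 [b0 ab0]] [c Mc] P [sP Pi] [x xn Px].
apply: contrapT => no.
have PP0 a b : P a -> P b -> mu a b = 0.
  by move=> Pa Pb; apply: contrapT => ab; apply: no; exists a, b.
have [A [Ah AP AI]] := orth_proj sP.
have [||U UU UA] := @herm_codiag [:: A].
- by move=> X; rewrite inE => /eqP ->.
- by move=> X Y; rewrite !inE => /eqP -> /eqP ->.
set a := fun i => (adj U *m A *m U) i i in UA.
have UAU : adj U *m A *m U = dg a by apply: UA; rewrite mem_head.
have UU' := mulmx1C UU.
have AUe i : A *m (U *m e_ i) = a i *: (U *m e_ i).
  by rewrite scalemxAr -dg_mul_delta -UAU -!mulmxA (mulmxA U) UU' mul1mx.
have AA (y : 'cV[C]_n) : A *m (A *m y) = A *m y := AI _ (AP y).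
have Ue i : U *m e_ i != 0.
  apply: contra_neq (_ : e_ i != 0) => [e|].
    by rewrite -[e_ i]mul1mx -UU -mulmxA e mulmx0.
  by apply/eqP => /colP/(_ i)/eqP; rewrite !mxE !eqxx oner_eq0.
have a01 i : (a i == 0) || (a i == 1).
  have /eqP := AA (U *m e_ i); rewrite !AUe -scalemxAr AUe scalerA -subr_eq0 -scalerBl.
  rewrite scaler_eq0 (negPf (Ue i)) orbF -{3}[a i]mulr1 -mulrBr mulf_eq0 subr_eq0.
  by [].
pose mu' := gact (adj U) mu.
have iU : invmx (adj U) = U by rewrite unitary_inv ?adjK.
have mu'E i j : mu' (e_ i) (e_ j) = adj U *m mu (U *m e_ i) (U *m e_ j) by rewrite /mu' /gact iU.
have PU i : a i = 1 -> P (U *m e_ i).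
  by move=> ai; rewrite -[U *m _]scale1r -ai -AUe.
have P0 k y : P y -> a k = 0 -> (adj U *m y) k 0 = 0.
  move=> Py ak; rewrite -(AI y Py) -[y]mul1mx -UU' -mulmxA mulmxA (mulmxA (adj U *m A)) UAU dg_mulE.
  by rewrite ak mul0r.
have M'c : Mm mu' = c%:M.
  by rewrite Mm_gact_unitary ?adjK // Mc mul_mx_scalar -scalemxAl UU scalemx1.
have sm' : symbil mu' := gact_symbil (adj U) sm.
have e1 : c * \sum_i a i = \sum_i \sum_j \sum_k (a k - a i - a j) * `|mu' (e_ i) (e_ j) k 0| ^+ 2.
  by rewrite -ip_diag // -Mm_tr // M'c mul_scalar_mx linearZ /= dg_tr.
have c_lt0 : c * n%:R < 0.
  have := Mm_trace sm; rewrite Mc mxtrace_scalar mulr_natr => ->.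
  rewrite oppr_lt0 lt_def ip_ge0 andbT; apply/eqP => /(ip_eq0 sm) h; exact: ab0.
have n_gt0 : 0 < n%:R :> C.
  rewrite ltr0n lt0n; apply/eqP => n0; apply: xn; apply/colP => i.
  by have := ltn_ord i; rewrite [X in (_ < X)%N]n0.
have {}c_lt0 : c < 0 by rewrite -(pmulr_llt0 _ n_gt0).
have sa_gt0 : 0 < \sum_i a i.
  have a_ge0 i : 0 <= a i by case/orP: (a01 i) => /eqP ->.
  rewrite lt_def sumr_ge0 // andbT; apply/eqP => /eqP; rewrite psumr_eq0 // => /allP h.
  apply: xn; rewrite -(AI x Px).
  have A0 : A *m U = 0.
    rewrite -[A *m U]mul1mx -UU' -mulmxA (mulmxA (adj U)) UAU.
    have -> : dg a = 0.
      apply/matrixP => i j; rewrite !mxE; have /eqP -> := h i (mem_index_enum _).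
      by rewrite mul0rn.
    by rewrite mulmx0.
  have -> : A *m x = (A *m U) *m (adj U *m x) by rewrite -mulmxA (mulmxA U) UU' mul1mx.
  by rewrite A0 mul0mx.
have : c * \sum_i a i < 0 by rewrite pmulr_llt0.
(* The sum is nonnegative term by term. The coefficient [a k - a i - a j] is negative only in two
   situations: exactly one of [i], [j] belongs to [P] and [k] does not, where the structure constant
   vanishes because [P] is an ideal; or both belong to [P], where it vanishes because [P] has square
   zero. *)
rewrite e1 => /lt_geF /negP; apply; apply: sumr_ge0 => i _; apply: sumr_ge0 => j _; apply: sumr_ge0 => k _.
rewrite mu'E; case/orP: (a01 i) => /eqP ai; case/orP: (a01 j) => /eqP aj; case/orP: (a01 k) => /eqP ak;
  rewrite ai aj ak; try by rewrite mulr_ge0 ?exprn_ge0 // ?subr0 ?subrr ?ler01.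
- rewrite P0 ?normr0 ?expr0n ?mulr0 //.
  by apply: Pi; apply: PU.
- rewrite P0 ?normr0 ?expr0n ?mulr0 //.
  by rewrite (muC sm); apply: Pi; apply: PU.
- by rewrite (PP0 _ _ (PU i ai) (PU j aj)) mulmx0 mxE normr0 expr0n mulr0.
- by rewrite (PP0 _ _ (PU i ai) (PU j aj)) mulmx0 mxE normr0 expr0n mulr0.
Qed.

Definition Mm0 mu : 'M[C]_n := Mm mu - ((\tr (Mm mu)) / n%:R)%:M.

Lemma Mm0_herm mu : symbil mu -> adj (Mm0 mu) = Mm0 mu.
Proof.
move=> sm; rewrite /Mm0 adjB Mm_herm // -scalemx1 adjZ adj1 Mm_trace // mulNr; congr (_ - _ *: _).
rewrite rmorphN rmorphM /= fmorphV rmorph_nat.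
by congr (- (_ / _)); apply: conj_Creal; apply: ger0_real; apply: ip_ge0.
Qed.

(** The traceless and the scalar part are orthogonal, and since [tr M = - ip mu mu] the scalar part
    contributes [n * (ip mu mu / n)^2]. *)
Lemma Mm_sq mu : (0 < n)%N -> symbil mu ->
  \tr (Mm mu *m Mm mu) = \tr (Mm0 mu *m adj (Mm0 mu)) + ip mu mu ^+ 2 / n%:R.
Proof.
move=> n_gt0 sm; have n0 : n%:R != 0 :> C by rewrite pnatr_eq0 -lt0n.
have tr_sq (X : 'M[C]_n) c : \tr ((X - c%:M) *m (X - c%:M)) =
    \tr (X *m X) - c * \tr X - (c * \tr X - c * c * n%:R).
  have tB (Y Z : 'M[C]_n) : \tr (Y - Z) = \tr Y - \tr Z by rewrite raddfB.
  rewrite mulmxBl !mulmxBr !tB !mul_mx_scalar !mul_scalar_mx !mxtraceZ mxtrace_scalar.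
  by rewrite -[c *+ n]mulr_natr mulrA.
rewrite Mm0_herm // /Mm0 tr_sq Mm_trace //.
by field.
Qed.

Lemma Mm0_trace mu : (0 < n)%N -> \tr (Mm0 mu) = 0.
Proof.
move=> n_gt0; rewrite /Mm0 raddfB /= mxtrace_scalar -[_ *+ n]mulr_natr mulfVK ?subrr //.
by rewrite pnatr_eq0 -lt0n.
Qed.

Lemma Mm0_eq0_balanced mu : Mm0 mu = 0 -> balanced mu.
Proof. by move/eqP; rewrite subr_eq0 => /eqP M0; exists (\tr (Mm mu) / n%:R). Qed.

Lemma balanced_Mm0_eq0 mu : (0 < n)%N -> balanced mu -> Mm0 mu = 0.
Proof.
move=> n_gt0 [c Mc]; rewrite /Mm0 Mc mxtrace_scalar -[c *+ n]mulr_natr mulfK ?subrr //.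
by rewrite pnatr_eq0 -lt0n.
Qed.

Lemma derivation_kap mu D x y : symbil mu -> derivation mu D ->
  kap mu (D *m x) y + kap mu x (D *m y) = 0.
Proof.
move=> sm /(derivationP sm) dD; rewrite /kap -!dD tr_comm_l.
by rewrite addNr.
Qed.

Definition kapm mu : 'M[C]_n := \matrix_(i, j) kap mu (e_ i) (e_ j).

Lemma kap_mx mu x y : symbil mu -> kap mu x y = (x^T *m kapm mu *m y) 0 0.
Proof.
move=> sm; rewrite /kap {1}(cV_sum_delta x) {1}(cV_sum_delta y) !(Lm_sum sm).
rewrite mulr_sumr raddf_sum mxE; apply: eq_bigr => j _.
rewrite mulr_suml raddf_sum /= mxE mulr_suml; apply: eq_bigr => i _.
by rewrite !(LmZ sm) mxscaleAl mxscaleAr !linearZ /= !mxE /kap; ring.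
Qed.

Lemma kapm_unit mu : symbil mu -> kap_nondeg mu -> kapm mu \in unitmx.
Proof.
move=> sm nd; rewrite -row_free_unit -kermx_eq0; apply/eqP/row_matrixP => i; rewrite row0.
set r := row i _; have r0 : r *m kapm mu = 0 by apply/sub_kermxP; apply: row_sub.
apply: (can_inj trmxK); rewrite trmx0; apply: nd => y.
by rewrite kap_mx // trmxK r0 mul0mx mxE.
Qed.

Lemma kapm_derivation mu D : symbil mu -> derivation mu D -> D^T *m kapm mu = - (kapm mu *m D).
Proof.
move=> sm dD; apply/eqP; rewrite -addr_eq0; apply/eqP.
have entry (Z : 'M[C]_n) i j : ((e_ i)^T *m Z *m e_ j) 0 0 = Z i j.
  by rewrite trmx_delta -rowE -colE !mxE.
apply/matrixP => i j; rewrite -entry mulmxDr mulmxDl !mxE.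
have := derivation_kap (e_ i) (e_ j) sm dD; rewrite !kap_mx // trmx_mul !mulmxA.
by rewrite [X in X + _ = _]mxE [X in _ + X = _]mxE.
Qed.

(** A derivation is skew for [kap], so with the Gram matrix [K] one has [D^T = - K D K^-1], and
    [tr D = - tr D]. *)
Lemma derivation_traceless mu D : symbil mu -> kap_nondeg mu -> derivation mu D -> \tr D = 0.
Proof.
move=> sm nd dD; have uK := kapm_unit sm nd; have e := kapm_derivation sm dD.
have : \tr D^T = - \tr D.
  by rewrite -[D^T](mulmxK uK) e mulNmx raddfN /= mxtrace_mulC mulmxA mulVmx // mul1mx.
rewrite mxtrace_tr => /eqP; rewrite -addr_eq0 -mulr2n -mulr_natr mulf_eq0 pnatr_eq0 orbF.
by move/eqP.
Qed.

(** The vanishing trace of this derivation says [tr (M^2) = (ip mu mu)^2 / n], the case of [Mm_sq]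
    in which the traceless part has norm zero. *)
Lemma derivation_balanced mu : (0 < n)%N -> symbil mu -> kap_nondeg mu -> (exists a b, mu a b <> 0) ->
  derivation mu (Mm mu + (\tr (Mm mu *m Mm mu) / ip mu mu)%:M) -> balanced mu.
Proof.
move=> n_gt0 sm nd [a [b ab]] dM; have n0 : n%:R != 0 :> C by rewrite pnatr_eq0 -lt0n.
have ip0 : ip mu mu != 0 by apply/eqP => /(ip_eq0 sm) h; exact: ab.
have := derivation_traceless sm nd dM; rewrite raddfD /= Mm_trace // mxtrace_scalar -mulr_natr => e.
apply: Mm0_eq0_balanced; apply: tr_adj_eq0.
have := Mm_sq n_gt0 sm; move: e; set t := \tr (Mm mu *m Mm mu) => e.
have -> : t = ip mu mu ^+ 2 / n%:R.
  apply: (mulIf n0); apply: (mulIf (invr_neq0 ip0)).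
  have -> : ip mu mu ^+ 2 / n%:R * n%:R / ip mu mu = ip mu mu by field; rewrite n0 ip0.
  by apply/eqP; rewrite -subr_eq0 -e; apply/eqP; field.
by move/eqP; rewrite -subr_eq0 opprD addrCA subrr addr0 oppr_eq0 => /eqP.
Qed.

End Balanced.

(** * Degenerations of semisimple algebras *)

Section Ray.
Variables (C : numClosedFieldType) (n : nat).
Notation e_ i := (delta_mx i 0 : 'cV[C]_n).
Variable mu : 'cV[C]_n -> 'cV[C]_n -> 'cV[C]_n.
Hypotheses (mus : symbil mu) (muj : jordan_id mu) (nd : kap_nondeg mu).

Lemma mul_dgE m (b : 'I_n -> C) (X : 'M[C]_(m, n)) k j : (X *m dg b) k j = X k j * b j.
Proof.
rewrite mxE (bigD1 j) //= big1 ?addr0 => [|l lj]; first by rewrite mxE eqxx mulr1n.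
by rewrite mxE (negPf lj) mulr0.
Qed.

Definition in_Inn X := exists w : 'I_n -> 'I_n -> C,
  X = \sum_i \sum_j w i j *: Inn mu (e_ i) (e_ j).

Lemma tr_der_Inn X x y : derivation mu X -> \tr (X * Inn mu x y) = kap mu (X *m x) y.
Proof.
move=> /(derivationP mus) dX; rewrite /kap -dX /Inn.
by rewrite -tr_comm_cycle.
Qed.

Lemma in_Inn_derivation X : in_Inn X -> derivation mu X.
Proof.
case=> w ->; apply: big_ind => [|Y Z|i _]; [exact: derivation0|exact: derivationD|].
apply: big_ind => [|Y Z|j _]; [exact: derivation0|exact: derivationD|].
exact/derivationZ/Inn_derivation.
Qed.

Lemma derivation_comm X Y : derivation mu X -> derivation mu Y -> derivation mu (comm X Y).
Proof.
move=> /(derivationP mus) dX /(derivationP mus) dY; apply/(derivationP mus) => x.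
have := comm_jacobi X Y (Lm mu x); rewrite !(dX, dY) => /eqP; rewrite -subr_eq => /eqP <-.
by rewrite -(LmB mus) /comm mulmxBl -!mulmxA.
Qed.

(** [tr (X * Inn x y) = kap (X x) y], so nondegeneracy of [kap] separates derivations by their
    pairings with the inner ones. *)
Lemma derivation_eq0 X : derivation mu X ->
  (forall i j, \tr (X * Inn mu (e_ i) (e_ j)) = 0) -> X = 0.
Proof.
move=> dX X0; apply: cV_mx_eq => v; rewrite mul0mx; apply: nd => y.
rewrite (cV_sum_delta v) (cV_sum_delta y) mulmx_sumr /kap !(Lm_sum mus) mulr_suml raddf_sum big1 //= => i _.
rewrite mulr_sumr raddf_sum big1 //= => j _.
rewrite -scalemxAr !(LmZ mus) mxscaleAl mxscaleAr !linearZ /= -/(kap mu _ _) -tr_der_Inn // X0.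
by rewrite !mulr0.
Qed.

(** The Gram system for the coefficients is consistent even if the [Inn (e_i) (e_j)] are dependent:
    a vector in the kernel of the Gram matrix yields a derivation orthogonal to all inner ones,
    which is zero and so pairs to zero with [A] as well. *)
Lemma Inn_projection A : exists2 D, in_Inn D &
  forall i j, \tr (D * Inn mu (e_ i) (e_ j)) = \tr (A * Inn mu (e_ i) (e_ j)).
Proof.
pose N := #|{: 'I_n * 'I_n}|.
pose X (q : 'I_N) := Inn mu (e_ (enum_val q).1) (e_ (enum_val q).2).
pose G : 'M[C]_N := \matrix_(p, q) \tr (X p * X q).
pose f : 'rV[C]_N := \row_q \tr (A * X q).
have sumE (w : 'I_N -> C) : \sum_q w q *: X q =
    \sum_i \sum_j w (enum_rank (i, j)) *: Inn mu (e_ i) (e_ j).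
  rewrite pair_big /= (reindex (fun p : 'I_n * 'I_n => enum_rank p)) /=; last first.
    by exists (fun q => enum_val q) => q _; [apply: enum_rankK | apply: enum_valK].
  by apply: eq_bigr => -[i j] _; rewrite /X enum_rankK.
have inn w : in_Inn (\sum_q w q *: X q) by exists (fun i j => w (enum_rank (i, j))).
have XE i j : X (enum_rank (i, j)) = Inn mu (e_ i) (e_ j) by rewrite /X enum_rankK.
have /submxP[c fc] : (f <= G)%MS.
  rewrite submxE; apply/eqP/rowP => k; rewrite [RHS]mxE.
  pose w := col k (cokermx G).
  have Gw : G *m w = 0 by rewrite /w colE mulmxA mulmx_coker mul0mx.
  have X0 : \sum_q w q 0 *: X q = 0.
    apply: derivation_eq0; first exact/in_Inn_derivation/inn.
    move=> i j; rewrite tr_mulC -XE mulr_sumr raddf_sum /=.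
    have /colP/(_ (enum_rank (i, j))) := Gw; rewrite !mxE => h; rewrite -[RHS]h.
    by apply: eq_bigr => q _; rewrite mxscaleAr linearZ /= !mxE mulrC.
  have -> : (f *m cokermx G) 0 k = \tr (A * \sum_q w q 0 *: X q).
    rewrite mulr_sumr raddf_sum mxE /=; apply: eq_bigr => q _.
    by rewrite mxscaleAr linearZ /= !mxE mulrC.
  by rewrite X0 mulr0 raddf0.
exists (\sum_q c 0 q *: X q); first exact: inn.
move=> i j; rewrite -XE mulr_suml raddf_sum /=.
have /rowP/(_ (enum_rank (i, j))) := fc; rewrite !mxE => ->.
by apply: eq_bigr => q _; rewrite mxscaleAl linearZ /= !mxE.
Qed.

Section Weights.
Variables (R : realFieldType) (io : {rmorphism R -> C}) (a : 'I_n -> R).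
Hypothesis a_sum : \sum_i a i = 0.
Hypothesis a_ray : forall i j k, mu (e_ i) (e_ j) k 0 != 0 -> a k <= a i + a j.

Let A : 'M[C]_n := dg (fun i => io (a i)).

Lemma LmEE x k j : Lm mu x k j = mu x (e_ j) k 0.
Proof. by rewrite mxE. Qed.

Lemma kap_sum i m : kap mu (e_ i) (e_ m) =
  \sum_k \sum_j mu (e_ i) (e_ j) k 0 * mu (e_ m) (e_ k) j 0.
Proof.
by apply: eq_bigr => k _; rewrite mxE; apply: eq_bigr => j _; rewrite !LmEE.
Qed.

Lemma trA_sum i m : \tr (A * Inn mu (e_ i) (e_ m)) =
  \sum_k \sum_j io (a k - a j) * (mu (e_ i) (e_ j) k 0 * mu (e_ m) (e_ k) j 0).
Proof.
rewrite /Inn -tr_comm_cycle; apply: eq_bigr => k _; rewrite mxE; apply: eq_bigr => j _.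
rewrite LmEE mulrA; congr (_ * _).
have -> : comm A (Lm mu (e_ i)) k j = (A *m Lm mu (e_ i)) k j - (Lm mu (e_ i) *m A) k j by rewrite /comm [LHS]mxE [X in _ + X]mxE.
by rewrite dg_mulE mul_dgE LmEE rmorphB mulrBl [_ * io (a j)]mulrC.
Qed.

(** Two uses of [a_ray] confine the weight [a k - a j] of a nonzero term to the interval from
    [- a m] to [a i]. When [a i + a m = 0] this is a single point, and there [A] pairs as a
    derivation would. *)
Lemma supp2 i m k j : mu (e_ i) (e_ j) k 0 * mu (e_ m) (e_ k) j 0 != 0 ->
  a k - a j <= a i /\ - a m <= a k - a j.
Proof.
rewrite mulf_eq0 negb_or => /andP[/a_ray h1 /a_ray h2]; split; lra.
Qed.

Lemma kap_supp i m : kap mu (e_ i) (e_ m) != 0 -> 0 <= a i + a m.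
Proof.
apply: contraR; rewrite -ltNge => lt; rewrite kap_sum big1 // => k _; rewrite big1 // => j _.
by apply: contraTeq lt => /supp2[h1 h2]; rewrite -leNgt; lra.
Qed.

Lemma trA_supp i m : \tr (A * Inn mu (e_ i) (e_ m)) != 0 -> 0 <= a i + a m.
Proof.
apply: contraR; rewrite -ltNge => lt; rewrite trA_sum big1 // => k _; rewrite big1 // => j _.
apply/eqP; rewrite mulf_eq0; apply/orP; right; apply: contraTT lt => /supp2[h1 h2].
by rewrite -leNgt; lra.
Qed.

Lemma trA_eq i m : a i + a m = 0 ->
  \tr (A * Inn mu (e_ i) (e_ m)) = io (a i) * kap mu (e_ i) (e_ m).
Proof.
move=> eq; rewrite trA_sum kap_sum mulr_sumr; apply: eq_bigr => k _.
rewrite mulr_sumr; apply: eq_bigr => j _.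
case: (eqVneq (mu (e_ i) (e_ j) k 0 * mu (e_ m) (e_ k) j 0) 0) => [->|/supp2[h1 h2]].
  by rewrite !mulr0.
by congr (io _ * _); lra.
Qed.

(** A nonzero cofactor contains a permutation product without zero factor, and [kap_supp] gives each
    factor a nonnegative sum of weights. The minor omits row [l] and column [m]; since all weights
    sum to zero, adding up the inequalities leaves [- a l - a m >= 0]. *)
Lemma kinv_supp m l : invmx (kapm mu) m l != 0 -> a m + a l <= 0.
Proof.
have uK := kapm_unit mus nd; rewrite /invmx uK mxE mulf_eq0 negb_or => /andP[_].
rewrite mxE /cofactor mulf_eq0 negb_or => /andP[_]; rewrite /determinant.
move=> h; have [s sP] : exists s : 'S_n.-1, forall i, kapm mu (lift l i) (lift m (s i)) != 0.
  apply: contrapT => no; move/eqP: h; apply; rewrite big1 // => s _.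
  apply/eqP; rewrite mulf_eq0; apply/orP; right.
  apply/prodf_eq0; apply: contrapT => no'; apply: no; exists s => i.
  by apply/negP => h0; apply: no'; exists i => //; rewrite !mxE in h0 *.
have a_sumD l0 : \sum_i a i = a l0 + \sum_i a (lift l0 i).
  by rewrite (bigD1_ord l0).
have : 0 <= \sum_i (a (lift l i) + a (lift m (s i))).
  by apply: sumr_ge0 => i _; apply: kap_supp; have := sP i; rewrite mxE.
rewrite big_split /=.
have -> : \sum_i a (lift m (s i)) = \sum_i a (lift m i) by rewrite [RHS](reindex_inj (@perm_inj _ s)).
have := a_sumD l; have := a_sumD m; rewrite a_sum; lra.
Qed.

Lemma kapm_invK i l : \sum_m kap mu (e_ i) (e_ m) * invmx (kapm mu) m l = (i == l)%:R.
Proof.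
have /matrixP/(_ i l) := mulmxV (kapm_unit mus nd); rewrite !mxE => <-.
by apply: eq_bigr => m _; rewrite mxE.
Qed.

Lemma der_entry D i l : derivation mu D ->
  D l i = \sum_m kap mu (D *m e_ i) (e_ m) * invmx (kapm mu) m l.
Proof.
move=> dD; have uK := kapm_unit mus nd.
transitivity (((D *m e_ i)^T *m kapm mu *m invmx (kapm mu)) 0 l).
  by rewrite mulmxK // -colE !mxE.
rewrite mxE; apply: eq_bigr => m _; rewrite kap_mx //; congr (_ * _).
by move: (_^T *m kapm mu) => X; rewrite -colE mxE.
Qed.

(** By [der_entry], [D l i] is the sum over [m] of [tr (A * Inn (e_i) (e_m))] times the entry
    [(m, l)] of the inverse Gram matrix. A nonzero term needs [a i + a m >= 0 >= a m + a l], so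
    [a l <= a i]. In case of equality [a m = - a i], the pairing is [a i] times [kap], and the sum
    collapses to an entry of the identity. *)
Lemma ray_triangular : exists2 D, in_Inn D &
  (forall i j, \tr (D * Inn mu (e_ i) (e_ j)) = \tr (A * Inn mu (e_ i) (e_ j))) /\
  forall l i, (a i < a l -> D l i = 0) /\ (a l = a i -> D l i = io (a i) *+ (l == i)).
Proof.
have [D iD DA] := Inn_projection A; exists D => //; split=> //.
have dD := in_Inn_derivation iD.
have S i m : kap mu (D *m e_ i) (e_ m) = \tr (A * Inn mu (e_ i) (e_ m)) by rewrite -DA tr_der_Inn.
move=> l i; rewrite (der_entry _ _ dD); split=> [lt|eq].
  apply: big1 => m _; apply/eqP; rewrite mulf_eq0; apply/norP => -[].
  rewrite S => /trA_supp h1 /kinv_supp h2; move: lt; rewrite ltNge => /negP; apply; lra.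
have -> : io (a i) *+ (l == i) = io (a i) * \sum_m kap mu (e_ i) (e_ m) * invmx (kapm mu) m l.
  by rewrite kapm_invK mulr_natr eq_sym.
rewrite mulr_sumr; apply: eq_bigr => m _; rewrite S mulrA.
case: (eqVneq (invmx (kapm mu) m l) 0) => [->|/kinv_supp h2]; first by rewrite !mulr0.
congr (_ * _); case: (eqVneq (a i + a m) 0) => [|/eqP ne]; first exact: trA_eq.
case: (eqVneq (\tr (A * Inn mu (e_ i) (e_ m))) 0) => [->|/trA_supp h1]; last by exfalso; apply: ne; lra.
case: (eqVneq (kap mu (e_ i) (e_ m)) 0) => [->|/kap_supp h1]; last by exfalso; apply: ne; lra.
by rewrite mulr0.
Qed.

(* Triangularity of [D] for the filtration by [a], with scalar diagonal blocks. *)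
Definition tri_diag (X : 'M[C]_n) (f : R -> C) :=
  (forall l i, X l i != 0 -> (a l < a i) || (l == i)) /\ forall i, X i i = f (a i).

Lemma tri_mul X Y f g : tri_diag X f -> tri_diag Y g -> tri_diag (X * Y) (fun c => f c * g c).
Proof.
move=> [tX dX] [tY dY]; split=> [l i|i].
  rewrite mxE; apply: contraR; rewrite negb_or -leNgt => /andP[le ne]; apply/eqP/big1 => k _.
  apply/eqP; rewrite mulf_eq0; apply/norP => -[/tX h1 /tY h2].
  case/orP: h1 => [h1|/eqP e1]; case/orP: h2 => [h2|/eqP e2].
  - by have := lt_trans h1 h2; rewrite ltNge le.
  - by move: h1; rewrite e2 ltNge le.
  - by move: h2; rewrite -e1 ltNge le.
  - by move: ne; rewrite e1 e2 eqxx.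
rewrite mxE (bigD1 i) //= dX dY big1 ?addr0 // => k ki; apply/eqP; rewrite mulf_eq0; apply/norP.
case=> /tX + /tY; rewrite (negPf ki) eq_sym (negPf ki) !orbF => h1 h2.
by have := lt_trans h1 h2; rewrite ltxx.
Qed.

Lemma tri_pmx D : tri_diag D io -> forall q, tri_diag (pmx D q) (fun c => q.[io c]).
Proof.
move=> tD; have t1 (c : C) : tri_diag c%:M (fun=> c).
  split=> [l i|i]; last by rewrite mxE eqxx mulr1n.
  by rewrite mxE; case: (l == i); rewrite ?orbT // mulr0n eqxx.
elim/poly_ind => [|q c [IH1 IH2]].
  by split=> [l i|i]; rewrite pmx0 mxE ?eqxx // horner0.
have [m1 m2] := tri_mul (conj IH1 IH2 : tri_diag (pmx D q) (fun c => q.[io c])) tD.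
rewrite pmxD pmxM pmxX pmxC; split=> [l i|i].
  apply: contraR => h; rewrite mxE.
  have /eqP -> : (pmx D q * D) l i == 0 by apply: contraR h => /m1.
  by have /eqP -> : (c%:M : 'M[C]_n) l i == 0 by [apply: contraR h => /(t1 c).1]; rewrite addr0.
by rewrite mxE m2 (t1 c).2 hornerD hornerM hornerX hornerC.
Qed.

(** Induction on the lower set [P]: for its top weight [c], the matrix [D - c] sends vectors
    supported on [P] to vectors supported on smaller weights, because the diagonal blocks of [D] are
    scalar. For [P] full this is a squarefree annihilating polynomial, so [D] is diagonalizable. *)
Lemma tri_annihilated D : tri_diag D io -> forall P : pred 'I_n,
  (forall i j, P j -> a i <= a j -> P i) ->
  exists s : seq R, [/\ uniq s, forall c, c \in s -> exists2 i, P i & a i = c,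
    forall i, P i -> a i \in s &
    forall v : 'cV[C]_n, (forall i, v i 0 != 0 -> P i) ->
      pmx D (\prod_(c <- s) ('X - (io c)%:P)) *m v = 0].
Proof.
move=> [tD dD] P; have [k] := ubnP #|P|; elim: k P => // k IH P Pk Pl.
case: (pickP P) => [i0 Pi0|P0]; last first.
  exists [::]; split=> //= [i|v vP]; first by rewrite P0.
  rewrite big_nil pmx1 mul1mx; apply/colP => i; rewrite mxE; apply/eqP/negPn/negP => /vP.
  by rewrite P0.
case: (arg_maxP a Pi0) => i1 Pi1 max1; set c := a i1.
have [|i j /andP[Pj lt] le|s [us sP' Ps sv]] := IH [pred i | P i && (a i < c)].
- rewrite -ltnS; apply: leq_trans Pk; rewrite ltnS; apply: proper_card; apply/properP; split.
    by apply/fintype.subsetP => i /andP[].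
  by exists i1; rewrite // !inE ltxx andbF.
- by apply/andP; split; [apply: Pl Pj le | apply: le_lt_trans le lt].
exists (c :: s); split=> [|d|i Pi|v vP].
- by rewrite /= us andbT; apply/negP => /sP'[i /andP[_ +] e]; rewrite e ltxx.
- by rewrite inE => /orP[/eqP ->|/sP'[i /andP[Pi _] e]]; [exists i1 | exists i].
- rewrite inE; case: (eqVneq (a i) c) => //= ne; apply: Ps; apply/andP; split=> //.
  by rewrite lt_neqAle ne; apply: max1.
rewrite big_cons mulrC pmxM -[_ *m v]mulmxA; apply: sv => l.
rewrite pmxB pmxX pmxC mulmxBl mul_scalar_mx => nz.
case: (boolP (P l && (a l < c))) => // no; case/negP: nz; apply/eqP.
have cl : c <= a l.
  rewrite leNgt; apply/negP => lt; move: no; rewrite lt andbT => /negP; apply.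
  by apply: (Pl l i1) => //; apply: ltW.
have -> : (D *m v - io c *: v) l 0 = \sum_i D l i * v i 0 - io c * v l 0 by rewrite !mxE.
rewrite (bigD1 l) //= big1 ?addr0 => [|i il].
  case: (eqVneq (v l 0) 0) => [->|/vP Pl0]; first by rewrite !mulr0 subrr.
  by rewrite dD (_ : a l = c) ?subrr //; apply/eqP; rewrite eq_le cl andbT; apply: max1.
apply/eqP; rewrite mulf_eq0; apply/norP => -[/tD + /vP Pi].
rewrite eq_sym (negPf il) orbF ltNge => /negP; apply; exact: le_trans (max1 i Pi) cl.
Qed.

(* [D] is the inner derivation dual to [A] under the trace form, and the columns of
   [p] are the spectral projections of [D] applied to the basis. *)
Lemma ray_derivation : exists p : 'M[C]_n, [/\ p \in unitmx,
  derivation mu (p *m A *m invmx p)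
  & forall t, derivation mu (dg t) -> p *m dg t = dg t *m p].
Proof.
have [D iD [DA DT]] := ray_triangular; have dD := in_Inn_derivation iD.
have tD : tri_diag D io.
  split=> [l i|i]; last by rewrite (DT i i).2 // eqxx.
  apply: contraR; rewrite negb_or -leNgt le_eqVlt => /andP[/orP[/eqP e|lt] ne]; last by rewrite (DT l i).1.
  by rewrite (DT l i).2 // (negPf ne).
have [s [us _ sa sv]] := tri_annihilated tD (P := predT) (fun _ _ _ _ => isT).
(* Lagrange polynomials at the weights; on [D] they give the spectral projection for the eigenvalue
   [io c]. *)
pose ppi (c : R) : {poly C} := \prod_(d <- rem c s) (('X - (io d)%:P) * (io c - io d)^-1%:P).
have ppi1 c : (ppi c).[io c] = 1.
  rewrite horner_prod big_seq big1 // => d; rewrite mem_rem_uniq // inE => /andP[dc _].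
  rewrite !hornerE mulfV // subr_eq0; apply: contraNneq dc => /fmorph_inj ->; exact: eqxx.
have ppiD c (v : 'cV[C]_n) : c \in s -> D *m (pmx D (ppi c) *m v) = io c *: (pmx D (ppi c) *m v).
  move=> cs; apply/eqP; rewrite -subr_eq0 -mul_scalar_mx -mulmxBl -(pmxC D) -{1}(pmxX D) -pmxB mulmxA.
  rewrite -[_ *m pmx D _]pmxM /ppi big_split mulrA /= mulrC pmxM -[_ *m v]mulmxA.
  have -> : ('X - (io c)%:P) * \prod_(d <- rem c s) ('X - (io d)%:P) = \prod_(d <- s) ('X - (io d)%:P) by rewrite [RHS](big_rem c).
  by rewrite sv ?mulmx0.
pose p : 'M[C]_n := \matrix_(l, i) (pmx D (ppi (a i))) l i.
have pe i : p *m e_ i = pmx D (ppi (a i)) *m e_ i.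
  by apply/colP => l; rewrite -!colE !mxE.
have Dp : D *m p = p *m A.
  apply/matrixP => l i; rewrite mul_dgE.
  have /colP/(_ l) := ppiD (a i) (e_ i) (sa i isT); rewrite -pe mulmxA -!colE [LHS]mxE => ->.
  by rewrite !mxE mulrC.
(* [p] is triangular for the filtration by [a], with unit diagonal; a kernel vector is read at the
   largest weight of its support. *)
have up : p \in unitmx.
  rewrite -unitmx_tr -row_free_unit -kermx_eq0; apply/eqP/row_matrixP => r; rewrite row0.
  set v := row r _; have v0 : v *m p^T = 0 by apply/sub_kermxP; apply: row_sub.
  have {}v0 : p *m v^T = 0 by apply: (can_inj trmxK); rewrite trmx_mul trmxK v0 trmx0.
  apply: contrapT => vn; have [i0 vi0] : exists i0, v^T i0 0 != 0.
    apply: contrapT => no; apply: vn; apply/rowP => i; rewrite [RHS]mxE; apply: contrapT => /eqP vi.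
    by apply: no; exists i; rewrite mxE.
  case: (@arg_maxP _ _ _ i0 (fun i => v^T i 0 != 0) a vi0) => l vl maxl; case/negP: vl.
  have /colP/(_ l) := v0; rewrite mxE (bigD1 l) //= big1 => [|i il].
    rewrite addr0 [RHS]mxE [p l l]mxE (tri_pmx tD _).2 ppi1 mul1r => -> //.
  apply/eqP; rewrite mulf_eq0; apply/norP => -[+ /maxl le].
  rewrite mxE => /(tri_pmx tD _).1; rewrite eq_sym (negPf il) orbF ltNge => /negP; apply; exact: le.
exists p; split=> //.
  by rewrite -Dp mulmxK.
(* [dg t] commutes with the diagonal matrix [A] and acts on each [Inn (e_i) (e_j)] by a scalar.
   Hence [comm (dg t) D] has the same pairings with inner derivations as [comm (dg t) A = 0], and
   being a derivation it vanishes. *)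
move=> t dt; have TD : dg t * D = D * dg t.
  apply/eqP; rewrite -subr_eq0; apply/eqP; rewrite -/(comm (dg t) D).
  apply: derivation_eq0 => [|i j]; first exact: derivation_comm.
  have cT : comm (dg t) (Inn mu (e_ i) (e_ j)) = (t i + t j) *: Inn mu (e_ i) (e_ j).
    have /(derivationP mus) dT := dt; rewrite /Inn comm_jacobi !dT !dg_mul_delta !(LmZ mus).
    by rewrite scalerDl /comm !mxscaleAl !mxscaleAr !scalerBr.
  rewrite tr_comm_l cT mxscaleAr linearZ /= DA -linearZ /= -mxscaleAr -cT -tr_comm_l.
  suff -> : comm (dg t) A = 0 by rewrite mul0r raddf0.
  apply/eqP; rewrite subr_eq0; apply/eqP/matrixP => k l.
  by rewrite [LHS]mul_dgE [RHS]mul_dgE !mxE; case: eqP => [->|]; rewrite ?mulr0n ?mul0r // mulrC.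
have comm_p q : pmx D q * dg t = dg t * pmx D q by apply: pmx_comm.
apply/matrixP => l i; rewrite mul_dgE.
have /colP/(_ l) : p *m (dg t *m e_ i) = dg t *m (p *m e_ i).
  by rewrite dg_mul_delta -scalemxAr pe mulmxA -[_ *m pmx D _]comm_p -[_ * _ *m _]mulmxA dg_mul_delta -scalemxAr.
rewrite dg_mul_delta -scalemxAr mulmxA -!colE
  [X in X = _ -> _]mxE [X in _ * X = _ -> _]mxE [X in _ = X -> _]mxE => <-.
by rewrite mulrC.
Qed.

End Weights.
End Ray.

(** * Minimizing a sum of exponentials *)

Section ContinuousRow.
Variables (R : realType) (N : nat).
Implicit Types (f g : 'rV[R]_N -> R).

Lemma cont_coord i : continuous (fun z : 'rV[R]_N => z 0 i : R).
Proof. exact: coord_continuous. Qed.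

Lemma cont_cst c : continuous (fun _ : 'rV[R]_N => c : R).
Proof. exact: cst_continuous. Qed.

Lemma contD f g : continuous f -> continuous g -> continuous (fun z => f z + g z).
Proof. by move=> cf cg z; apply: continuousD; [exact: cf | exact: cg]. Qed.

Lemma contM f g : continuous f -> continuous g -> continuous (fun z => f z * g z).
Proof. by move=> cf cg z; apply: continuousM; [exact: cf | exact: cg]. Qed.

Lemma cont_comp f (h : R -> R) : continuous f -> continuous h -> continuous (fun z => h (f z)).
Proof. by move=> cf ch z; apply: continuous_comp; [exact: cf | exact: ch]. Qed.

Lemma contN f : continuous f -> continuous (fun z => - f z).
Proof.
move=> cf; rewrite (_ : (fun z => - f z) = (fun z => -1 * f z)); last first.
  by apply/funext => z; rewrite mulN1r.
exact/contM/cf/cont_cst.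
Qed.

Lemma contB f g : continuous f -> continuous g -> continuous (fun z => f z - g z).
Proof. by move=> cf cg; apply/contD/contN. Qed.

Lemma cont_sum (I : Type) (r : seq I) (F : I -> 'rV[R]_N -> R) :
  (forall i, continuous (F i)) -> continuous (fun z => \sum_(i <- r) F i z).
Proof.
move=> cF; elim: r => [|i r IH].
  rewrite (_ : (fun _ => _) = (fun _ => 0)); first exact: cont_cst.
  by apply/funext => z; rewrite big_nil.
rewrite (_ : (fun _ => _) = (fun z => F i z + \sum_(j <- r) F j z)); first exact: contD.
by apply/funext => z; rewrite big_cons.
Qed.

Lemma closed_zero f : continuous f -> closed [set z | f z = 0].
Proof.
move=> cf; apply: (@preimage_closed _ _ f [set x | x = 0]) => [z _|]; first exact: cf.
exact: closed_eq.
Qed.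

Lemma box_closed_min (K : set 'rV[R]_N) f (M : R) : closed K -> (exists z, K z) ->
  (forall z, K z -> forall i, `|z 0 i| <= M) -> continuous f ->
  exists2 z, K z & forall z', K z' -> f z <= f z'.
Proof.
move=> cK [z0 Kz0] KM cf.
have cpt : compact K.
  have -> : K = [set v : 'rV[R]_N | forall i, `[(- M), M]%classic (v 0 i)] `&` K.
    apply/seteqP; split=> z /=; last by case.
    by move=> Kz; split=> // i; rewrite /= in_itv /= -ler_norml KM.
  apply: compact_closedI => //; apply: (@rV_compact R N (fun=> `[(- M), M]%classic)) => i.
  exact: segment_compact.
have [||c cK' cmin] := @compact_EVT_min _ R f K _ cpt; first by exists z0.
  exact: continuous_subspaceT.
by exists c; [rewrite inE in cK' | move=> z' Kz'; apply: cmin; rewrite inE].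
Qed.

End ContinuousRow.

(** The first block of coordinates is bounded, the second ranges over a cone. Along every nonzero
    direction [b] of the cone some exponential with positive coefficient grows, and compactness of
    the unit directions makes this growth uniform. *)
Lemma coercive_min (R : realType) (d n : nat) (L : finType) (w : L -> 'rV[R]_(d + n) -> R)
    (c : L -> 'I_n -> R) (K : set 'rV[R]_(d + n)) (M : R) :
  let be l (b : 'rV[R]_n) := \sum_i c l i * b 0 i in
  let F z := \sum_l expR (be l (rsubmx z)) * w l z in
  (forall l, continuous (w l)) -> (forall l z, 0 <= w l z) ->
  (forall l x b b', w l (row_mx x b) = w l (row_mx x b')) ->
  closed K -> (exists z, K z) ->
  (forall z, K z -> forall i, `|lsubmx z 0 i| <= M) ->
  (forall x b s, K (row_mx x b) -> 0 <= s -> K (row_mx x (s *: b))) ->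
  (forall x b, K (row_mx x b) -> b != 0 -> exists l, 0 < w l (row_mx x b) /\ 0 < be l b) ->
  exists2 z, K z & forall z', K z' -> F z <= F z'.
Proof.
move=> be F cw w0 wb clK Kne KM Kcone noray.
have cb i : continuous (fun z : 'rV[R]_(d + n) => rsubmx z 0 i).
  have -> : (fun z : 'rV[R]_(d + n) => rsubmx z 0 i) = (fun z => z 0 (rshift d i)).
    by apply/funext => z; rewrite mxE.
  exact: cont_coord.
have cbe l : continuous (fun z : 'rV[R]_(d + n) => be l (rsubmx z)).
  apply: cont_sum => i; apply: (@contM _ _ (fun=> c l i) (fun z => rsubmx z 0 i)).
    exact: cont_cst.
  exact: cb.
pose q (b : 'rV[R]_n) : R := \sum_i `|b 0 i|.
have q_ge (b : 'rV[R]_n) i : `|b 0 i| <= q b by rewrite /q (bigD1 i) //= lerDl sumr_ge0.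
have q0 (b : 'rV[R]_n) : 0 <= q b by apply: sumr_ge0.
have qZ s (b : 'rV[R]_n) : 0 <= s -> q (s *: b) = s * q b.
  by move=> s0; rewrite /q mulr_sumr; apply: eq_bigr => i _; rewrite mxE normrM ger0_norm.
have q_eq0 (b : 'rV[R]_n) : q b = 0 -> b = 0.
  move=> qb; apply/rowP => i; rewrite mxE; apply/eqP; rewrite -normr_le0 -qb; exact: q_ge.
have cq : continuous (fun z : 'rV[R]_(d + n) => q (rsubmx z)).
  by apply: cont_sum => i; apply: (cont_comp (cb i)); apply: norm_continuous.
have cF : continuous F.
  by apply: cont_sum => l; apply: contM => //; apply: (cont_comp (cbe l)); apply: continuous_expR.
have F0 z : 0 <= F z by apply: sumr_ge0 => l _; rewrite mulr_ge0 // expR_ge0.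
(* Built from twice the positive part of the exponents: unlike [F] it is homogeneous of degree one
   in [b], and [1 + t <= exp t] bounds it by [2 * F]. *)
pose phi (z : 'rV[R]_(d + n)) := \sum_l (be l (rsubmx z) + `|be l (rsubmx z)|) * w l z.
have cphi : continuous phi.
  apply: cont_sum => l; apply: contM => //; apply: contD => //.
  by apply: (cont_comp (cbe l)); apply: norm_continuous.
have bound z (r : R) : K z -> q (rsubmx z) <= r -> forall i, `|z 0 i| <= Num.max M r.
  move=> Kz qr i; case: (split_ordP i) => j ->; rewrite le_max.
    by have := KM z Kz j; rewrite mxE => ->.
  by apply/orP; right; apply: le_trans qr; have := q_ge (rsubmx z) j; rewrite mxE.
have phi_le (z : 'rV[R]_(d + n)) : phi z <= 2 * F z.
  rewrite mulr_sumr; apply: ler_sum => l _; rewrite mulrA ler_wpM2r //.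
  have := expR_ge1Dx (be l (rsubmx z)); have := expR_ge0 (be l (rsubmx z)).
  by case: (ler0P (be l (rsubmx z))) => _; lra.
have rowE (z : 'rV[R]_(d + n)) : z = row_mx (lsubmx z) (rsubmx z) by rewrite hsubmxK.
have pos_abs (t : R) : 0 <= t + `|t| by case: (ler0P t) => h; lra.
have beZ l s (b : 'rV[R]_n) : be l (s *: b) = s * be l b.
  by rewrite /be mulr_sumr; apply: eq_bigr => i _; rewrite mxE mulrCA.
have phiZ x (b : 'rV[R]_n) s : 0 <= s -> phi (row_mx x (s *: b)) = s * phi (row_mx x b).
  move=> s0; rewrite mulr_sumr; apply: eq_bigr => l _.
  by rewrite !row_mxKr beZ normrM (ger0_norm s0) -mulrDr (wb l x _ b) mulrA.
have phi_pos z : K z -> rsubmx z != 0 -> 0 < phi z.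
  move=> Kz bn; move: Kz; rewrite (rowE z) => Kz; have [l [wl bl]] := noray _ _ Kz bn.
  rewrite /phi (bigD1 l) //= ltr_wpDr //; first by apply: sumr_ge0 => l' _; rewrite mulr_ge0.
  by rewrite mulr_gt0 // row_mxKr ger0_norm ?ltW // addr_gt0.
have normalize z : K z -> rsubmx z != 0 ->
    K (row_mx (lsubmx z) ((q (rsubmx z))^-1 *: rsubmx z)) /\ q ((q (rsubmx z))^-1 *: rsubmx z) = 1.
  move=> Kz bn; have qn : q (rsubmx z) != 0 by apply: contra_neq bn; apply: q_eq0.
  by split; [apply: Kcone; rewrite -?rowE ?invr_ge0 | rewrite qZ ?invr_ge0 // mulVf].
have [delta delta0 coer] : exists2 delta, 0 < delta & forall z, K z -> delta * q (rsubmx z) <= F z.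
  pose K1 := K `&` [set z | q (rsubmx z) - 1 = 0].
  have clK1 : closed K1 by apply: closedI => //; apply: closed_zero; apply: contB => //; apply: cont_cst.
  have K1q z : K1 z -> K z /\ q (rsubmx z) = 1 by case=> Kz /eqP; rewrite subr_eq0 => /eqP.
  case: (pselect (exists z, K1 z)) => [K1ne|no]; last first.
    exists 1 => // z Kz; rewrite mul1r; case: (eqVneq (rsubmx z) 0) => [b0|bn].
      by rewrite b0 -(scale0r (0 : 'rV_n)) qZ // mul0r.
    have [Kz' qz'] := normalize z Kz bn; case: no.
    by eexists; split; [exact: Kz' | rewrite /= row_mxKr qz' subrr].
  have bndK1 z : K1 z -> forall i, `|z 0 i| <= Num.max M 1.
    by case/K1q => Kz qz; apply: bound => //; rewrite qz.
  have [z1 K1z1 min1] := box_closed_min clK1 K1ne bndK1 cphi.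
  have [Kz1 qz1] := K1q _ K1z1.
  have phi1 : 0 < phi z1.
    apply: phi_pos => //; apply: contra_eq_neq qz1 => ->.
    by rewrite -(scale0r (0 : 'rV_n)) qZ // mul0r eq_sym oner_eq0.
  exists (phi z1 / 2); first by rewrite divr_gt0.
  move=> z Kz; case: (eqVneq (rsubmx z) 0) => [b0|bn].
    by rewrite b0 -(scale0r (0 : 'rV_n)) qZ // mul0r mulr0.
  have [Kz' qz'] := normalize z Kz bn.
  have qn : q (rsubmx z) != 0 by apply: contra_neq bn; apply: q_eq0.
  have : phi z1 <= phi (row_mx (lsubmx z) ((q (rsubmx z))^-1 *: rsubmx z)).
    by apply: min1; split=> //=; rewrite row_mxKr qz' subrr.
  rewrite phiZ ?invr_ge0 // -rowE mulrC ler_pdivlMr; last by rewrite lt_def qn q0.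
  move=> h; rewrite mulrAC ler_pdivrMr // mulrC [F z * 2]mulrC mulrC; exact: le_trans h (phi_le z).
have [z0 Kz0] := Kne.
(* Outside this radius [F] exceeds [F z0], so a minimum over the compact set [K2] is a minimum over
   [K]. *)
pose K2 := K `&` [set z | q (rsubmx z) <= F z0 / delta].
have K2z0 : K2 z0 by split=> //=; rewrite ler_pdivlMr // mulrC; apply: coer.
have clK2 : closed K2.
  apply: closedI => //; apply: (@preimage_closed _ _ (fun z => q (rsubmx z)) [set x | x <= F z0 / delta]) => [z _|].
    exact: cq.
  exact: closed_le.
have bndK2 z : K2 z -> forall i, `|z 0 i| <= Num.max M (F z0 / delta).
  by move=> [Kz qz]; apply: bound.
have [z K2z minz] := box_closed_min clK2 (ex_intro _ z0 K2z0) bndK2 cF.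
exists z; first by case: K2z.
move=> z' Kz'; case: (leP (q (rsubmx z')) (F z0 / delta)) => [le|lt]; first exact: minz.
apply: le_trans (minz _ K2z0) _; apply: le_trans (coer z' Kz'); rewrite mulrC -ler_pdivrMr //.
exact: ltW.
Qed.

Lemma is_derive_bigsum (R : realType) (I : Type) (r : seq I) (F : I -> R -> R) (dF : I -> R) (x : R) :
  (forall i, is_derive x 1 (F i) (dF i)) ->
  is_derive x 1 (fun s => \sum_(i <- r) F i s) (\sum_(i <- r) dF i).
Proof.
move=> h; elim: r => [|i r IH].
  rewrite (_ : (fun _ => _) = cst 0) ?big_nil; first exact: is_derive_cst.
  by apply/funext => s; rewrite big_nil.
rewrite (_ : (fun _ => _) = F i + (fun s => \sum_(j <- r) F j s)) ?big_cons; first exact: is_deriveD.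
by apply/funext => s; rewrite big_cons.
Qed.

Lemma expR_sum_critical (R : realType) (L : finType) (w be : L -> R) :
  (forall s, \sum_l w l <= \sum_l expR (s * be l) * w l) -> \sum_l be l * w l = 0.
Proof.
move=> h; pose f (s : R) := \sum_l expR (s * be l) * w l.
have df (t : R) : is_derive t 1 f (\sum_l be l * expR (t * be l) * w l).
  apply: is_derive_bigsum => l.
  have d1 : is_derive t 1 (fun s : R => s * be l) (be l).
    rewrite (_ : (fun s : R => s * be l) = be l *: (id : R -> R)); last first.
      by apply/funext => s; rewrite mulrC.
    by rewrite -[X in is_derive _ _ _ X]mulr1; apply: is_deriveZ.
  have d2 : is_derive t 1 (expR \o (fun s : R => s * be l)) (be l * expR (t * be l)).
    have := @is_derive1_comp R expR (fun s : R => s * be l) t _ _ (is_derive_expR (t * be l)) d1.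
    by rewrite mulrC.
  rewrite (_ : (fun s : R => _) = w l *: (expR \o (fun s : R => s * be l))); last first.
    by apply/funext => s; rewrite mulrC.
  rewrite mulrC; exact: is_deriveZ.
have d0 : is_derive (0 : R) 1 f 0.
  apply: (@derive1_at_min R f (-1) 1 0); rewrite ?in_itv /= ?ltrN10 ?ltr01 //.
  move=> t _; rewrite /f; under eq_bigr do rewrite mul0r expR0 mul1r.
  exact: h.
have e1 := @derive_val _ _ _ _ _ _ _ d0; have e2 := @derive_val _ _ _ _ _ _ _ (df 0).
rewrite -[RHS]e1 e2; apply: eq_bigr => l _.
by rewrite mul0r expR0 mulr1.
Qed.

Section ComplexParts.
Variables (R : realType) (C : numClosedFieldType) (io : {rmorphism R -> C}).
Hypothesis io_real : forall z : C, z \is Num.real -> exists r, z = io r.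
Hypothesis io_ge0 : forall r, (0 <= io r) = (0 <= r).

(** [C] is an abstract closed field with the reals embedded by [io]; the preimages of real and
    imaginary parts are chosen in order to use the topology of [R]. *)
Definition re (z : C) : R := projT1 (cid (io_real (Creal_Re z))).
Definition im (z : C) : R := projT1 (cid (io_real (Creal_Im z))).

Lemma reE z : io (re z) = 'Re z. Proof. by rewrite /re; case: cid. Qed.
Lemma imE z : io (im z) = 'Im z. Proof. by rewrite /im; case: cid. Qed.

Lemma io_inj : injective io. Proof. exact: fmorph_inj. Qed.

Lemma ioR r : io r \is Num.real.
Proof.
rewrite realE io_ge0; case: (lerP 0 r) => //= r0.
by rewrite -oppr_ge0 -rmorphN io_ge0 oppr_ge0 ltW.
Qed.

Lemma reD x y : re (x + y) = re x + re y.
Proof. by apply: io_inj; rewrite rmorphD !reE raddfD. Qed.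
Lemma imD x y : im (x + y) = im x + im y.
Proof. by apply: io_inj; rewrite rmorphD !imE raddfD. Qed.

Lemma reM x y : re (x * y) = re x * re y - im x * im y.
Proof.
apply: io_inj; rewrite rmorphB !rmorphM /= !reE !imE {1}(Crect x) {1}(Crect y) mulC_rect Re_rect //.
  by rewrite rpredB // rpredM // ?Creal_Re ?Creal_Im.
by rewrite rpredD // rpredM // ?Creal_Re ?Creal_Im.
Qed.

Lemma imM x y : im (x * y) = re x * im y + im x * re y.
Proof.
apply: io_inj; rewrite rmorphD !rmorphM /= !reE !imE {1}(Crect x) {1}(Crect y) mulC_rect Im_rect.
- by rewrite ['Im x * _]mulrC.
- by rewrite rpredB // rpredM // ?Creal_Re ?Creal_Im.
by rewrite rpredD // rpredM // ?Creal_Re ?Creal_Im.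
Qed.

Lemma re_conj x : re x^* = re x.
Proof. by apply: io_inj; rewrite !reE Re_conj. Qed.
Lemma im_conj x : im x^* = - im x.
Proof. by apply: io_inj; rewrite rmorphN /= !imE Im_conj. Qed.

Lemma re_io r : re (io r) = r.
Proof. by apply: io_inj; rewrite reE; apply/Creal_ReP/ioR. Qed.
Lemma im_io r : im (io r) = 0.
Proof. by apply: io_inj; rewrite rmorph0 imE; apply/Creal_ImP/ioR. Qed.

Lemma reim_inj x y : re x = re y -> im x = im y -> x = y.
Proof. by move=> e1 e2; rewrite (Crect x) (Crect y) -!reE -!imE e1 e2. Qed.

Definition sq (z : C) : R := re z ^+ 2 + im z ^+ 2.

Lemma sqE z : io (sq z) = `|z| ^+ 2.
Proof. by rewrite /sq rmorphD !rmorphXn /= reE imE -normC2_Re_Im. Qed.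

Lemma sq_ge0 z : 0 <= sq z. Proof. by rewrite addr_ge0 ?sqr_ge0. Qed.

Lemma sq_gt0 z : (0 < sq z) = (z != 0).
Proof.
rewrite lt_def sq_ge0 andbT; congr (~~ _).
by rewrite -(inj_eq io_inj) sqE rmorph0 sqrf_eq0 normr_eq0.
Qed.

Section Continuity.
Variable N : nat.
(** Continuity of a complex function, expressed through its two real coordinates. *)
Definition cc (f : 'rV[R]_N -> C) := continuous (fun z => re (f z)) /\ continuous (fun z => im (f z)).

Lemma cc_ext f g : f =1 g -> cc f -> cc g.
Proof. by move=> fg; rewrite (funext fg). Qed.

Lemma cc_cst c : cc (fun=> c).
Proof. by split; exact: cont_cst. Qed.

Lemma ccD f g : cc f -> cc g -> cc (fun z => f z + g z).
Proof.
move=> [f1 f2] [g1 g2]; split.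
  by rewrite (_ : (fun z => _) = fun z => re (f z) + re (g z)); [exact: contD | apply/funext => z; rewrite reD].
by rewrite (_ : (fun z => _) = fun z => im (f z) + im (g z)); [exact: contD | apply/funext => z; rewrite imD].
Qed.

Lemma ccM f g : cc f -> cc g -> cc (fun z => f z * g z).
Proof.
move=> [f1 f2] [g1 g2]; split.
  rewrite (_ : (fun z => _) = fun z => re (f z) * re (g z) - im (f z) * im (g z)); last by apply/funext => z; rewrite reM.
  by apply: contB; exact: contM.
rewrite (_ : (fun z => _) = fun z => re (f z) * im (g z) + im (f z) * re (g z)); last by apply/funext => z; rewrite imM.
by apply: contD; exact: contM.
Qed.

Lemma cc_conj f : cc f -> cc (fun z => (f z)^*).
Proof.
move=> [f1 f2]; split.
  by rewrite (_ : (fun z => _) = fun z => re (f z)) //; apply/funext => z; rewrite re_conj.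
by rewrite (_ : (fun z => _) = fun z => - im (f z)); [exact: contN | apply/funext => z; rewrite im_conj].
Qed.

Lemma cc_sum (I : Type) (r : seq I) (F : I -> 'rV[R]_N -> C) :
  (forall i, cc (F i)) -> cc (fun z => \sum_(i <- r) F i z).
Proof.
move=> cF; elim: r => [|i r IH].
  by apply: (@cc_ext (fun=> 0)); [move=> z; rewrite big_nil | exact: cc_cst].
apply: (@cc_ext (fun z => F i z + \sum_(j <- r) F j z)); last exact: ccD.
by move=> z; rewrite big_cons.
Qed.

Lemma cc_io (f : 'rV[R]_N -> R) : continuous f -> cc (fun z => io (f z)).
Proof.
move=> cf; split.
  by rewrite (_ : (fun z => _) = f) //; apply/funext => z; rewrite re_io.
rewrite (_ : (fun z => _) = (fun=> 0)); [exact: cont_cst | apply/funext => z; exact: im_io].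
Qed.

Lemma cc_closed f : cc f -> closed [set z | f z = 0].
Proof.
move=> [f1 f2]; rewrite (_ : [set z | f z = 0] = [set z | re (f z) = 0] `&` [set z | im (f z) = 0]).
  by apply: closedI; apply: closed_zero.
have r0 : re 0 = 0 by rewrite -(rmorph0 io) re_io.
have i0 : im 0 = 0 by rewrite -(rmorph0 io) im_io.
apply/seteqP; split=> z /= => [->|[e1 e2]]; first by rewrite r0 i0.
by apply: reim_inj; rewrite ?e1 ?e2 ?r0 ?i0.
Qed.

Lemma cc_sq f : cc f -> continuous (fun z => sq (f z)).
Proof. by move=> [f1 f2]; apply: contD; apply: contM. Qed.

Definition ccmx p q (M : 'rV[R]_N -> 'M[C]_(p, q)) := forall i j, cc (fun z => M z i j).

Lemma ccmx_mul p q r (A : 'rV[R]_N -> 'M[C]_(p, q)) (B : 'rV[R]_N -> 'M[C]_(q, r)) :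
  ccmx A -> ccmx B -> ccmx (fun z => A z *m B z).
Proof.
move=> cA cB i j; apply: (@cc_ext (fun z => \sum_k A z i k * B z k j)) => [z|]; first by rewrite mxE.
by apply: cc_sum => k; apply: ccM.
Qed.

Lemma ccmx_adj p q (A : 'rV[R]_N -> 'M[C]_(p, q)) : ccmx A -> ccmx (fun z => adj (A z)).
Proof.
move=> cA i j; apply: (@cc_ext (fun z => (A z j i)^*)) => [z|]; first by rewrite adjE.
exact: cc_conj.
Qed.

Lemma ccmx_cst p q (A : 'M[C]_(p, q)) : ccmx (fun=> A).
Proof. by move=> i j; apply: cc_cst. Qed.

Lemma closed_forall (I : Type) (P : I -> 'rV[R]_N -> Prop) :
  (forall i, closed [set z | P i z]) -> closed [set z | forall i, P i z].
Proof.
move=> cP; rewrite (_ : [set z | _] = \bigcap_(i in setT) [set z | P i z]).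
  by apply: closed_bigI => i _; exact: cP.
by apply/seteqP; split=> z /= h i; [move=> _; apply: h | apply: h].
Qed.

Lemma ccmx_closed p q (A B : 'rV[R]_N -> 'M[C]_(p, q)) : ccmx A -> ccmx B ->
  closed [set z | A z = B z].
Proof.
move=> cA cB; rewrite (_ : [set z | _] = [set z | forall i j, A z i j - B z i j = 0]).
  apply: closed_forall => i; apply: closed_forall => j; apply: cc_closed.
  apply: (@cc_ext (fun z => A z i j + (-1) * B z i j)) => [z|]; first by rewrite mulN1r.
  by apply: ccD => //; apply: ccM => //; apply: cc_cst.
apply/seteqP; split=> z /= => [-> i j|h]; first by rewrite subrr.
by apply/matrixP => i j; apply/eqP; rewrite -subr_eq0 h.
Qed.

Lemma ccmx_mu n (mu : 'cV[C]_n -> 'cV[C]_n -> 'cV[C]_n) (u v : 'rV[R]_N -> 'cV[C]_n) : symbil mu ->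
  ccmx u -> ccmx v -> ccmx (fun z => mu (u z) (v z)).
Proof.
move=> sm cu cv l j; apply: (@cc_ext (fun z => \sum_p \sum_q u z p 0 * v z q 0 * mu (delta_mx p 0) (delta_mx q 0) l j)).
  move=> z; rewrite [in RHS](cV_sum_delta (u z)) [in RHS](cV_sum_delta (v z)) (mu_suml sm) summxE.
  apply: eq_bigr => p _; rewrite (muZl sm) (mu_sumr sm) mxE summxE mulr_sumr.
  by apply: eq_bigr => q _; rewrite (muZr sm) mxE mulrA.
by apply: cc_sum => p; apply: cc_sum => q; apply: ccM; [apply: ccM | apply: cc_cst].
Qed.

End Continuity.
End ComplexParts.

(** * The norm as a function of a frame and real exponents *)

Section UnitaryMin.
Variables (R : realType) (C : numClosedFieldType) (io : {rmorphism R -> C}).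
Hypothesis io_real : forall z : C, z \is Num.real -> exists r, z = io r.
Hypothesis io_ge0 : forall r, (0 <= io r) = (0 <= r).
Variables (n m : nat) (mu : 'cV[C]_n -> 'cV[C]_n -> 'cV[C]_n).
Hypothesis mus : symbil mu.
Variable T : 'I_m -> 'M[C]_n.
Notation e_ i := (delta_mx i 0 : 'cV[C]_n).
Local Notation sq := (sq io_real).

(* Pairs of an orthonormal basis diagonalizing the [T k] and a traceless real
   diagonal matrix in that basis, orthogonal to them. *)
Definition feasible (U : 'M[C]_n) (b : 'rV[R]_n) :=
  [/\ adj U *m U = 1%:M,
      forall k i j, i != j -> (adj U *m T k *m U) i j = 0,
      \sum_i b 0 i = 0
    & forall k, \sum_i io (b 0 i) * (adj U *m T k *m U) i i = 0].

(** The structure constants of [mu] in the orthonormal basis of columns of [U]; a triple [l] holds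
    two input indices and the output index. *)
Definition sc (U : 'M[C]_n) (l : 'I_n * 'I_n * 'I_n) : C :=
  (adj U *m mu (U *m e_ l.1.1) (U *m e_ l.1.2)) l.2 0.

Definition wt (b : 'rV[R]_n) (l : 'I_n * 'I_n * 'I_n) : R := b 0 l.2 - b 0 l.1.1 - b 0 l.1.2.

(** The squared norm of [exp(b) U^* mu], as [ip_F] shows; the 2 comes from squaring. *)
Definition Fub (U : 'M[C]_n) (b : 'rV[R]_n) : R := \sum_l expR (2 * wt b l) * sq (sc U l).

Lemma F_min : feasible 1%:M 0 ->
  (forall U b, feasible U b -> b != 0 -> exists l, sc U l != 0 /\ 0 < wt b l) ->
  exists U0 b0, feasible U0 b0 /\ forall U b, feasible U b -> Fub U0 b0 <= Fub U b.
Proof.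
move=> feas1 noray.
(* A complex matrix becomes a real row vector of its real and imaginary parts, of length [2 n^2]. *)
pose d := (n * n + n * n)%N.
pose Ux (x : 'rV[R]_d) : 'M[C]_n :=
  \matrix_(i, j) (io (x 0 (lshift _ (mxvec_index i j))) + 'i * io (x 0 (rshift _ (mxvec_index i j)))).
pose xU (U : 'M[C]_n) : 'rV[R]_d := row_mx (mxvec (map_mx (re io_real) U)) (mxvec (map_mx (im io_real) U)).
have xUK U : Ux (xU U) = U.
  apply/matrixP => i j; rewrite mxE row_mxEl row_mxEr !mxvecE !mxE reE imE.
  by rewrite -Crect.
pose Uz (z : 'rV[R]_(d + n)) := Ux (lsubmx z).
have cUz : ccmx io_real Uz.
  move=> i j.
  apply: (@cc_ext _ _ _ io_real _ (fun z : 'rV[R]_(d + n) => io (z 0 (lshift n (lshift _ (mxvec_index i j)))) +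
     'i * io (z 0 (lshift n (rshift _ (mxvec_index i j)))))).
    by move=> z; rewrite !mxE.
  by apply: ccD; [|apply: ccM; [apply: cc_cst|]]; apply: cc_io => //; apply: cont_coord.
pose c (l : 'I_n * 'I_n * 'I_n) (i : 'I_n) : R := 2 * ((i == l.2)%:R - (i == l.1.1)%:R - (i == l.1.2)%:R).
have delta_sum (b : 'rV[R]_n) k : \sum_i (i == k)%:R * b 0 i = b 0 k.
  rewrite (bigD1 k) //= eqxx mul1r big1 ?addr0 // => i /negbTE ->.
  by rewrite mul0r.
have wtE (b : 'rV[R]_n) l : \sum_i c l i * b 0 i = 2 * wt b l.
  rewrite /wt -!(delta_sum b) -!sumrB mulr_sumr; apply: eq_bigr => i _.
  by rewrite /c; ring.
have cU l : cc io_real (fun z => sc (Uz z) l).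
  have cc_e : ccmx io_real (fun z : 'rV[R]_(d + n) => Uz z *m e_ l.1.1) by apply: ccmx_mul => //; apply: ccmx_cst.
  have cc_e' : ccmx io_real (fun z : 'rV[R]_(d + n) => Uz z *m e_ l.1.2) by apply: ccmx_mul => //; apply: ccmx_cst.
  have := ccmx_mul (ccmx_adj cUz) (ccmx_mu mus cc_e cc_e').
  by apply.
have cT k : ccmx io_real (fun z => adj (Uz z) *m T k *m Uz z).
  by apply: ccmx_mul => //; apply: ccmx_mul; [apply: ccmx_adj | apply: ccmx_cst].
have cb i : continuous (fun z : 'rV[R]_(d + n) => rsubmx z 0 i).
  have -> : (fun z : 'rV[R]_(d + n) => rsubmx z 0 i) = (fun z => z 0 (rshift d i)).
    by apply/funext => z; rewrite mxE.
  exact: cont_coord.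
pose K : set 'rV[R]_(d + n) := [set z | feasible (Uz z) (rsubmx z)].
have clK : closed K.
  rewrite (_ : K = [set z | adj (Uz z) *m Uz z = 1%:M] `&` ([set z | forall k i j, i != j -> (adj (Uz z) *m T k *m Uz z) i j = 0] `&`
      ([set z | \sum_i rsubmx z 0 i = 0] `&` [set z | forall k, \sum_i io (rsubmx z 0 i) * (adj (Uz z) *m T k *m Uz z) i i = 0]))); last first.
    by apply/seteqP; split=> z; [case=> h1 h2 h3 h4 | case=> h1 [h2 [h3 h4]]; split].
  apply: closedI.
    by apply: (@ccmx_closed _ _ _ io_real) => //; [apply: ccmx_mul => //; apply: ccmx_adj | apply: ccmx_cst].
  apply: closedI.
    apply: closed_forall => k; apply: closed_forall => i; apply: closed_forall => j.
    case: (eqVneq i j) => [->|ij].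
      rewrite (_ : [set z | _] = setT); first exact: closedT.
      by apply/seteqP; split.
    rewrite (_ : [set z | _] = [set z | (adj (Uz z) *m T k *m Uz z) i j = 0]); first by apply: (@cc_closed _ _ io io_real) => //; apply: cT.
    by apply/seteqP; split=> z /=; [apply | move=> ->].
  apply: closedI; first by apply: closed_zero; apply: cont_sum.
  apply: closed_forall => k; apply: (@cc_closed _ _ io io_real) => //; apply: cc_sum => i; apply: ccM => //.
    exact: cc_io.
  exact: cT.
have := @coercive_min R d n _ (fun l z => sq (sc (Uz z) l)) c K 1.
case=> //.
- by move=> l; apply: cc_sq.
- by move=> l z; apply: (sq_ge0 io_real).
- by move=> l x b b'; rewrite /Uz !row_mxKl.
- exists (row_mx (xU 1%:M) 0); rewrite /K /= /Uz row_mxKl row_mxKr xUK //.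
- move=> z [UU _ _ _].
  (* The columns of a unitary matrix have norm one, which bounds all the coordinates by 1. *)
  have en i j : sq (Uz z i j) <= 1.
    rewrite -[leRHS](_ : \sum_l sq (Uz z l j) = 1).
      by rewrite (bigD1 i) //= lerDl sumr_ge0 // => l _; apply: (sq_ge0 io_real).
    apply: (io_inj (io := io)); rewrite rmorph_sum rmorph1 /=.
    have /matrixP/(_ j j) := UU; rewrite !mxE eqxx mulr1n => <-.
    by apply: eq_bigr => l _; rewrite sqE adjE normCK mulrC.
  have le1 (x y : R) : x ^+ 2 + y ^+ 2 <= 1 -> `|x| <= 1.
    move=> h; rewrite -(ler_pXn2r (n := 2)) ?nnegrE ?normr_ge0 // expr1n real_normK ?num_real //.
    by apply: le_trans h; rewrite lerDl sqr_ge0.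
  move=> i; have xz : xU (Uz z) = lsubmx z.
    apply/rowP => k; case: (split_ordP k) => k' ->; rewrite ?row_mxEl ?row_mxEr;
      case/mxvec_indexP: k' => p q; rewrite mxvecE mxE; apply: (io_inj (io := io)); rewrite ?reE ?imE.
      by rewrite mxE Re_rect ?(ioR io_ge0).
    by rewrite mxE Im_rect ?(ioR io_ge0).
  rewrite -xz; case: (split_ordP i) => k ->; rewrite ?row_mxEl ?row_mxEr;
    case/mxvec_indexP: k => p q; rewrite mxvecE mxE; have := en p q; first exact: le1.
  by rewrite /sq addrC; apply: le1.
- move=> x b s Kxb s0; have [h1 h2 h3 h4] : feasible (Ux x) b.
    by move: Kxb; rewrite /K /= /Uz row_mxKl row_mxKr.
  rewrite /K /= /Uz row_mxKl row_mxKr.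
  split=> // [|k].
    transitivity (s * \sum_i b 0 i); last by rewrite h3 mulr0.
    by rewrite mulr_sumr; apply: eq_bigr => i _; rewrite mxE.
  transitivity (io s * \sum_i io (b 0 i) * (adj (Ux x) *m T k *m Ux x) i i); last by rewrite h4 mulr0.
  by rewrite mulr_sumr; apply: eq_bigr => i _; rewrite mxE rmorphM mulrA.
- move=> x b Kxb bn; have [l [sl wl]] : exists l, sc (Ux x) l != 0 /\ 0 < wt b l.
    by apply: noray bn; move: Kxb; rewrite /K /= /Uz row_mxKl row_mxKr.
  by exists l; rewrite wtE /Uz row_mxKl (sq_gt0 io_real) // sl; split=> //; rewrite mulr_gt0.
move=> z Kz zmin; exists (Uz z), (rsubmx z); split=> // U b fUb.
have := zmin (row_mx (xU U) b); rewrite /K /= /Uz row_mxKl row_mxKr xUK => /(_ fUb).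
rewrite /Fub; under eq_bigr do rewrite wtE; under [X in _ <= X]eq_bigr do rewrite wtE.
by [].
Qed.

End UnitaryMin.

(** * Balanced algebras in an orbit *)

Section GroupAction.
Variables (C : numClosedFieldType) (n : nat).
Implicit Types (mu : 'cV[C]_n -> 'cV[C]_n -> 'cV[C]_n) (g : 'M[C]_n).
Notation e_ i := (delta_mx i 0 : 'cV[C]_n).

Lemma gactM g g' mu : g \in unitmx -> g' \in unitmx -> gact g (gact g' mu) = gact (g *m g') mu.
Proof.
move=> ug ug'; apply/funext => a; apply/funext => b.
have invM : invmx (g *m g') = invmx g' *m invmx g.
  apply: (can_inj (mulKmx (_ : g *m g' \in unitmx))); first by rewrite unitmx_mul ug ug'.
  by rewrite mulmxV ?unitmx_mul ?ug ?ug' // mulmxA -(mulmxA g) mulmxV // mulmx1 mulmxV.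
by rewrite /gact invM !mulmxA.
Qed.

Lemma gact1 mu : gact 1%:M mu = mu.
Proof. by apply/funext => a; apply/funext => b; rewrite /gact invmx1 !mul1mx. Qed.

Lemma derivation_gact g mu D : g \in unitmx -> derivation mu D ->
  derivation (gact g mu) (g *m D *m invmx g).
Proof.
move=> ug dD a b; rewrite /gact -!mulmxA (mulmxA (invmx g) g) mulVmx // mul1mx dD mulmxDr.
by rewrite !(mulmxA (invmx g) g) mulVmx // !mul1mx.
Qed.

Lemma derivation_dg mu (t : 'I_n -> C) i j k : symbil mu -> derivation mu (dg t) ->
  mu (e_ i) (e_ j) k 0 != 0 -> t k = t i + t j.
Proof.
move=> sm dt; have /colP/(_ k) := dt (e_ i) (e_ j).
rewrite dg_mulE !dg_mul_delta (muZl sm) (muZr sm) !mxE -mulrDl => + nz.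
by move/(mulIf nz).
Qed.

Lemma lact_comm (A B : 'M[C]_n) mu a b : symbil mu ->
  lact (A *m B - B *m A) mu a b = lact A (lact B mu) a b - lact B (lact A mu) a b.
Proof.
move=> sm; rewrite {1}/lact [lact A _ _ _]/lact [lact B (lact _ _) _ _]/lact /lact.
rewrite !mulmxBl !(muBl sm) !(muBr sm) !mulmxBr -!mulmxA.
move: (A *m (B *m mu a b)) (B *m (A *m mu a b)) (A *m mu (B *m a) b) (A *m mu a (B *m b))
  (B *m mu (A *m a) b) (B *m mu a (A *m b)) => p1 p2 p3 p4 p5 p6.
move: (mu (A *m (B *m a)) b) (mu (B *m (A *m a)) b) (mu a (A *m (B *m b))) (mu a (B *m (A *m b)))
  (mu (A *m a) (B *m b)) (mu (B *m a) (A *m b)) => q1 q2 q3 q4 q5 q6.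
by apply/colP => i; rewrite !mxE; ring.
Qed.

Lemma lact_eq0 (B : 'M[C]_n) mu : (forall a b, mu a b = 0) -> forall a b, lact B mu a b = 0.
Proof. by move=> m0 a b; rewrite /lact !m0 mulmx0 !subr0. Qed.

(** A Hermitian derivation kills [mu] and is its own adjoint for [ip]. So the trace of
    [(M D - D M) B] is [ip (lact D (lact B mu)) mu], which equals
    [ip (lact B mu) (lact D mu) = 0]. *)
Lemma Mm_derivation mu D : symbil mu -> derivation mu D -> adj D = D ->
  Mm mu *m D = D *m Mm mu /\ \tr (Mm mu *m D) = 0.
Proof.
move=> sm dD aD; have l0 (nu : 'cV[C]_n -> 'cV[C]_n -> 'cV[C]_n) : ip nu (lact D mu) = 0.
  rewrite ipC (@ip_ext _ _ (lact D mu) (fun a b => 0 *: mu a b) nu nu) // ?ipZl ?mul0r ?rmorph0 // => a b.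
  by rewrite /lact dD addrAC addrK subrr scale0r.
split; last by rewrite Mm_tr // ipC l0 rmorph0.
apply/eqP; rewrite -subr_eq0; apply/eqP/tr_eq0 => B.
have -> : \tr ((Mm mu *m D - D *m Mm mu) *m B) = \tr (Mm mu *m (D *m B - B *m D)).
  rewrite mulmxBl mulmxBr !raddfB /= -!mulmxA; congr (_ - _).
  by rewrite mxtrace_mulC mulmxA.
have lD0 a b : lact D mu a b = 0 by rewrite /lact dD addrAC addrK subrr.
rewrite Mm_tr // (@ip_ext _ _ _ (lact D (lact B mu)) mu mu) // => [|a b].
  by rewrite ip_lact_adj ?aD // ?l0 //; exact: lact_symbil.
by rewrite lact_comm // (lact_eq0 B lD0) subr0.
Qed.

Lemma gram_unit g (U : 'M[C]_n) : g \in unitmx -> adj U *m U = 1%:M -> forall i, 0 < (adj (g *m U) *m (g *m U)) i i.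
Proof.
move=> ug UU i; have -> : (adj (g *m U) *m (g *m U)) i i = dotv (g *m U *m e_ i) (g *m U *m e_ i).
  by rewrite dotv_mx -!colE !mxE; apply: eq_bigr => k _; rewrite !adjE !mxE.
rewrite lt_def dotvv_ge0 andbT; apply/eqP => /dotvv_eq0 /(congr1 (mulmx (adj U *m invmx g))).
rewrite mulmx0 -!mulmxA (mulmxA (invmx g)) mulVmx // mul1mx mulmxA UU mul1mx.
by move/colP/(_ i)/eqP; rewrite !mxE !eqxx oner_eq0.
Qed.

Lemma dg_comm (a b : 'I_n -> C) : dg a *m dg b = dg b *m dg a.
Proof. by apply/matrixP => i j; rewrite !dg_mulE !mxE; case: eqP => [->|]; rewrite ?mulr0n ?mulr0 // mulrC. Qed.

Lemma dg_mul (a b : 'I_n -> C) : dg a *m dg b = dg (fun i => a i * b i).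
Proof. by apply/matrixP => i j; rewrite dg_mulE !mxE mulrnAr. Qed.

Lemma adj_dg (a : 'I_n -> C) : adj (dg a) = dg (fun i => (a i)^*).
Proof.
by apply/matrixP => i j; rewrite adjE !mxE eq_sym rmorphMn /=; case: eqP => [->|].
Qed.

Lemma det_dg (a : 'I_n -> C) : \det (dg a) = \prod_i a i.
Proof.
have -> : dg a = diag_mx (\row_i a i) by apply/matrixP => i j; rewrite !mxE.
by rewrite det_diag; apply: eq_bigr => i _; rewrite mxE.
Qed.

Lemma gact_unitaryE (U : 'M[C]_n) mu i j : adj U *m U = 1%:M ->
  gact (adj U) mu (e_ i) (e_ j) = adj U *m mu (U *m e_ i) (U *m e_ j).
Proof. by move=> UU; rewrite /gact unitary_inv adjK // (mulmx1C UU). Qed.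

Lemma unitary_unit (U : 'M[C]_n) : adj U *m U = 1%:M -> U \in unitmx /\ adj U \in unitmx.
Proof. by move=> UU; have [? ?] := mulmx1_unit UU. Qed.

Lemma unitary_conjM (U A B : 'M[C]_n) : adj U *m U = 1%:M ->
  (U *m A *m adj U) *m (U *m B *m adj U) = U *m (A *m B) *m adj U.
Proof. by move=> UU; rewrite -!mulmxA (mulmxA (adj U) U) UU mul1mx. Qed.

Lemma det_unitary_conj (U A : 'M[C]_n) : adj U *m U = 1%:M -> \det (U *m A *m adj U) = \det A.
Proof.
move=> UU; rewrite !det_mulmx mulrC mulrA -det_mulmx UU det1 mul1r //.
Qed.

End GroupAction.

Section ExpDiag.
Variables (R : realType) (C : numClosedFieldType) (io : {rmorphism R -> C}).
Hypothesis io_real : forall z : C, z \is Num.real -> exists r, z = io r.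
Hypothesis io_ge0 : forall r, (0 <= io r) = (0 <= r).
Variables (n : nat).
Notation e_ i := (delta_mx i 0 : 'cV[C]_n).
Implicit Types (b : 'I_n -> R).

Definition Ed b : 'M[C]_n := dg (fun i => io (expR (b i))).

Lemma EdN b : Ed (fun i => - b i) *m Ed b = 1%:M.
Proof.
rewrite dg_mul; apply/matrixP => i j; rewrite !mxE; congr (_ *+ _).
by rewrite -rmorphM -expRD addNr expR0 rmorph1.
Qed.

Lemma Ed_unit b : Ed b \in unitmx.
Proof. by have [] := mulmx1_unit (EdN b). Qed.

Lemma Ed_inv b : invmx (Ed b) = Ed (fun i => - b i).
Proof. by rewrite -[RHS]mulmx1 -(mulmxV (Ed_unit b)) mulmxA EdN mul1mx. Qed.

Lemma adj_Ed b : adj (Ed b) = Ed b.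
Proof.
rewrite adj_dg; congr dg; apply/funext => i; apply: conj_Creal; exact: ioR.
Qed.

Lemma det_Ed b : \det (Ed b) = io (expR (\sum_i b i)).
Proof. by rewrite det_dg -rmorph_prod expR_sum. Qed.

Lemma ip_Ed b mu : symbil mu -> ip (gact (Ed b) mu) (gact (Ed b) mu) =
  \sum_i \sum_j \sum_k io (expR (2 * (b k - b i - b j))) * `|mu (e_ i) (e_ j) k 0| ^+ 2.
Proof.
move=> sm; apply: eq_bigr => i _; apply: eq_bigr => j _; apply: eq_bigr => k _.
have -> : gact (Ed b) mu (e_ i) (e_ j) k 0 = io (expR (b k - b i - b j)) * mu (e_ i) (e_ j) k 0.
  rewrite /gact dg_mulE Ed_inv !dg_mul_delta (muZl sm) (muZr sm) !mxE.
  by rewrite !expRD !rmorphM /=; ring.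
rewrite -normCK normrM exprMn; congr (_ * _).
rewrite ger0_norm ?io_ge0 ?expR_ge0 // -rmorphXn /=; congr (io _).
by rewrite expr2 -expRD; congr expR; ring.
Qed.

End ExpDiag.

(** * A constrained minimizer is balanced *)

Section Minimizer.
Variables (R : realType) (C : numClosedFieldType) (io : {rmorphism R -> C}).
Hypothesis io_real : forall z : C, z \is Num.real -> exists r, z = io r.
Hypothesis io_ge0 : forall r, (0 <= io r) = (0 <= r).
Variables (n m : nat) (n_gt0 : (0 < n)%N) (mu : 'cV[C]_n -> 'cV[C]_n -> 'cV[C]_n).
Hypothesis mus : symbil mu.
Variable T : 'I_m -> 'M[C]_n.
Hypotheses (Th : forall k, adj (T k) = T k) (Tc : forall k l, T k *m T l = T l *m T k).
Hypotheses (Td : forall k, derivation mu (T k)) (Ttr : forall k, \tr (T k) = 0).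
Notation e_ i := (delta_mx i 0 : 'cV[C]_n).
Local Notation sq := (sq io_real).
Local Notation sc := (sc mu).
Local Notation F := (Fub io_real mu).

Definition Tdiag (U : 'M[C]_n) := forall k i j, i != j -> (adj U *m T k *m U) i j = 0.

Definition tw (U : 'M[C]_n) k : 'I_n -> R := fun i => re io_real ((adj U *m T k *m U) i i).

Lemma twE U k i : io (tw U k i) = (adj U *m T k *m U) i i.
Proof.
rewrite reE; apply/Creal_ReP/CrealP.
by rewrite -adjE !adjM adjK Th mulmxA.
Qed.

Lemma TdiagE U k : Tdiag U -> adj U *m T k *m U = dg (fun i => io (tw U k i)).
Proof.
move=> dU; apply/matrixP => i j; rewrite [RHS]mxE.
case: (eqVneq i j) => [<-|ij]; last by rewrite dU.
by rewrite mulr1n twE.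
Qed.

Lemma wt_tw U k l : adj U *m U = 1%:M -> Tdiag U -> sc U l != 0 ->
  tw U k l.2 = tw U k l.1.1 + tw U k l.1.2.
Proof.
move=> UU dU nz; apply: (io_inj (io := io)); rewrite rmorphD.
have [uU uaU] := unitary_unit UU.
have := derivation_gact uaU (Td k); rewrite unitary_inv ?adjK ?(mulmx1C UU) // TdiagE // => dt.
apply: (derivation_dg (gact_symbil _ mus) dt).
by rewrite gact_unitaryE.
Qed.

Lemma tw_sum U k : adj U *m U = 1%:M -> \sum_i tw U k i = 0.
Proof.
move=> UU; apply: (io_inj (io := io)); rewrite rmorph_sum rmorph0 /=.
under eq_bigr do rewrite twE.
by rewrite -/(mxtrace _) mxtrace_mulC mulmxA (mulmx1C UU) mul1mx Ttr.
Qed.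

Lemma ip_F U (b : 'rV[R]_n) : adj U *m U = 1%:M ->
  io (F U b) = ip (gact (Ed io (fun i => b 0 i) *m adj U) mu) (gact (Ed io (fun i => b 0 i) *m adj U) mu).
Proof.
move=> UU; have [uU uaU] := unitary_unit UU.
rewrite -gactM ?Ed_unit // (ip_Ed io_ge0 _ (gact_symbil _ mus)) rmorph_sum pair_big pair_big /=.
apply: eq_bigr => -[[i j] k] _; rewrite rmorphM /= sqE; congr (_ * _ ^+ 2).
by rewrite gact_unitaryE.
Qed.

(** The normal equations [s S S^T = b S^T] are solvable: over the reals [S S^T w = 0] forces
    [S^T w = 0]. *)
Lemma real_proj (S : 'M[R]_(m, n)) (b : 'rV[R]_n) : exists s : 'rV[R]_m, (b - s *m S) *m S^T = 0.
Proof.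
have /submxP[s e] : (b *m S^T <= S *m S^T)%MS.
  rewrite submxE; set w := cokermx _.
  have Sw : S^T *m w = 0.
    apply/matrixP => i j; rewrite [RHS]mxE.
    have : \sum_l (S^T *m w) l j ^+ 2 = 0.
      have e : (S^T *m w)^T *m (S^T *m w) = w^T *m (S *m S^T *m w) by rewrite trmx_mul trmxK !mulmxA.
      have : ((S^T *m w)^T *m (S^T *m w)) j j = 0 by rewrite e mulmx_coker mulmx0 mxE.
      rewrite mxE => h; rewrite -[RHS]h.
      by apply: eq_bigr => l _; rewrite [X in _ = X * _]mxE expr2.
    move/eqP; rewrite psumr_eq0 => [/allP/(_ i (mem_index_enum _))|l _]; last exact: sqr_ge0.
    by rewrite /= sqrf_eq0 => /eqP.
  by rewrite -mulmxA Sw mulmx0.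
by exists s; rewrite mulmxBl e mulmxA subrr.
Qed.

Variables (U0 : 'M[C]_n) (b0 : 'rV[R]_n).
Hypothesis feas0 : feasible io T U0 b0.
Hypothesis Fmin : forall U b, feasible io T U b -> F U0 b0 <= F U b.

(** The orthogonality constraint on [b] can be lifted: as the [T k] are derivations, subtracting a
    combination of their weights from [b] changes no exponent whose structure constant is
    nonzero. *)
Lemma F_min_ext U (b : 'rV[R]_n) : adj U *m U = 1%:M -> Tdiag U -> \sum_i b 0 i = 0 -> F U0 b0 <= F U b.
Proof.
move=> UU dU bs; pose S : 'M[R]_(m, n) := \matrix_(k, i) tw U k i.
have [s sP] := real_proj S b.
have -> : F U b = F U (b - s *m S).
  apply: eq_bigr => l _; case: (eqVneq (sc U l) 0) => [->|nz].
    by rewrite /sq -(rmorph0 io) re_io // im_io // expr0n addr0 !mulr0.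
  congr (expR (2 * _) * _).
  have w0 : wt (s *m S) l = 0.
    rewrite /wt !mxE -!sumrB big1 // => k _; rewrite !mxE (wt_tw k UU dU nz); ring.
  by rewrite -[LHS]subr0 -w0 /wt; rewrite !mxE; ring.
apply: Fmin; split=> // [|k].
  rewrite (eq_bigr (fun i => b 0 i - (s *m S) 0 i)) => [|i _]; last by rewrite !mxE.
  rewrite sumrB bs sub0r; apply/eqP; rewrite oppr_eq0; apply/eqP.
  under eq_bigr do rewrite mxE; rewrite exchange_big big1 // => k _.
  by rewrite -mulr_sumr; under eq_bigr do rewrite mxE; rewrite tw_sum // mulr0.
have /matrixP/(_ 0 k) := sP; rewrite !mxE => /(congr1 io); rewrite rmorph_sum rmorph0 => h; rewrite -[RHS]h.
apply: eq_bigr => i _; rewrite rmorphM TdiagE //; congr (_ * _).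
by rewrite !mxE eqxx mulr1n.
Qed.

Lemma minimizer_balanced : balanced (gact (Ed io (fun i => b0 0 i) *m adj U0) mu).
Proof.
have [UU0 dU0 bs0 _] := feas0; have [uU0 uaU0] := unitary_unit UU0.
set E0 := Ed io _; have uE0 : E0 \in unitmx := Ed_unit _ _.
rewrite -gactM //; set nu0 := gact (adj U0) mu; set nu1 := gact E0 nu0.
have s0 : symbil nu0 := gact_symbil _ mus; have s1 : symbil nu1 := gact_symbil _ s0.
pose T' k := adj U0 *m T k *m U0.
have T'E k : T' k = dg (fun i => io (tw U0 k i)) := TdiagE k dU0.
have T'h k : adj (T' k) = T' k by rewrite /T' !adjM adjK Th mulmxA.
have dT'0 k : derivation nu0 (T' k).
  by have := derivation_gact uaU0 (Td k); rewrite unitary_inv ?adjK ?(mulmx1C UU0).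
have dT'1 k : derivation nu1 (T' k).
  have := derivation_gact uE0 (dT'0 k); rewrite T'E /E0 /Ed dg_comm mulmxK //.
have [uZ Zh] := (Mm0_trace nu1 n_gt0, Mm0_herm s1).
set Z := Mm0 nu1 in uZ Zh.
have ZT' k : Z *m T' k = T' k *m Z.
  rewrite /Z /Mm0 mulmxBl mulmxBr (Mm_derivation s1 (dT'1 k) (T'h k)).1.
  by rewrite mul_scalar_mx mul_mx_scalar.
have T'c k l : T' k *m T' l = T' l *m T' k by rewrite !T'E dg_comm.
pose As := Z :: [seq T' k | k <- enum 'I_m].
have [||V VV VA] := @herm_codiag _ _ As.
- by move=> A; rewrite inE => /orP[/eqP ->|/mapP[k _ ->]].
- move=> A B; rewrite !inE => /orP[/eqP ->|/mapP[k _ ->]] /orP[/eqP ->|/mapP[l _ ->]] //.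
have VV' := mulmx1C VV; have [uV uaV] := unitary_unit VV.
(* The eigenvalues of the traceless part [Z] of the moment matrix. The variation is by [exp(s Z)],
   and [V] diagonalizes [Z] together with the torus. *)
pose al i : R := re io_real ((adj V *m Z *m V) i i).
have VZ : adj V *m Z *m V = dg (fun i => io (al i)).
  rewrite VA ?mem_head //; congr dg; apply/funext => i; rewrite reE; apply/esym/Creal_ReP/CrealP.
  by rewrite -adjE !adjM adjK Zh mulmxA.
have VT k : adj V *m T' k *m V = dg (fun i => (adj V *m T' k *m V) i i).
  by apply: VA; rewrite inE map_f ?orbT // mem_enum.
have al0 : \sum_i al i = 0.
  apply: (io_inj (io := io)); rewrite rmorph_sum rmorph0 -(dg_tr (fun i => io (al i))) -VZ.
  by rewrite mxtrace_mulC mulmxA VV' mul1mx.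
pose nu2 := gact (adj V) nu1; have s2 : symbil nu2 := gact_symbil _ s1.
pose al' (s : R) i := s * al i.
(* Some unitary diagonalizes both the [T k] and [g^* g]; in that frame [g mu] has the
   norm of a competitor of [(U0, b0)]. *)
have main s : F U0 b0 <= re io_real (ip (gact (Ed io (al' s)) nu2) (gact (Ed io (al' s)) nu2)).
  pose g := Ed io (al' s) *m adj V *m E0 *m adj U0.
  have ug : g \in unitmx by rewrite !unitmx_mul Ed_unit uaV uE0 uaU0.
  have gE : gact (Ed io (al' s)) nu2 = gact g mu.
    by rewrite /nu2 /nu1 /nu0 !gactM ?unitmx_mul ?Ed_unit ?uaV ?uE0 ?uaU0 // /g !mulmxA.
  pose H := adj g *m g.
  have HE : H = U0 *m (E0 *m (V *m (Ed io (al' s) *m Ed io (al' s)) *m adj V) *m E0) *m adj U0.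
    by rewrite /H /g !adjM !adjK (adj_Ed io_ge0) [adj E0](adj_Ed io_ge0) !mulmxA.
  have UU0' := mulmx1C UU0.
  have TE k : T k = U0 *m T' k *m adj U0.
    by rewrite /T' !mulmxA UU0' mul1mx -mulmxA UU0' mulmx1.
  have HT k : H *m T k = T k *m H.
    have c1 : E0 *m T' k = T' k *m E0 by rewrite T'E dg_comm.
    have [t T'V] : exists t, T' k = V *m dg t *m adj V.
      by exists (fun i => (adj V *m T' k *m V) i i); rewrite -VT !mulmxA VV' mul1mx -mulmxA VV' mulmx1.
    have := HE; set X := V *m _ *m adj V => HE'.
    have c2 : X *m T' k = T' k *m X by rewrite /X T'V dg_mul !unitary_conjM // dg_comm.
    have c3 : (E0 *m X *m E0) *m T' k = T' k *m (E0 *m X *m E0).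
      move: (T' k) (X) c1 c2 => Y W c1 c2.
      by rewrite -(mulmxA (E0 *m W) E0) c1 mulmxA -(mulmxA E0 W) c2 !mulmxA c1.
    by rewrite HE' TE !unitary_conjM // c3.
  have [||U UU UA] := @herm_codiag _ _ (H :: [seq T k | k <- enum 'I_m]).
  - by move=> A; rewrite inE => /orP[/eqP ->|/mapP[k _ ->]] //; rewrite /H adjM adjK.
  - by move=> A B; rewrite !inE => /orP[/eqP ->|/mapP[k _ ->]] /orP[/eqP ->|/mapP[l _ ->]].
  have dU : Tdiag U.
    move=> k i j ij; rewrite UA ?mxE ?(negPf ij) // inE map_f ?orbT // mem_enum //.
  have HU : adj U *m H *m U = adj (g *m U) *m (g *m U) by rewrite /H adjM !mulmxA.
  have hpos i : 0 < (adj U *m H *m U) i i by rewrite HU; apply: gram_unit.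
  pose r i : R := re io_real ((adj U *m H *m U) i i).
  have rE i : io (r i) = (adj U *m H *m U) i i.
    by rewrite reE; apply/Creal_ReP; apply: gtr0_real.
  have r0 i : 0 < r i.
    have := hpos i; rewrite -rE lt_def io_ge0 => /andP[ne ge]; rewrite lt_def ge andbT.
    by apply: contra_neq ne => ->; rewrite rmorph0.
  (* Chosen so that [exp(b)^2 = U^* H U]: then [exp(b) U^*] and [g] differ by a unitary left factor,
     the matrix [k] below. *)
  pose b : 'rV[R]_n := \row_i (ln (r i) / 2).
  have E2 : Ed io (fun i => b 0 i) *m Ed io (fun i => b 0 i) = adj U *m H *m U.
    rewrite UA ?mem_head // dg_mul; congr dg; apply/funext => i.
    by rewrite -rE -rmorphM -expRD; congr (io _); rewrite mxE -splitr lnK ?posrE.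
  have bsum : \sum_i b 0 i = 0.
    have dE0 : \det E0 = 1 by rewrite det_Ed bs0 expR0 rmorph1.
    have dEs : \det (Ed io (al' s)) = 1 by rewrite det_Ed -mulr_sumr al0 mulr0 expR0 rmorph1.
    have dH : \det H = 1.
      rewrite HE det_unitary_conj // !det_mulmx dE0 dEs !mul1r !mulr1 -det_mulmx VV' det1 //.
    have := congr1 determinant E2; rewrite -{2}(adjK U) det_unitary_conj; last by rewrite adjK; exact: mulmx1C.
    rewrite dH det_mulmx det_Ed -rmorphM -expRD -(rmorph1 io) => /(io_inj (io := io)).
    by rewrite -expR0 => /expR_inj /eqP; rewrite -mulr2n mulrn_eq0 /= => /eqP.
  have FE : F U b = re io_real (ip (gact (Ed io (al' s)) nu2) (gact (Ed io (al' s)) nu2)).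
    apply: (io_inj (io := io)); rewrite ip_F // reE gE.
    have -> : 'Re (ip (gact g mu) (gact g mu)) = ip (gact g mu) (gact g mu).
      by apply/Creal_ReP; apply: ger0_real; apply: ip_ge0.
    set Eb := Ed io _ in E2 *.
    pose k := g *m U *m invmx Eb.
    have uEb : Eb \in unitmx := Ed_unit _ _.
    have [uU uaU] := unitary_unit UU.
    have aiE : adj (invmx Eb) = invmx Eb by rewrite Ed_inv adj_Ed.
    have KK : adj k *m k = 1%:M.
      have -> : adj k *m k = invmx Eb *m (adj U *m H *m U) *m invmx Eb.
        by rewrite /k /H 2!adjM aiE !mulmxA.
      by rewrite -E2 mulmxA mulVmx // mul1mx mulmxV.
    have -> : gact g mu = gact k (gact (Eb *m adj U) mu).
      rewrite gactM; [|exact: (unitary_unit KK).1|by rewrite unitmx_mul uEb uaU].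
      congr gact; apply/esym; rewrite /k [LHS]mulmxA -[X in X *m _]mulmxA mulVmx // mulmx1.
      by rewrite -[LHS]mulmxA (mulmx1C UU) mulmx1.
    by rewrite [RHS]ip_gact_unitary //; exact: gact_symbil.
  by rewrite -FE; apply: F_min_ext.
have F0 : io (F U0 b0) = \sum_(l : 'I_n * 'I_n * 'I_n) `|nu2 (e_ l.1.1) (e_ l.1.2) l.2 0| ^+ 2.
  rewrite ip_F // -gactM // -/nu1 -(ip_gact_unitary s1 s1 (_ : adj (adj V) *m adj V = 1%:M)) ?adjK //.
  rewrite -/nu2 /ip pair_big; under eq_bigr do rewrite /dotv; rewrite pair_big /=.
  by apply: eq_bigr => l _; rewrite normCK.
(* The norm along [s] is a sum of exponentials with its minimum at [s = 0]. The vanishing derivative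
   says [tr (M Z) = 0], and [tr (M Z) = tr (Z^2)] because [Z] is the traceless part of [M]. *)
have crit := @expR_sum_critical R _ (fun l : 'I_n * 'I_n * 'I_n => sq (nu2 (e_ l.1.1) (e_ l.1.2) l.2 0))
  (fun l => 2 * (al l.2 - al l.1.1 - al l.1.2)).
have {}crit : \sum_(l : 'I_n * 'I_n * 'I_n) 2 * (al l.2 - al l.1.1 - al l.1.2) *
    sq (nu2 (e_ l.1.1) (e_ l.1.2) l.2 0) = 0.
  apply: crit => s; have := main s; congr (is_true (_ <= _)).
    apply: (io_inj (io := io)); rewrite F0 rmorph_sum; apply: eq_bigr => l _.
    by rewrite sqE.
  apply: (io_inj (io := io)); rewrite reE ip_Ed //.
  set x := \sum_i _; have -> : 'Re x = x.
    apply/Creal_ReP; apply: ger0_real; do 3!(apply: sumr_ge0 => ? _).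
    by rewrite mulr_ge0 ?exprn_ge0 // io_ge0 expR_ge0.
  rewrite /x pair_big pair_big /= rmorph_sum /=; apply: eq_bigr => l _.
  rewrite rmorphM /= sqE; congr (io (expR _) * _); rewrite /al'; ring.
have : ip (lact (dg (fun i => io (al i))) nu2) nu2 = 0.
  have n2 : 2 != 0 :> C by rewrite pnatr_eq0.
  apply: (mulfI n2); rewrite mulr0 -(rmorph0 io) -crit rmorph_sum ip_diag //.
  rewrite pair_big pair_big mulr_sumr /=; apply: eq_bigr => l _.
  by rewrite !rmorphM !rmorphB /= sqE rmorph_nat mulrA.
rewrite -Mm_tr // Mm_gact_unitary ?adjK // => tr0.
apply: Mm0_eq0_balanced; rewrite -/Z.
have ZV : Z = V *m dg (fun i => io (al i)) *m adj V.
  by rewrite -VZ !mulmxA VV' mul1mx -mulmxA VV' mulmx1.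
have MZ : Mm nu1 = Z + (\tr (Mm nu1) / n%:R)%:M by rewrite /Z /Mm0 subrK.
have al2 : \sum_i io (al i) ^+ 2 = 0.
  move: tr0; rewrite MZ mulmxDr mulmxDl VZ mul_mx_scalar -scalemxAl VV mulmxDl.
  rewrite raddfD /= dg_mul dg_tr -scalemxAl mul1mx mxtraceZ dg_tr.
  rewrite -rmorph_sum al0 rmorph0 mulr0 addr0 => h; rewrite -[RHS]h.
  by apply: eq_bigr => i _; rewrite expr2.
rewrite ZV (_ : dg _ = 0) ?mulmx0 ?mul0mx //.
apply/matrixP => i j; rewrite !mxE.
have -> : io (al i) = 0; last by rewrite mul0rn.
apply/eqP; rewrite -sqrf_eq0; apply/eqP; move/eqP: al2; rewrite psumr_eq0 => [/allP/(_ i (mem_index_enum _)) /eqP //|l _].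
by rewrite -rmorphXn io_ge0 sqr_ge0.
Qed.

End Minimizer.

Section Transport.
Variables (C : numClosedFieldType) (n : nat) (g : 'M[C]_n) (mu : 'cV[C]_n -> 'cV[C]_n -> 'cV[C]_n).
Hypothesis ug : g \in unitmx.

Lemma gact_jordan_id : jordan_id mu -> jordan_id (gact g mu).
Proof. by move=> muj a b; rewrite /gact !mulKmx // muj. Qed.

Lemma gact_kap : symbil mu -> forall a b, kap (gact g mu) a b = kap mu (invmx g *m a) (invmx g *m b).
Proof.
move=> mus a b; have LE c : Lm (gact g mu) c = g *m Lm mu (invmx g *m c) *m invmx g.
  by apply: cV_mx_eq => v; rewrite (LmE (gact_symbil g mus)) -!mulmxA (LmE mus).
by rewrite /kap !LE -[\tr _]/(\tr (_ *m _)) -!mulmxA mxtrace_mulC !mulmxA !(mulmxKV ug).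
Qed.

Lemma gact_kap_nondeg : symbil mu -> kap_nondeg mu -> kap_nondeg (gact g mu).
Proof.
move=> mus nd x x0; have : invmx g *m x = 0.
  by apply: nd => y; rewrite -(mulKmx ug y) -gact_kap.
by move=> /(congr1 (mulmx g)); rewrite mulKVmx // mulmx0.
Qed.

End Transport.

(** * Maximal diagonal tori and balanced points *)

Section NondegenerateBalanced.
Variables (R : realType) (C : numClosedFieldType) (io : {rmorphism R -> C}).
Hypothesis io_real : forall z : C, z \is Num.real -> exists r, z = io r.
Hypothesis io_ge0 : forall r, (0 <= io r) = (0 <= r).
Variables (n : nat) (n_gt0 : (0 < n)%N) (mu : 'cV[C]_n -> 'cV[C]_n -> 'cV[C]_n).
Hypotheses (mus : symbil mu) (muj : jordan_id mu) (nd : kap_nondeg mu).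
Notation e_ i := (delta_mx i 0 : 'cV[C]_n).

(** Independent commuting Hermitian derivations, put in diagonal form with the rows of [Th] as
    diagonals. The matrix [g] is part of the data so that maximality refers to the whole orbit; the
    rank is at most [n]. *)
Definition diag_torus (m : nat) (g : 'M[C]_n) (Th : 'M[R]_(m, n)) :=
  [/\ g \in unitmx, row_free Th & forall k, derivation (gact g mu) (dg (fun i => io (Th k i)))].

Lemma max_diag_torus : exists m g (Th : 'M[R]_(m, n)), diag_torus g Th /\
  forall g' (Th' : 'M[R]_(m.+1, n)), ~ diag_torus g' Th'.
Proof.
pose P m := `[< exists g (Th : 'M[R]_(m, n)), diag_torus g Th >].
have P0 : exists m, P m.
  exists 0; apply/asboolP; exists 1%:M, 0; split; first exact: unitmx1.
    by rewrite /row_free mxrank0.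
  by case.
have Pn m : P m -> (m <= n)%N.
  by move=> /asboolP[g [Th [_ /eqP rT _]]]; have := rank_leq_col Th; rewrite rT.
case: (ex_maxnP P0 Pn) => m /asboolP[g [Th tT]] mm; exists m, g, Th; split=> // g' Th' t'.
have : P m.+1 by apply/asboolP; exists g', Th'.
by move=> /mm; rewrite ltnn.
Qed.

Lemma nondegenerate_balanced : exists2 g, g \in unitmx & balanced (gact g mu).
Proof.
have [m [g [Th [[ug fT dT] maxT]]]] := max_diag_torus.
set nu := gact g mu in dT.
have nus : symbil nu := gact_symbil _ mus.
have nuj : jordan_id nu by apply: gact_jordan_id.
have nnd : kap_nondeg nu by apply: gact_kap_nondeg.
pose T k := dg (fun i => io (Th k i)).
have Tth k : adj (T k) = T k.
  by rewrite /T adj_dg; congr dg; apply/funext => i; apply: conj_Creal; apply: ioR.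
have Tc k l : T k *m T l = T l *m T k by apply: dg_comm.
have Ttr k : \tr (T k) = 0 := derivation_traceless nus nnd (dT k).
have feas1 : feasible io T 1%:M 0.
  split=> [|k i j ij||k]; first by rewrite adj1 mul1mx.
  - by rewrite adj1 mul1mx mulmx1 mxE (negPf ij).
  - by rewrite big1 // => i _; rewrite mxE.
  - by rewrite big1 // => i _; rewrite mxE rmorph0 mul0r.
have [|U0 [b0 [fU0 mU0]]] := F_min io_real io_ge0 nus feas1; last first.
  have /(_ dT) := minimizer_balanced io_ge0 n_gt0 nus Tth Tc _ Ttr fU0 mU0.
  have [UU _ _ _] := fU0; have [_ uaU] := unitary_unit UU.
  rewrite /nu gactM // ?unitmx_mul ?Ed_unit ?uaU // => bal.
  by eexists; last exact: bal; rewrite !unitmx_mul Ed_unit uaU ug.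
(* A direction [b] along which no structure constant grows meets the hypotheses of [ray_derivation].
   Conjugation by [invmx p] turns the derivation found there into the diagonal matrix of [b] and
   fixes the old ones, which commute with [p]: the torus would have rank [m.+1]. *)
move=> U b fU b0; apply: contrapT => noray.
have [UU dU bs bT] := fU; have [uU uaU] := unitary_unit UU.
pose nu' := gact (adj U) nu; have nus' : symbil nu' := gact_symbil _ nus.
have TE k : adj U *m T k *m U = dg (fun i => io (tw io_real T U k i)) := TdiagE io_real Tth k dU.
have dT' k : derivation nu' (dg (fun i => io (tw io_real T U k i))).
  have := derivation_gact uaU (dT k).
  by rewrite unitary_inv ?adjK ?(mulmx1C UU) // -/(T k) TE.
have [i j k nz|p [up dp cp]] := ray_derivation nus' (gact_jordan_id uaU nuj)
    (gact_kap_nondeg uaU nus nnd) io bs.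
  rewrite leNgt; apply/negP => lt; apply: noray; exists (i, j, k); split.
    by rewrite /sc /= -gact_unitaryE.
  by rewrite /wt /=; move: lt; lra.
pose Th' : 'M[R]_(m.+1, n) := col_mx b (\matrix_(k, i) tw io_real T U k i).
have upi : invmx p \in unitmx by rewrite unitmx_inv.
apply: (maxT (invmx p *m (adj U *m g)) Th'); split.
- by rewrite !unitmx_mul upi uaU ug.
(* Independence: [b] is orthogonal to the old diagonals by feasibility, and these are independent
   because the [T k] are. *)
- pose W : 'M[R]_(m, n) := \matrix_(k, i) tw io_real T U k i.
  have Wb : W *m b^T = 0.
    apply/colP => k; apply: (io_inj (io := io)); have h := bT k; rewrite TE in h.
    by rewrite mxE rmorph_sum [in RHS]mxE rmorph0 -[RHS]h; apply: eq_bigr => i _; rewrite !mxE eqxx mulr1n rmorphM mulrC.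
  have fW : row_free W.
    apply: inj_row_free => v vW.
    have sT0 : \sum_k io (v 0 k) *: T k = 0.
      have s0 : \sum_k io (v 0 k) *: (adj U *m T k *m U) = 0.
        apply/matrixP => i j; rewrite summxE [RHS]mxE.
        under eq_bigr do rewrite TE !mxE.
        case: (i == j); last by rewrite big1 // => k _; rewrite mulr0n mulr0.
        move/rowP: vW => /(_ i)/(congr1 io); rewrite !mxE rmorph_sum rmorph0 => h.
        by rewrite -[RHS]h; apply: eq_bigr => k _; rewrite !mxE mulr1n rmorphM.
      have UU' := mulmx1C UU.
      transitivity (U *m (\sum_k io (v 0 k) *: (adj U *m T k *m U)) *m adj U); last by rewrite s0 mulmx0 mul0mx.
      rewrite mulmx_sumr mulmx_suml; apply: eq_bigr => k _.
      by rewrite -scalemxAr -scalemxAl !mulmxA UU' mul1mx -mulmxA UU' mulmx1.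
    apply: (row_free_inj fT); rewrite mul0mx; apply/rowP => i; apply: (io_inj (io := io)).
    move/matrixP/(_ i i): sT0; rewrite summxE !mxE rmorph_sum rmorph0 => h; rewrite -[RHS]h.
    by apply: eq_bigr => k _; rewrite !mxE eqxx mulr1n rmorphM.
  apply: inj_row_free => v; rewrite -[v](@hsubmxK _ 1 1 m) /Th' (@mul_row_col _ 1 1 m n) -/W.
  move: (lsubmx _) (rsubmx _) => v1 v2 e.
  have v10 : v1 = 0.
    move/(congr1 (fun x => x *m b^T)): (e); rewrite mulmxDl -!mulmxA Wb mulmx0 addr0 mul0mx.
    rewrite [v1]mx11_scalar mul_scalar_mx => /matrixP/(_ 0 0); rewrite !mxE => /eqP.
    rewrite mulf_eq0 => /orP[/eqP ->|]; first by rewrite raddf0.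
    move=> bb; case/negP: b0; apply/eqP/rowP => i; rewrite [RHS]mxE; apply/eqP.
    rewrite -sqrf_eq0; move: bb; rewrite psumr_eq0 => [/allP/(_ i (mem_index_enum _))|l _].
      by rewrite /= mxE -expr2.
    by rewrite mxE -expr2 sqr_ge0.
  move: e; rewrite v10 mul0mx add0r => e; have -> : v2 = 0 by apply: (row_free_inj fW); rewrite mul0mx.
  by rewrite row_mx0.
have -> : gact (invmx p *m (adj U *m g)) mu = gact (invmx p) nu'.
  by rewrite /nu' /nu !gactM ?unitmx_mul ?upi ?uaU // mulmxA.
move=> k; case: (@split_ordP 1 m k) => k' ->.
  have -> : dg (fun i => io (Th' (lshift m k') i)) = invmx p *m (p *m dg (fun i => io (b 0 i)) *m invmx p) *m invmx (invmx p).
    rewrite invmxK !mulmxA mulVmx // mul1mx mulmxKV //; congr dg; apply/funext => i.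
    by rewrite /Th' (@col_mxEu _ 1 m n) ord1.
  exact: derivation_gact.
have -> : dg (fun i => io (Th' (rshift 1 k') i)) = invmx p *m dg (fun i => io (tw io_real T U k' i)) *m invmx (invmx p).
  rewrite invmxK -mulmxA -cp // mulmxA mulVmx // mul1mx; congr dg; apply/funext => i.
  by rewrite /Th' (@col_mxEd _ 1 m n) mxE.
exact: derivation_gact.
Qed.

End NondegenerateBalanced.

(** * Critical points of the energy *)

Section CriticalPoints.
Variables (R : realType) (C : numClosedFieldType) (io : {rmorphism R -> C}).
Hypothesis io_real : forall z : C, z \is Num.real -> exists r, z = io r.
Hypothesis io_ge0 : forall r, (0 <= io r) = (0 <= r).
Variable n : nat.
Implicit Types mu nu : 'cV[C]_n -> 'cV[C]_n -> 'cV[C]_n.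
Local Notation re := (re io_real).

Definition shift mu nu (t : R) : 'cV[C]_n -> 'cV[C]_n -> 'cV[C]_n := fun a b => mu a b + io t *: nu a b.

Lemma shift_symbil mu nu t : symbil mu -> symbil nu -> symbil (shift mu nu t).
Proof.
move=> mus nus; split=> [a c x y|a b]; last by rewrite /shift (muC mus) (muC nus).
rewrite /shift !mus.1 !nus.1 !scalerDr addrACA; congr (_ + _ + _).
by rewrite !scalerA mulrC.
Qed.

Lemma lact_shift A mu nu t a b : lact A (shift mu nu t) a b = shift (lact A mu) (lact A nu) t a b.
Proof.
rewrite /shift /lact mulmxDr -scalemxAr.
move: (A *m _) (mu _ b) (mu a _) (A *m _) (nu _ b) (nu a _) => u v w u' v' w'.
by apply/colP => i; rewrite !mxE; ring.
Qed.

Lemma ip_shift f g h k t : ip (shift f g t) (shift h k t) =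
  ip f h + io t * (ip f k + ip g h) + io t ^+ 2 * ip g k.
Proof.
have cio : (io t)^* = io t by apply: conj_Creal; apply: ioR.
rewrite {1}/shift ipDl ipZl ![ip _ (shift _ _ _)]ipC /shift !ipDl !ipZl !rmorphD !rmorphM /= cio -!ipC.
ring.
Qed.

(** The polarization of the quadratic map [Mm]: the coefficient of [t] in [Mm_shift]. *)
Definition Mpol mu nu : 'M[C]_n :=
  \matrix_(k, l) (ip (lact (delta_mx l k) mu) nu + ip (lact (delta_mx l k) nu) mu).

Lemma Mm_shift mu nu t : Mm (shift mu nu t) = Mm mu + io t *: Mpol mu nu + io t ^+ 2 *: Mm nu.
Proof.
apply/matrixP => k l; rewrite !mxE -ip_shift; apply: ip_ext => // a b; exact: lact_shift.
Qed.

Lemma Mpol_tr A mu nu : symbil mu -> symbil nu ->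
  \tr (Mpol mu nu *m A) = ip (lact A mu) nu + ip (lact A nu) mu.
Proof.
move=> mus nus; have := Mm_tr A (shift_symbil 1 mus nus).
rewrite Mm_shift !mulmxDl rmorph1 expr1n !scale1r !raddfD /= !Mm_tr //.
rewrite (ip_ext (lact_shift A mu nu 1) (fun a b => erefl)) ip_shift rmorph1 expr1n !mul1r.
by move=> /addIr /addrI.
Qed.

Definition energy_at mu : R := re (\tr (Mm mu *m Mm mu) / ip mu mu ^+ 2).

(** Along a line, [tr (M^2)] is a quartic and [ip mu mu] a quadratic polynomial in [t]. *)
Lemma is_derive_quot (p0 p1 p2 p3 p4 q0 q1 q2 : R) : q0 != 0 ->
  is_derive (0 : R) (1 : R) (fun t : R => (p0 + t * p1 + t ^+ 2 * p2 + t ^+ 3 * p3 + t ^+ 4 * p4) /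
    (q0 + t * q1 + t ^+ 2 * q2) ^+ 2) ((p1 * q0 - p0 * q1 * 2) / q0 ^+ 3).
Proof.
move=> q00.
pose p : {poly R} := p0%:P + p1 *: 'X + p2 *: 'X^2 + p3 *: 'X^3 + p4 *: 'X^4.
pose q : {poly R} := q0%:P + q1 *: 'X + q2 *: 'X^2.
have pE t : p.[t] = p0 + t * p1 + t ^+ 2 * p2 + t ^+ 3 * p3 + t ^+ 4 * p4.
  rewrite !(hornerD, hornerZ, hornerC, hornerX, hornerXn); ring.
have qE t : (q ^+ 2).[t] = (q0 + t * q1 + t ^+ 2 * q2) ^+ 2 by rewrite horner_exp !(hornerD, hornerZ, hornerC, hornerX, hornerXn); ring.
have q20 : (q ^+ 2).[0] != 0 by rewrite qE !mul0r expr0n /= mul0r !addr0 expf_neq0.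
have h : is_derive (0 : R) (1 : R) (horner p * (fun t => (q ^+ 2).[t]^-1)) (p.[0] *: (- (q ^+ 2).[0] ^- 2 *: (q ^+ 2)^`().[0]) + (q ^+ 2).[0]^-1 *: p^`().[0]).
  by apply: is_deriveM; apply: is_deriveV.
rewrite (_ : (fun t : R => _ / _) = horner p * (fun t => (q ^+ 2).[t]^-1)); last first.
  by apply/funext => t; rewrite -pE -qE.
apply: (is_derive_eq h).
have p'0 : p^`().[0] = p1.
  by rewrite horner_coef0 coef_deriv !(coefD, coefZ, coefC, coefX, coefXn) /=; ring.
have q'0 : (q ^+ 2)^`().[0] = 2 * q0 * q1.
  rewrite expr2 derivM hornerD !hornerM !horner_coef0 coef_deriv !(coefD, coefZ, coefC, coefX, coefXn) /=.
  by ring.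
rewrite pE qE p'0 q'0 !mul0r !expr0n /= !mul0r !addr0 -![_ *: _]/(_ * _).
by field.
Qed.

(** Up to a positive factor the gradient of the energy is [ip mu mu] times [lact M mu] minus
    [tr (M^2)] times [mu]. The 4 is a product of two factors 2, one from differentiating a square
    and one from [z + z^* = 2 Re z]. *)
Lemma energy_derive mu nu : symbil mu -> symbil nu -> ip mu mu != 0 ->
  exists v, is_derive (0 : R) (1 : R) (fun t => energy_at (shift mu nu t)) v /\
    io v * ip mu mu ^+ 3 =
    4 * 'Re (ip mu mu * ip (lact (Mm mu) mu) nu - \tr (Mm mu *m Mm mu) * ip mu nu).
Proof.
move=> mus nus q0.
have M0h := Mm_herm mus; have M2h := Mm_herm nus.
set M0 := Mm mu in M0h *; set M2 := Mm nu in M2h *; set M1 := Mpol mu nu.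
pose P := (fun X Y : 'M[C]_n => \tr (X *m Y)).
pose v := (re (2 * P M0 M1) * re (ip mu mu) - re (P M0 M0) * re (ip mu nu + ip nu mu) * 2) / re (ip mu mu) ^+ 3.
have rq (x : 'cV[C]_n -> 'cV[C]_n -> 'cV[C]_n) : symbil x -> io (re (ip x x)) = ip x x.
  by move=> xs; rewrite reE; apply/Creal_ReP; apply: ger0_real; apply: ip_ge0.
have rq0 : re (ip mu mu) != 0.
  by apply: contraNneq q0 => h; rewrite -(rq mu) // h rmorph0.
exists v; split.
  have -> : (fun t => energy_at (shift mu nu t)) = (fun t : R =>
     (re (P M0 M0) + t * re (2 * P M0 M1) + t ^+ 2 * re (P M1 M1 + 2 * P M0 M2) + t ^+ 3 * re (2 * P M1 M2)
      + t ^+ 4 * re (P M2 M2)) /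
     (re (ip mu mu) + t * re (ip mu nu + ip nu mu) + t ^+ 2 * re (ip nu nu)) ^+ 2).
    apply/funext => t; rewrite /energy_at.
    have reZ s z : re (io s * z) = s * re z by rewrite reM re_io // im_io // mul0r subr0.
    have -> : ip (shift mu nu t) (shift mu nu t) = io (re (ip (shift mu nu t) (shift mu nu t))).
      by rewrite rq //; apply: shift_symbil.
    rewrite -rmorphXn -fmorphV mulrC reZ mulrC; congr (_ / _ ^+ 2); last first.
      by rewrite ip_shift -rmorphXn !reD !reZ reD.
    rewrite -!reZ -!reD; congr re; rewrite Mm_shift -/M0 -/M1 -/M2 /P.
    rewrite !mulmxDl !mulmxDr -!scalemxAl -!scalemxAr !raddfD /= !mxtraceZ !rmorphXn /=.
    rewrite (mxtrace_mulC M1 M0) (mxtrace_mulC M2 M0) (mxtrace_mulC M2 M1); ring.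
  exact: is_derive_quot.
have iv : io v * io (re (ip mu mu)) ^+ 3 = io (re (2 * P M0 M1) * re (ip mu mu) - re (P M0 M0) * re (ip mu nu + ip nu mu) * 2).
  by rewrite -rmorphXn -rmorphM /v mulfVK // expf_neq0.
rewrite -rq // iv rmorphB !rmorphM rmorph_nat /= !reE.
have conjD z : z + z^* = 2 * 'Re z :> C.
  by rewrite {1 2}[z]Crect conjC_rect ?Creal_Re ?Creal_Im //; ring.
have P00 : P M0 M0 \is Num.real by rewrite /P -{2}M0h ger0_real // tr_adj_ge0.
have -> : P M0 M1 = 2 * 'Re (ip (lact M0 mu) nu).
  by rewrite /P mxtrace_mulC Mpol_tr // (ip_lact_adj _ nus) // M0h [X in _ + X]ipC conjD.
have ReM (x z : C) : x \is Num.real -> 'Re (x * z) = x * 'Re z by move=> xr; rewrite ReMl.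
have Rer z : 'Re ('Re z) = 'Re z :> C by apply/Creal_ReP/Creal_Re.
rewrite [ip nu mu]ipC conjD raddfB /= -/(P M0 M0).
rewrite !ReM ?Creal_Re ?realn ?Rer //; have /Creal_ReP -> := P00.
ring.
Qed.

Definition critical mu := forall nu, symbil nu ->
  is_derive (0 : R) (1 : R) (fun t => energy_at (shift mu nu t)) 0.

(** The gradient [X] itself is taken as test direction, so [X = 0]. Since scalars [c] act on [mu] by
    [- c], this says that [M + tr (M^2) / ip mu mu] annihilates [mu], that is, is a derivation. *)
Lemma critical_balanced mu : (0 < n)%N -> symbil mu -> kap_nondeg mu -> (exists a b, mu a b <> 0) ->
  critical mu -> balanced mu.
Proof.
move=> n_gt0 mus nd nz crit; have [a0 [b0 ab0]] := nz.
have q0 : ip mu mu != 0 by apply/eqP => /(ip_eq0 mus) h; apply: ab0.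
apply: derivation_balanced => // a b.
set tt := \tr (Mm mu *m Mm mu) in crit *.
pose X a b := ip mu mu *: lact (Mm mu) mu a b + (- tt) *: mu a b.
have Xs : symbil X.
  split=> [a' c x y|a' b']; last by rewrite /X (muC (lact_symbil _ mus)) (muC mus).
  rewrite /X (lact_symbil _ mus).1 mus.1 !scalerDr addrACA; congr (_ + _ + _);
    by rewrite !scalerA ![c * _]mulrC.
have X0 : ip X X = 0.
  have [v [dv vE]] := energy_derive mus Xs q0.
  have v0 : v = 0 by rewrite -(@derive_val _ _ _ _ _ _ _ dv) (@derive_val _ _ _ _ _ _ _ (crit X Xs)).
  move: vE; rewrite v0 rmorph0 mul0r => /esym/eqP; rewrite mulf_eq0 pnatr_eq0 /= => /eqP.
  rewrite -/tt -mulNr -!ipZl -ipDl -/X.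
  by have /Creal_ReP -> : ip X X \is Num.real by rewrite ger0_real // ip_ge0.
have := ip_eq0 Xs X0 a b; rewrite /X /lact => /(congr1 (fun v => (ip mu mu)^-1 *: v)).
rewrite scaler0 scalerDr !scalerA mulVf // scale1r => e.
rewrite !mulmxDl !mul_scalar_mx (muDl mus) (muZl mus) (muDr mus) (muZr mus).
apply/eqP; rewrite -subr_eq0 -[X in _ == X]e; apply/eqP.
move: (Mm mu *m mu a b) (mu (Mm mu *m a) b) (mu a (Mm mu *m b)) (mu a b) => u1 u2 u3 u4.
by apply/colP => i; rewrite !mxE; ring.
Qed.

(** If [M = c], it acts on [mu] by [- c], and [tr (M^2) = - c * ip mu mu]; the two terms of the
    gradient cancel. *)
Lemma balanced_critical mu : symbil mu -> ip mu mu != 0 -> balanced mu -> critical mu.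
Proof.
move=> mus q0 [c Mc] nu nus; have [v [dv vE]] := energy_derive mus nus q0.
suff e : v = 0 by rewrite e in dv; exact: dv.
have lE : ip (lact (Mm mu) mu) nu = - c * ip mu nu.
  rewrite -ipZl; apply: ip_ext => // a b.
  by rewrite /lact Mc !mul_scalar_mx (muZl mus) (muZr mus) addrAC subrr sub0r scaleNr.
have tE : \tr (Mm mu *m Mm mu) = - c * ip mu mu.
  by rewrite {1}Mc mul_scalar_mx mxtraceZ Mm_trace // mulrN mulNr.
move: vE; rewrite lE tE (_ : _ - _ = 0); [rewrite raddf0 mulr0 => /eqP|by ring].
by rewrite mulf_eq0 expf_eq0 (negPf q0) orbF fmorph_eq0 => /eqP.
Qed.


Lemma energy_atE mu : (0 < n)%N -> symbil mu -> ip mu mu != 0 ->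
  io (energy_at mu) = \tr (Mm0 mu *m adj (Mm0 mu)) / ip mu mu ^+ 2 + n%:R^-1.
Proof.
move=> n_gt0 mus q0; rewrite /energy_at reE Mm_sq // mulrDl [X in _ + X]mulrAC mulfV ?expf_neq0 // mul1r.
apply/Creal_ReP; rewrite rpredD ?rpredV ?realn // rpredM ?ger0_real ?tr_adj_ge0 // invr_ge0.
exact/exprn_ge0/ip_ge0.
Qed.

Lemma energy_at_ge mu : (0 < n)%N -> symbil mu -> ip mu mu != 0 -> n%:R^-1 <= energy_at mu.
Proof.
move=> n_gt0 mus q0; rewrite -subr_ge0 -io_ge0 rmorphB fmorphV rmorph_nat energy_atE // addrK.
by rewrite divr_ge0 ?tr_adj_ge0 ?exprn_ge0 ?ip_ge0.
Qed.

Lemma energy_at_min mu : (0 < n)%N -> symbil mu -> ip mu mu != 0 ->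
  energy_at mu = n%:R^-1 <-> balanced mu.
Proof.
move=> n_gt0 mus q0; split=> [e|bal].
  have := energy_atE n_gt0 mus q0; rewrite e fmorphV rmorph_nat => /eqP.
  rewrite -subr_eq0 opprD addrCA subrr addr0 oppr_eq0 mulf_eq0 invr_eq0 expf_eq0 (negPf q0) orbF.
  by move/eqP/tr_adj_eq0/Mm0_eq0_balanced.
apply: (io_inj (io := io)).
by rewrite energy_atE // (balanced_Mm0_eq0 n_gt0 bal) mul0mx mxtrace0 mul0r add0r fmorphV rmorph_nat.
Qed.

End CriticalPoints.

(** * Orthonormal frames *)

Section Frame.
Variables (C : numClosedFieldType) (n : nat) (h : {dot 'cV[C]_n for Num.conj}) (x : n.-tuple 'cV[C]_n).
Hypothesis ox : orthonormal h x.
Local Notation e_ i := (delta_mx i 0 : 'cV[C]_n).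
Implicit Types mu nu : 'cV[C]_n -> 'cV[C]_n -> 'cV[C]_n.

Definition frame : 'M[C]_n := \matrix_(k, i) tnth x i k 0.
Local Notation X := frame.

Lemma frame_delta i : X *m e_ i = tnth x i.
Proof. by apply/colP => k; rewrite -colE !mxE. Qed.

Lemma frame_dot a b : h (X *m a) (X *m b) = dotv a b.
Proof.
have hx i j : h (tnth x i) (tnth x j) = (i == j)%:R.
  have /orthonormalP [ux hx] := ox; rewrite hx ?mem_tnth //.
  by rewrite !(tnth_nth 0) nth_uniq ?size_tuple.
have XE (c : 'cV[C]_n) : X *m c = \sum_i c i 0 *: tnth x i.
  rewrite {1}(cV_sum_delta c) mulmx_sumr; apply: eq_bigr => i _.
  by rewrite -scalemxAr frame_delta.
rewrite (XE a) linear_sumlz; apply: eq_bigr => i _ /=.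
rewrite linearZl_LR /= XE linear_sumr (bigD1 i) //= big1 => [|j ji].
  by rewrite addr0 linearZr_LR /= hx eqxx mulr1.
by rewrite linearZr_LR /= hx eq_sym (negPf ji) mulr0.
Qed.

Lemma frame_unit : X \in unitmx.
Proof.
rewrite -unitmx_tr -row_free_unit; apply: inj_row_free => v vX.
have Xv : X *m v^T = 0 by rewrite -[X]trmxK -trmx_mul vX trmx0.
have : dotv v^T v^T = 0 by rewrite -frame_dot Xv linear0l.
by move/dotvv_eq0/(congr1 trmx); rewrite trmxK trmx0.
Qed.

(** The pullback of [mu] by the frame, which turns [h] into the standard product [dotv]. *)
Definition std mu := gact (invmx X) mu.

Lemma stdK mu : gact X (std mu) = mu.
Proof. by rewrite /std gactM ?unitmx_inv ?frame_unit // mulmxV ?frame_unit // gact1. Qed.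

Lemma gact_frameK mu : std (gact X mu) = mu.
Proof. by rewrite /std gactM ?unitmx_inv ?frame_unit // mulVmx ?frame_unit // gact1. Qed.

Lemma std_delta mu i j : X *m std mu (e_ i) (e_ j) = mu (tnth x i) (tnth x j).
Proof. by rewrite /std /gact mulKVmx ?frame_unit // invmxK !frame_delta. Qed.

Lemma dotv_delta (a : 'cV[C]_n) k : dotv a (e_ k) = a k 0.
Proof.
rewrite /dotv (bigD1 k) //= !mxE !eqxx conjC1 mulr1 big1 ?addr0 // => l lk.
by rewrite !mxE (negPf lk) conjC0 mulr0.
Qed.

Lemma ip_std mu nu : ip (std mu) (std nu) = \sum_(i < n) \sum_(j < n) \sum_(k < n)
    h (mu (tnth x i) (tnth x j)) (tnth x k) *
    Num.conj (h (nu (tnth x i) (tnth x j)) (tnth x k)).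
Proof.
apply: eq_bigr => i _; apply: eq_bigr => j _; apply: eq_bigr => k _.
by rewrite -!std_delta -(frame_delta k) !frame_dot !dotv_delta.
Qed.

Lemma lact_std A mu : symbil mu -> std (lact A mu) = lact (invmx X *m A *m X) (std mu).
Proof.
move=> mus; apply/funext => a; apply/funext => b.
rewrite /std lact_gact ?unitmx_inv ?frame_unit // invmxK; congr (gact _ (lact _ _) a b).
by rewrite !mulmxA mulmxV ?frame_unit // mul1mx -mulmxA mulmxV ?frame_unit // mulmx1.
Qed.

Lemma herm_std A : (forall u v, h (A *m u) v = h u (A *m v)) <->
  adj (invmx X *m A *m X) = invmx X *m A *m X.
Proof.
set B := invmx X *m A *m X.
have AE u : A *m (X *m u) = X *m (B *m u) by rewrite /B !mulmxA mulmxV ?frame_unit // mul1mx.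
split=> [hA|hB u v].
  apply/matrixP => i j; rewrite adjE.
  have de (M : 'M[C]_n) k l : M k l = dotv (M *m e_ l) (e_ k) by rewrite dotv_delta -colE mxE.
  by rewrite !de -dotvC -!frame_dot -!AE; apply/esym/hA.
by rewrite -[u](mulKVmx frame_unit) -[v](mulKVmx frame_unit) !AE !frame_dot dotv_adj hB.
Qed.

Definition frame_Mm mu := X *m Mm (std mu) *m invmx X.

(** Uniqueness holds because the difference of two solutions is Hermitian and may be tested against
    itself. Both directions are needed to identify a matrix that is defined by choice. *)
Lemma frame_MmP mu M : symbil mu ->
  ((forall u v, h (M *m u) v = h u (M *m v)) /\
   forall A, (forall u v, h (A *m u) v = h u (A *m v)) -> \tr (M *m A) = ip (std (lact A mu)) (std mu)) <->
  M = frame_Mm mu.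
Proof.
move=> mus; have smus : symbil (std mu) := gact_symbil _ mus.
have conjK (A : 'M[C]_n) : invmx X *m (X *m A *m invmx X) *m X = A.
  by rewrite !mulmxA mulVmx ?frame_unit // mul1mx mulmxKV ?frame_unit.
have tr (A B : 'M[C]_n) : \tr (A *m B) = \tr ((invmx X *m A *m X) *m (invmx X *m B *m X)).
  by rewrite !mulmxA mulmxK ?frame_unit // [RHS]mxtrace_mulC !mulmxA mulmxV ?frame_unit // mul1mx.
have MP : (forall u v, h (frame_Mm mu *m u) v = h u (frame_Mm mu *m v)) /\ forall A,
    (forall u v, h (A *m u) v = h u (A *m v)) -> \tr (frame_Mm mu *m A) = ip (std (lact A mu)) (std mu).
  split; first by apply/herm_std; rewrite conjK Mm_herm.
  by move=> A hA; rewrite tr conjK Mm_tr // lact_std.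
split=> [[hN tN]|->] //.
have hD : forall u v, h ((M - frame_Mm mu) *m u) v = h u ((M - frame_Mm mu) *m v).
  by move=> u v; rewrite !mulmxBl linearBl linearBr /= hN MP.1.
have /tr_adj_eq0 D0 : \tr ((invmx X *m (M - frame_Mm mu) *m X) *m adj (invmx X *m (M - frame_Mm mu) *m X)) = 0.
  by rewrite (herm_std _).1 // -tr mulmxBl raddfB /= tN // MP.2 // subrr.
have : X *m (invmx X *m (M - frame_Mm mu) *m X) *m invmx X = 0 by rewrite D0 mulmx0 mul0mx.
rewrite -!mulmxA mulKVmx ?frame_unit // mulmxV ?frame_unit // mulmx1 => /eqP.
by rewrite subr_eq0 => /eqP.
Qed.

Lemma frame_Mm_sq mu (c : C) : \tr ((c^-1 *: frame_Mm mu) *m (c^-1 *: frame_Mm mu)) =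
  \tr (Mm (std mu) *m Mm (std mu)) / c ^+ 2.
Proof.
rewrite -scalemxAl -scalemxAr !mxtraceZ mulrA -expr2 exprVn mulrC; congr (_ / _).
rewrite /frame_Mm !mulmxA mulmxKV ?frame_unit // mxtrace_mulC !mulmxA mulVmx ?frame_unit //.
by rewrite mul1mx.
Qed.

Lemma std_nz mu : mu <> (fun _ _ => 0) -> exists a b, std mu a b <> 0.
Proof.
move=> nz; apply: contrapT => z; apply: nz; rewrite -(stdK mu).
apply/funext => a; apply/funext => b; rewrite /gact.
have -> : std mu (invmx X *m a) (invmx X *m b) = 0 by apply: contrapT => ne; apply: z; do 2!eexists; exact: ne.
by rewrite mulmx0.
Qed.

Lemma std_shift (R : realType) (io : {rmorphism R -> C}) mu nu t :
  std (shift io mu nu t) = shift io (std mu) (std nu) t.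
Proof. by apply/funext => a; apply/funext => b; rewrite /std /gact /shift mulmxDr -scalemxAr. Qed.

End Frame.

(** * Ideals as predicates, and a model algebra in each dimension *)

Section Models.
Variable C : numClosedFieldType.
Notation alg n := ('cV[C]_n -> 'cV[C]_n -> 'cV[C]_n).

Lemma simple_algP n (mu : alg n) : simple_alg mu <->
  [/\ symbil mu, jordan_id mu, exists a b, mu a b <> 0
    & forall I : {vspace 'cV[C]_n}, (forall a x, x \in I -> mu a x \in I) -> I = 0%VS \/ I = fullv].
Proof.
split=> -[mus muj nz simp]; split=> //.
  move=> I II.
  have [->|I0] := eqVneq I 0%VS; [by left|right].
  apply/vspaceP => y; rewrite memvf.
  apply: (simp (fun x => x \in I)); first by split=> //; split; [exact: mem0v|exact: memvD|exact: memvZ].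
  exists (vpick I); last exact: memv_pick.
  by apply/eqP; rewrite vpick0.
move=> P [sP PP] [x x0 Px]; have [m [B [B' [_ PB]]]] := subspace_basis sP.
pose f : 'Hom('cV[C]_m, 'cV[C]_n) := linfun (mulmx B).
have fP y : y \in limg f <-> P y.
  rewrite PB; split=> [/memv_imgP[v _ ->]|[v ->]]; first by exists v; rewrite lfunE.
  by rewrite -[B *m v]/(mulmx B v) -lfunE memv_img ?memvf.
have [|I0|I1] := simp (limg f).
- by move=> a y /fP Py; apply/fP/PP.
- by case: x0; apply/eqP; rewrite -memv0 -I0; apply/fP.
- by move=> y; apply/fP; rewrite I1 memvf.
Qed.

Lemma gact_semisimple (T : Type) n (g : 'M[C]_n) (mu : alg n) : g \in unitmx ->
  semisimple_over T mu -> semisimple_over T (gact g mu).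
Proof.
move=> ug [d [nu [p [sn pm px]]]]; exists d, nu, (fun i => p i *m invmx g); split=> // [i a b|y].
  by rewrite /gact -mulmxA mulKmx // pm !mulmxA.
have [v [pv vu]] := px y; exists (g *m v); split=> [i|w pw].
  by rewrite -mulmxA mulKmx.
by rewrite (vu (invmx g *m w)) ?mulKVmx // => i; rewrite mulmxA pw.
Qed.

Lemma kap_nondeg_neq0 n (mu : alg n) : (0 < n)%N -> kap_nondeg mu -> exists a b, mu a b <> 0.
Proof.
move=> n_gt0 nd; apply: contrapT => z.
have mu0 a b : mu a b = 0 by apply: contrapT => ne; apply: z; exists a, b.
pose i0 := Ordinal n_gt0.
have : (delta_mx i0 0 : 'cV[C]_n) = 0.
  apply: nd => y; rewrite /kap (_ : Lm mu _ = 0) ?mul0r ?mxtrace0 //.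
  by apply/matrixP => i j; rewrite !mxE mu0 mxE.
by move/matrixP/(_ i0 0); rewrite !mxE !eqxx => /eqP; rewrite oner_eq0.
Qed.

(** The coordinatewise product on [C^n], a nondegenerate Jordan algebra in every dimension; it shows
    that the bound [1/n] on the energy is attained. *)
Definition cprod n : alg n := fun a b => \col_i (a i 0 * b i 0).

Lemma cprod_symbil n : symbil (@cprod n).
Proof.
by split=> [a c x y|a b]; apply/colP => i; rewrite !mxE ?mulrDr 1?mulrCA // mulrC.
Qed.

Lemma cprod_jordan_id n : jordan_id (@cprod n).
Proof. by move=> a b; apply/colP => i; rewrite !mxE; ring. Qed.

Lemma cprod_kap_nondeg n : kap_nondeg (@cprod n).
Proof.
have L (x : 'cV[C]_n) : Lm (@cprod n) x = dg (fun i => x i 0).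
  by apply/matrixP => i j; rewrite !mxE andbT mulr_natr.
move=> x x0; apply/colP => i; rewrite [RHS]mxE -[RHS](x0 (delta_mx i 0)) /kap !L.
rewrite -[\tr _]/(\tr (_ *m _)) dg_mul dg_tr (bigD1 i) //= !mxE !eqxx mulr1 big1 ?addr0 // => j ji.
by rewrite !mxE (negPf ji) mulr0.
Qed.

End Models.

(** * Translation to the definitions of the statement *)

Section Bridge.
Variables (R : realType) (n : nat) (h : {dot 'cV[R[i]]_n for Num.conj}) (x : n.-tuple 'cV[R[i]]_n).
Hypothesis ox : orthonormal h x.
Implicit Types mu nu : algebra_law R n.

Lemma jordanP m (mu : algebra_law R m) : jordan mu <-> symbil mu /\ jordan_id mu.
Proof.
split=> -[mus muj]; split=> //; first by move=> a b; have /= -> := congr1 (fun f => f b) (muj a).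
by move=> a; apply/funext => b; exact: muj.
Qed.

Lemma simple_jordanP m (mu : algebra_law R m) : simple_jordan mu <-> simple_alg mu.
Proof.
split=> [[/jordanP[mus muj] nz simp]|/simple_algP[mus muj nz simp]]; first by apply/simple_algP.
by split=> //; apply/jordanP.
Qed.

Lemma semisimple_jordanP mu : semisimple_jordan mu <-> exists k, semisimple_over 'I_k mu.
Proof.
split=> -[k [d [nu [p [sn pm px]]]]]; exists k, d, nu.
  have pE i v : (\matrix_(r, s) p i (delta_mx s 0) r 0) *m v = p i v.
    rewrite {2}(cV_sum_delta v) linear_sum; apply/colP => r; rewrite mxE summxE.
    by apply: eq_bigr => s _; rewrite linearZ !mxE mulrC.
  exists (fun i => \matrix_(r, s) p i (delta_mx s 0) r 0); split=> [i|i a b|y].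
  - exact/simple_jordanP.
  - by rewrite !pE pm.
  - by have [v [pv vu]] := px y; exists v; split=> [i|w pw]; [rewrite pE pv|apply: vu => i; rewrite -pE pw].
by exists (fun i => mulmx (p i)); split=> // i; apply/simple_jordanP.
Qed.

Lemma real_complex_real (z : R[i]) : z \is Num.real -> exists r : R, z = real_complex R r.
Proof. by move=> zr; exists (complex.Re z); rewrite /= RRe_real. Qed.

Lemma real_complex_ge0 (r : R) : (0 <= real_complex R r) = (0 <= r).
Proof. by rewrite (lecR 0 r). Qed.

Local Notation E := (energy_at real_complex_real).

Lemma alg_dot_std mu nu : alg_dot h x mu nu = ip (std x mu) (std x nu).
Proof. by rewrite (ip_std ox). Qed.

Lemma moment_matrix_std mu : symbil mu -> moment_matrix h x mu = frame_Mm x mu.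
Proof.
move=> mus; have H M : (hermitian_endo h M /\
    forall A, hermitian_endo h A -> \tr (M *m A) = alg_dot h x (lie_act A mu) mu) <-> M = frame_Mm x mu.
  rewrite -(frame_MmP ox _ mus); split=> -[hM tM]; split=> // A hA.
    by rewrite tM //; exact: alg_dot_std.
  by rewrite tM //; exact/esym/alg_dot_std.
by rewrite /moment_matrix; case: xgetP => [N -> /H|/(_ (frame_Mm x mu))[]] //; apply/H.
Qed.

Lemma energy_std mu : symbil mu -> energy h x mu = E (std x mu).
Proof.
move=> mus; apply: (@fmorph_inj _ _ (real_complex R)); rewrite reE /= complexRe.
by rewrite /normalized_moment moment_matrix_std // (frame_Mm_sq ox) alg_dot_std.
Qed.

Lemma soliton_std mu : symbil mu -> mu <> (fun _ _ => 0) ->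
  soliton h x mu <-> critical real_complex_real (std x mu).
Proof.
move=> mus nz; have key nu : symbil nu ->
    (fun t : R => energy h x (fun a b => mu a b + t%:C%C *: nu a b)) =
    (fun t => E (shift (real_complex R) (std x mu) (std x nu) t)).
  move=> nus; apply/funext => t; rewrite -std_shift -energy_std //.
  exact: shift_symbil.
split=> [[_ _ crit] nu nus|crit].
  have := crit (gact (frame x) nu) (gact_symbil _ nus); rewrite key; last exact: gact_symbil.
  by rewrite (gact_frameK ox).
by split=> // nu nus; rewrite key //; apply: crit; apply: gact_symbil.
Qed.

Lemma gact_jordan (g : 'M[R[i]]_n) mu : g \in unitmx -> jordan mu -> jordan (gact g mu).
Proof.
by move=> ug /jordanP[mus muj]; apply/jordanP; split; [exact: gact_symbil|exact: gact_jordan_id].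
Qed.

Lemma frame_inv_unit : invmx (frame x) \in unitmx.
Proof. by rewrite unitmx_inv (frame_unit ox). Qed.

Lemma std_ip_neq0 mu : symbil mu -> mu <> (fun _ _ => 0) -> ip (std x mu) (std x mu) != 0.
Proof.
move=> mus /(std_nz ox)[a [b ab]]; apply/eqP => ip0; apply: ab.
exact: (ip_eq0 (gact_symbil _ mus) ip0).
Qed.

Hypothesis n_gt0 : (0 < n)%N.

Lemma soliton_semisimpleP mu : jordan mu -> mu <> (fun _ _ => 0) ->
  soliton h x mu /\ semisimple_jordan mu <-> balanced (std x mu).
Proof.
move=> /jordanP[mus muj] nz; have smus : symbil (std x mu) := gact_symbil _ mus.
rewrite soliton_std //; split=> [[crit /semisimple_jordanP[k ss]]|bal].
  apply: critical_balanced crit => //; first exact: real_complex_ge0; last exact: (std_nz ox nz).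
  apply: gact_kap_nondeg => //; first exact: frame_inv_unit.
  exact: semisimple_kap_nondeg ss.
split; first by apply: balanced_critical => //; [exact: real_complex_ge0|exact: std_ip_neq0].
have sj : jordan_id (std x mu) := gact_jordan_id frame_inv_unit muj.
have [k ss] := semiprime_semisimple smus sj (balanced_semiprime smus (std_nz ox nz) bal).
by apply/semisimple_jordanP; exists k; rewrite -(stdK ox mu); apply: gact_semisimple (frame_unit ox) ss.
Qed.

Lemma nondegenerate_std_balanced mu : jordan mu -> kap_nondeg mu ->
  exists g, [/\ g \in unitmx, gact g mu <> (fun _ _ => 0) & balanced (std x (gact g mu))].
Proof.
move=> /jordanP[mus muj] nd.
have [g ug bal] := nondegenerate_balanced real_complex_real real_complex_ge0 n_gt0 mus muj nd.
(* The factor [frame x] cancels the pullback in [std]. *)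
have uXg : frame x *m g \in unitmx by rewrite unitmx_mul (frame_unit ox) ug.
exists (frame x *m g); split=> // [z|]; last first.
  by rewrite -gactM ?(frame_unit ox) // (gact_frameK ox).
have [a [b]] := kap_nondeg_neq0 n_gt0 (gact_kap_nondeg uXg mus nd).
by rewrite z.
Qed.

Lemma energy_is_minP mu : nonzero_jordan mu ->
  energy_is_min h x (@nonzero_jordan R n) mu <-> balanced (std x mu).
Proof.
move=> [muj nz]; have [mus _] := muj.
have energy_min nu : symbil nu -> nu <> (fun _ _ => 0) ->
    n%:R^-1 <= energy h x nu /\ (energy h x nu = n%:R^-1 <-> balanced (std x nu)).
  move=> nus nnz; have nip := std_ip_neq0 nus nnz; have snus : symbil (std x nu) := gact_symbil _ nus.
  rewrite energy_std //; split.
    exact: (energy_at_ge real_complex_real real_complex_ge0 n_gt0 snus nip).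
  exact: (energy_at_min real_complex_real n_gt0 snus nip).
have [mu_ge mu_eq] := energy_min mu mus nz; rewrite -mu_eq; split=> [[_ min]|e]; last first.
  by split=> // nu [[nus _] nnz]; rewrite e; exact: (energy_min nu nus nnz).1.
(* Some isomorphic copy of [cprod] is balanced and has energy [1/n], so a minimizer has energy at
   most [1/n], hence exactly [1/n]. *)
have cj : jordan (@cprod R[i] n).
  by apply/jordanP; split; [exact: cprod_symbil|exact: cprod_jordan_id].
have [g [ug gnz gbal]] := nondegenerate_std_balanced cj (@cprod_kap_nondeg _ n).
have gj := gact_jordan ug cj; have [_ /iffRL/(_ gbal) ge] := energy_min _ gj.1 gnz.
by apply/eqP; rewrite eq_le mu_ge andbT -ge; apply: min.
Qed.

End Bridge.

Local Open Scope complex_scope.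

Theorem theorem1p2 (R : realType) (n : nat) (n_gt0 : (0 < n)%N)
    (h : {dot 'cV[R[i]]_n for Num.conj}) (x : n.-tuple 'cV[R[i]]_n)
    (x_orthonormal : orthonormal h x) :
  (forall mu : algebra_law R n, jordan mu -> semisimple_jordan mu ->
     distinguished h x (gl_orbit mu)) /\
  (forall mu : algebra_law R n, nonzero_jordan mu ->
     (energy_is_min h x (@nonzero_jordan R n) mu <->
      soliton h x mu /\ semisimple_jordan mu)).
Proof.
split=> [mu muj ss|mu munz].
  have [k sk] := (semisimple_jordanP mu).1 ss.
  have [g [ug gnz gbal]] :=
    nondegenerate_std_balanced x_orthonormal n_gt0 muj (semisimple_kap_nondeg muj.1 sk).
  exists (gact g mu); first by exists g.
  by have [] := (soliton_semisimpleP x_orthonormal n_gt0 (gact_jordan ug muj) gnz).2 gbal.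
by rewrite (energy_is_minP x_orthonormal n_gt0 munz) (soliton_semisimpleP x_orthonormal n_gt0 munz.1 munz.2).
Qed.
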